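(* Let $V_0\in L^2(\mathbb{T}^d;\mathbb{R}^d)$ be a divergence-free vector field of zero spatial mean with $\nabla V_0\in L^2(\mathbb{T}^d;\mathbb{R}^{d\times d})$, and let $\nu_0>0$. For $\nu\in(0,\nu_0]$ let $(\mathbb{E}^\nu,B^\nu,\chi^\nu)$ be a minimiser of $\widetilde{\mathcal{A}^\nu_{NS}}$. Then there exist a sequence $\nu_k\to0^+$ and a minimiser $(\mathbb{E}^0,B^0,\chi^0)$ of $\widetilde{\mathcal{A}^0_{NS}}$ such that, as $k\to\infty$, $$(\mathbb{E}^{\nu_k},B^{\nu_k},\chi^{\nu_k})\to(\mathbb{E}^0,B^0,\chi^0)\quad\text{in }\ \widetilde{\mathcal{EB}\Psi_{2,\infty,2}}^{w}(\nu_0).$$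
   Context: Here $d\in\{2,3\}$, $\mathbb{T}^d=\mathbb{R}^d/\mathbb{Z}^d$, $T>0$, $a_V>0$, $a_W>0$, $\bar V\in L^2(0,T;L^2(\mathbb{T}^d;\mathbb{R}^d))$, $\bar W\in L^2(0,T;L^2(\mathbb{T}^d;\mathbb{R}^{d\times d}))$ are fixed, $\alpha$ is a fixed exponent with $0<\alpha<\frac{1}{[d/2]+4}$ ($[\cdot]$ the integer part), with $0^\alpha=0$, repeated indices are summed from $1$ to $d$, and $\partial_i$, $\nabla$, $\Delta$ act in the space variable; $\Delta^{-1}$ is the inverse Laplacian on mean-zero functions/distributions on $\mathbb{T}^d$. For $\nu\ge0$, $\mathcal{EB}\Psi^\nu_{2,\infty,2}$ is the class of all triples $(\mathbb{E},B,\chi)$ in $L^2\times L^\infty\times L^2$ on $[0,T]\times\mathbb{T}^d$, with $\mathbb{E}$ valued in $\mathbb{R}^d$ and $B,\chi$ valued in symmetric $d\times d$ matrices, satisfying weakly, together with $B(T,\cdot)\equiv0$, $$\partial_tB_{ij}=\tfrac12(\partial_j\mathbb{E}_i+\partial_i\mathbb{E}_j)-\partial_i\partial_j\Delta^{-1}(\partial_l\mathbb{E}_l-2\nu\,\partial_l\partial_k\chi_{lk})-\nu(\partial_j\partial_l\chi_{li}+\partial_i\partial_l\chi_{lj}),$$ that is, for every smooth symmetric-matrix-valued $\psi$ on $[0,T]\times\mathbb{T}^d$ with $\psi(0,\cdot)=0$, $$-\int_0^T\!\!\int_{\mathbb{T}^d}B_{ij}\partial_t\psi_{ij}=\int_0^T\!\!\int_{\mathbb{T}^d}\Big(-\mathbb{E}_i\partial_j\psi_{ij}+\mathbb{E}_l\partial_l\Delta^{-1}\partial_i\partial_j\psi_{ij}+2\nu\chi_{lk}\partial_l\partial_k\Delta^{-1}\partial_i\partial_j\psi_{ij}-2\nu\chi_{li}\partial_l\partial_j\psi_{ij}\Big).$$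 Put $\widetilde{\mathcal{EB}\Psi_{2,\infty,2}}:=\bigcup_{\nu\ge0}\mathcal{EB}\Psi^\nu_{2,\infty,2}$. With $\|\cdot\|$ the $L^2(0,T;L^2(\mathbb{T}^d))$ norm (time-independent $V_0,\nabla V_0$ being viewed as functions of $(t,x)$) and $a_\nu:=a_V+\nu^\alpha$, set $$b_{\mathbb{E}}(\nu)=\tfrac85a_\nu^2(3+d)\|\bar V\|^2+\tfrac{56}5d\,a_Wa_\nu\|\bar W\|^2+\tfrac{64}5d^2a_\nu^2\|V_0\|^2+\tfrac{128}5d\,a_\nu a_W\nu^2\|\nabla V_0\|^2+\tfrac{12a_\nu^3}{5a_W}(d-1)^2d^2|\mathbb{T}^d|T,$$ $$b_\chi(\nu)=\tfrac{2(3+d)}d a_\nu a_W\|\bar V\|^2+14a_W^2\|\bar W\|^2+16d\,a_\nu a_W\|V_0\|^2+32a_W^2\nu^2\|\nabla V_0\|^2+3a_\nu^2(d-1)^2d\,|\mathbb{T}^d|T,$$ $$b_B(\nu)=\sqrt d\,\tfrac{d-1}2a_\nu,$$ and $\mathfrak{B}(\nu_0)=\{(\mathbb{E},B,\chi)\in L^2\times L^\infty\times L^2:\ \|\mathbb{E}\|^2\le b_{\mathbb{E}}(\nu_0),\ \|\chi\|^2\le b_\chi(\nu_0),\ \||B|\|_{L^\infty}\le b_B(\nu_0)\}$, where $|B|$ is the pointwise Frobenius norm. The space $\widetilde{\mathcal{EB}\Psi_{2,\infty,2}}^{w}(\nu_0):=\widetilde{\mathcal{EB}\Psi_{2,\infty,2}}\cap\mathfrak{B}(\nu_0)$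 is endowed with the weak topology of $L^2(0,T;L^2)$ for the $\mathbb{E}$ and $\chi$ components and the weak-* topology of $L^\infty(0,T;L^\infty)$ for the $B$ component (metrizable, since the set is bounded). For $\mathbb{E}\in L^2([0,T]\times\mathbb{T}^d;\mathbb{R}^d)$ and a bounded symmetric-matrix field $N$, define $$\mathcal{M}[\mathbb{E},N]:=\sup_{M\ge Z\otimes Z}\ \frac12\int_0^T\!\!\int_{\mathbb{T}^d}2\mathbb{E}_iZ^i-N_{ij}M^{ij}\,dx\,dt\in[0,+\infty],$$ the supremum over all continuous $Z:[0,T]\times\mathbb{T}^d\to\mathbb{R}^d$ and continuous symmetric-matrix-valued $M$ with $Z\otimes Z\le M$ (formally $\mathcal{M}[\mathbb{E},N]=\frac12\int_0^T\!\int_{\mathbb{T}^d}\mathbb{E}_i(N^{-1})^{ij}\mathbb{E}_j$). With $N(a,B):=a\,\mathrm{Id}+2B$, for $\nu\ge0$, $$\mathcal{A}^\nu_{NS}(\mathbb{E},B,\chi):=\mathcal{M}\big[\mathbb{E}-(a_V+\nu^\alpha)\bar V,\,N(a_V+\nu^\alpha,B)\big]+\int_0^T\!\!\int_{\mathbb{T}^d}\big(V_0^i\mathbb{E}_i+2\nu\,\partial_lV_0^i\chi_{il}\big)\,dx\,dt$$ $$+\int_0^T\!\!\int_{\mathbb{T}^d}\frac1{2a_W}|\chi-B-a_W\bar W|^2\,dx\,dt-\int_0^T\!\!\int_{\mathbb{T}^d}\frac{a_V+\nu^\alpha}{2}|\bar V|^2+\frac{a_W}{2}|\bar W|^2\,dx\,dt$$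 ($|\cdot|$ the Euclidean/Frobenius norm), and $\widetilde{\mathcal{A}^\nu_{NS}}:\widetilde{\mathcal{EB}\Psi_{2,\infty,2}}\to(-\infty,+\infty]$ equals $\mathcal{A}^\nu_{NS}$ on $\mathcal{EB}\Psi^\nu_{2,\infty,2}$ and $+\infty$ on the complement. Minimisers are taken over $\widetilde{\mathcal{EB}\Psi_{2,\infty,2}}$. *)

(* Defs.v *)
From HB Require Import structures.
From mathcomp Require Import all_boot all_order all_algebra.
From mathcomp Require Import all_classical all_reals all_analysis.
Set Implicit Arguments.
Unset Strict Implicit.
Unset Printing Implicit Defensive.
Import Order.TTheory GRing.Theory Num.Theory.
Import numFieldNormedType.Exports.
Local Open Scope classical_set_scope.
Local Open Scope ring_scope.

(* Matrices carry the sigma-algebra generated by the entries; for real entries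
   this is the Borel sigma-algebra. *)
Definition matrix_display : measure_display -> measure_display.
Proof. exact. Qed.

Section measurable_matrix.
Context {disp} {T : measurableType disp}.
Variables m n : nat.

Definition matrix_entry_preimages : set (set 'M[T]_(m, n)) :=
  [set A | exists i j, exists2 B : set T, measurable B &
    A = (fun M : 'M[T]_(m, n) => M i j) @^-1` B].

Let matrix_set0 : <<s matrix_entry_preimages >> set0.
Proof. exact: sigma_algebra0. Qed.

Let matrix_setC A : <<s matrix_entry_preimages >> A ->
  <<s matrix_entry_preimages >> (~` A).
Proof. exact: sigma_algebraC. Qed.

Let matrix_bigcup (F : _^nat) :
  (forall i, <<s matrix_entry_preimages >> (F i)) ->
  <<s matrix_entry_preimages >> (\bigcup_i (F i)).
Proof. exact: sigma_algebra_bigcup. Qed.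

HB.instance Definition _ := @isMeasurable.Build (matrix_display disp)
  'M[T]_(m, n) <<s matrix_entry_preimages >>
  matrix_set0 matrix_setC matrix_bigcup.

Lemma measurable_fun_entry i j :
  measurable_fun [set: 'M[T]_(m, n)] (fun M : 'M[T]_(m, n) => M i j).
Proof.
by move=> _ B mB; rewrite setTI; apply: sub_sigma_algebra; exists i, j, B.
Qed.

Lemma measurable_fun_matrixP disp' (S : measurableType disp')
    (f : S -> 'M[T]_(m, n)) :
  measurable_fun [set: S] f <->
  forall i j, measurable_fun [set: S] (fun x => f x i j).
Proof.
split=> [mf i j|mf].
  exact: (measurableT_comp (@measurable_fun_entry i j) mf).
move=> _; apply: measurability => //.
by move=> _ [_ [i [j [B mB ->]] <-]]; exact: mf.
Qed.

End measurable_matrix.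

Section torus_measure.
Variable R : realType.

Definition interval_measure (a b : R) : set (measurableTypeR R) -> \bar R :=
  mrestr lebesgue_measure (measurable_itv `[a, b]).

HB.instance Definition _ a b := Measure.on (interval_measure a b).

Let interval_measure_fin a b : fin_num_fun (interval_measure a b).
Proof.
apply: lty_fin_num_fun.
suff : (lebesgue_measure ([set: R] `&` `[a, b]) < +oo)%E by [].
by rewrite setTI lebesgue_measure_itv /=; case: ifP => // _; rewrite -EFinB ltry.
Qed.

HB.instance Definition _ a b := @Measure_isFinite.Build _ _ _
  (interval_measure a b) (@interval_measure_fin a b).

Definition rV_cons n (p : measurableTypeR R * 'rV[R]_n) : 'rV[R]_n.+1 :=
  row_mx (p.1%:M : 'rV[R]_1) p.2.

Lemma measurable_rV_cons n : measurable_fun setT (@rV_cons n).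
Proof.
apply/measurable_fun_matrixP => i j; rewrite /rV_cons.
case: (split_ordP (j : 'I_(1 + n))) => k ->.
  apply: (eq_measurable_fun fst) => [p _|]; last exact: measurable_fst.
  by rewrite (row_mxEl (p.1%:M : 'rV[R]_1)) !ord1 mxE eqxx.
apply: (eq_measurable_fun
    (fun p : measurableTypeR R * 'rV[R]_n => p.2 i k)) => [p _|].
  by rewrite (row_mxEr (p.1%:M : 'rV[R]_1)).
exact: (measurableT_comp (measurable_fun_entry i k) measurable_snd).
Qed.

Section cons_measure.
Variables (n : nat) (m : {finite_measure set 'rV[R]_n -> \bar R}).

Definition cons_measure : set 'rV[R]_n.+1 -> \bar R :=
  pushforward (interval_measure 0 1 \x m)%E (@rV_cons n).

Let cons_measure0 : cons_measure set0 = 0%E.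
Proof. by rewrite /cons_measure /pushforward preimage_set0 measure0. Qed.

Let cons_measure_ge0 A : (0 <= cons_measure A)%E.
Proof. by apply: measure_ge0; exact: measurable_rV_cons. Qed.

Let cons_measure_sigma_additive : semi_sigma_additive cons_measure.
Proof. apply: measure_semi_sigma_additive. exact: measurable_rV_cons. Qed.

HB.instance Definition _ := isMeasure.Build _ _ _ cons_measure
  cons_measure0 cons_measure_ge0 cons_measure_sigma_additive.

Let cons_measure_fin : fin_num_fun cons_measure.
Proof.
apply: lty_fin_num_fun.
suff : ((interval_measure 0 1 \x m) (setT `*` setT) < +oo)%E by rewrite setXTT.
rewrite product_measure1E//.
by rewrite lte_mul_pinfty// -?ge0_fin_numE// fin_num_measure.
Qed.

HB.instance Definition _ := @Measure_isFinite.Build _ _ _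
  cons_measure cons_measure_fin.

End cons_measure.

(* Lebesgue measure of the torus R^n / Z^n, carried by the cell [0, 1]^n: the
   n-fold product of Lebesgue measure on [0, 1]. Functions on the torus are
   functions on R^n; elements of Lebesgue spaces are read on the cell only,
   continuous and smooth functions are required to be Z^n-periodic. *)
Fixpoint torus_measure n : {finite_measure set 'rV[R]_n -> \bar R} :=
  if n is n'.+1 then cons_measure (torus_measure n')
  else \d_(0 : 'rV[R]_0).

Lemma torus_measureT n : torus_measure n setT = 1%E.
Proof.
elim: n => [|n IHn]; first by rewrite /= diracT.
suff : ((interval_measure 0 1 \x torus_measure n) setT = 1)%E by [].
rewrite -setXTT product_measure1E//.
suff : (lebesgue_measure ([set: R] `&` `[0, 1])%R * torus_measure n setT = 1)%E
  by [].
by rewrite setTI lebesgue_measure_itv /= lte01 oppr0 adde0 mul1e IHn.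
Qed.

Definition spacetime_measure (T : R) (d : nat) :
    {measure set (measurableTypeR R * 'rV[R]_d) -> \bar R} :=
  (interval_measure 0 T \x torus_measure d)%E.

End torus_measure.

Section lebesgue_spaces.
Variable R : realType.

Definition frob_dot m n (A B : 'M[R]_(m, n)) : R :=
  \sum_i \sum_j A i j * B i j.

(* Euclidean norm of vectors, Frobenius norm of matrices; the library's `|A|
   is the maximum norm. *)
Definition frobenius m n (A : 'M[R]_(m, n)) : R := Num.sqrt (frob_dot A A).

Context {disp} {X : measurableType disp}.
Variable mu : {measure set X -> \bar R}.

Definition in_Lp m n (p : \bar R) (F : X -> 'M[R]_(m, n)) : Prop :=
  measurable_fun setT F /\ finite_norm mu p (@frobenius m n \o F).

Definition Lp_norm m n (p : \bar R) (F : X -> 'M[R]_(m, n)) : R :=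
  fine ('N[mu]_p [EFin \o (@frobenius m n \o F)])%E.

(* Convergence against all test fields of L^q: weak convergence in L^2 for
   q = 2, weak-* convergence in L^oo for q = 1. *)
Definition cvg_against m n (q : \bar R) (F : nat -> X -> 'M[R]_(m, n))
    (G : X -> 'M[R]_(m, n)) : Prop :=
  forall phi : X -> 'M[R]_(m, n), in_Lp q phi ->
    (\int[mu]_z frob_dot (F k z) (phi z)) @[k --> \oo]
      --> \int[mu]_z frob_dot (G z) (phi z).

End lebesgue_spaces.

Section calculus.
Variable R : realType.

Fixpoint Ck (V : normedModType R) (k : nat) (f : V -> R) : Prop :=
  continuous f /\
  if k is k'.+1
  then forall v, (forall x, derivable f x v) /\ Ck k' (fun x => 'D_v f x)
  else True.

Definition smooth (V : normedModType R) (f : V -> R) : Prop :=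
  forall k, Ck k f.

Variable d : nat.

Definition basis_vec (i : 'I_d) : 'rV[R]_d := delta_mx 0 i.

Definition Zn_periodic (Y : Type) (f : 'rV[R]_d -> Y) : Prop :=
  forall i x, f (x + basis_vec i) = f x.

Definition dt (f : R * 'rV[R]_d -> R) (z : R * 'rV[R]_d) : R :=
  'D_((1, 0) : R * 'rV[R]_d) f z.

Definition dx (i : 'I_d) (f : R * 'rV[R]_d -> R) (z : R * 'rV[R]_d) : R :=
  'D_((0, basis_vec i) : R * 'rV[R]_d) f z.

Definition smooth_periodic (f : R * 'rV[R]_d -> R) : Prop :=
  smooth f /\ forall t, Zn_periodic (fun x => f (t, x)).

(* q(t, .) = Delta^-1 phi(t, .) for all t: the unique mean-zero periodic
   solution of Delta q = phi. *)
Definition is_inv_laplacian (phi q : R * 'rV[R]_d -> R) : Prop :=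
  [/\ smooth_periodic q,
      forall t, \int[torus_measure R d]_x q (t, x) = 0 &
      forall z, \sum_i dx i (dx i q) z = phi z].

Definition is_weak_gradient (V : 'rV[R]_d -> 'rV[R]_d)
    (G : 'rV[R]_d -> 'M[R]_d) : Prop :=
  forall phi : 'rV[R]_d -> R, smooth phi -> Zn_periodic phi ->
  forall i l, \int[torus_measure R d]_x (V x 0 i * 'D_(basis_vec l) phi x) =
    - (\int[torus_measure R d]_x (G x i l * phi x)).

Definition divergence_free (V : 'rV[R]_d -> 'rV[R]_d) : Prop :=
  forall phi : 'rV[R]_d -> R, smooth phi -> Zn_periodic phi ->
  \int[torus_measure R d]_x (\sum_i V x 0 i * 'D_(basis_vec i) phi x) = 0.

Definition zero_mean (V : 'rV[R]_d -> 'rV[R]_d) : Prop :=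
  forall i, \int[torus_measure R d]_x V x 0 i = 0.

End calculus.

Definition is_minimiser (R : realType) (X : Type) (S : set X) (F : X -> \bar R)
  (x : X) : Prop := S x /\ forall y, S y -> (F x <= F y)%E.

Section navier_stokes.
Variables (R : realType) (d : nat) (T : R).

Local Notation vector_field := (R * 'rV[R]_d -> 'rV[R]_d).
Local Notation matrix_field := (R * 'rV[R]_d -> 'M[R]_d).
Local Notation mu := (spacetime_measure T d).

Record dual_triple := DualTriple {
  dualE : vector_field;
  dualB : matrix_field;
  dualchi : matrix_field
}.

Definition in_L2_Loo_L2 (u : dual_triple) : Prop :=
  [/\ in_Lp mu 2%:E (dualE u), in_Lp mu +oo%E (dualB u),
      in_Lp mu 2%:E (dualchi u),
      {ae mu, forall z, (dualB u z)^T = dualB u z} &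
      {ae mu, forall z, (dualchi u z)^T = dualchi u z}].

Definition is_test_field (psi : matrix_field) : Prop :=
  [/\ forall i j, smooth_periodic (fun z => psi z i j),
      forall z, (psi z)^T = psi z & forall x, psi (0, x) = 0].

(* B(T, .) = 0 is encoded by the absence of a boundary term at time T, the
   test fields being free there. *)
Definition EBPsi (nu : R) : set dual_triple := [set u |
  in_L2_Loo_L2 u /\
  forall (psi : matrix_field) (q : R * 'rV[R]_d -> R),
    is_test_field psi ->
    is_inv_laplacian
      (fun z => \sum_i \sum_j dx i (dx j (fun y => psi y i j)) z) q ->
    let: DualTriple E B chi := u in
    - (\int[mu]_z (\sum_i \sum_j B z i j * dt (fun y => psi y i j) z)) =
    \int[mu]_z
      (- (\sum_i \sum_j E z 0 i * dx j (fun y => psi y i j) z)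
       + (\sum_l E z 0 l * dx l q z)
       + 2 * nu * (\sum_l \sum_k chi z l k * dx l (dx k q) z)
       - 2 * nu * (\sum_i \sum_j \sum_l
           chi z l i * dx l (dx j (fun y => psi y i j)) z))].

Definition EBPsi_union : set dual_triple :=
  \bigcup_(nu in [set nu : R | 0 <= nu]) EBPsi nu.

Definition psd (A : 'M[R]_d) : Prop :=
  forall xi : 'rV[R]_d, 0 <= (xi *m A *m xi^T) 0 0.

(* Continuous fields on [0, T] x torus are the restrictions of continuous
   periodic fields on R x R^d. *)
Definition admissible (Z : vector_field) (M : matrix_field) : Prop :=
  [/\ continuous Z /\ (forall t, Zn_periodic (fun x => Z (t, x))),
      continuous M /\ (forall t, Zn_periodic (fun x => M (t, x))),
      forall t x, 0 <= t <= T -> (M (t, x))^T = M (t, x) &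
      forall t x, 0 <= t <= T ->
        psd (M (t, x) - (Z (t, x))^T *m Z (t, x))].

Definition calM (E : vector_field) (N : matrix_field) : \bar R :=
  ereal_sup [set e | exists Z M, admissible Z M /\
    e = (2^-1 * \int[mu]_z (2 * frob_dot (E z) (Z z) - frob_dot (N z) (M z)))%:E].

Definition Nmx (a : R) (B : matrix_field) : matrix_field :=
  fun z => a%:M + 2 *: B z.

Variables (aV aW alpha : R) (Vbar : vector_field) (Wbar : matrix_field).
Variables (V0 : 'rV[R]_d -> 'rV[R]_d) (gradV0 : 'rV[R]_d -> 'M[R]_d).

Definition a_ (nu : R) : R := aV + nu `^ alpha.

Definition action (nu : R) (u : dual_triple) : \bar R :=
  let: DualTriple E B chi := u in
  (calM (fun z => E z - a_ nu *: Vbar z)%R (Nmx (a_ nu) B)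
   + (\int[mu]_z (frob_dot (V0 z.2) (E z)
        + 2 * nu * frob_dot (gradV0 z.2) (chi z)))%R%:E
   + (\int[mu]_z ((2 * aW)^-1
        * frobenius (chi z - B z - aW *: Wbar z) ^+ 2))%R%:E
   - (\int[mu]_z (a_ nu / 2 * frobenius (Vbar z) ^+ 2
        + aW / 2 * frobenius (Wbar z) ^+ 2))%R%:E)%E.

Definition ext_action (nu : R) (u : dual_triple) : \bar R :=
  if `[< EBPsi nu u >] then action nu u else +oo%E.

Local Notation normVbar := (Lp_norm mu 2%:E Vbar).
Local Notation normWbar := (Lp_norm mu 2%:E Wbar).
Local Notation normV0 := (Lp_norm mu 2%:E (fun z => V0 z.2)).
Local Notation normgradV0 := (Lp_norm mu 2%:E (fun z => gradV0 z.2)).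
Local Notation torus_volume := (fine (torus_measure R d setT)).
Local Notation dR := (d%:R : R).

Definition bound_E (nu : R) : R :=
  8 / 5 * a_ nu ^+ 2 * (3 + dR) * normVbar ^+ 2
  + 56 / 5 * dR * aW * a_ nu * normWbar ^+ 2
  + 64 / 5 * dR ^+ 2 * a_ nu ^+ 2 * normV0 ^+ 2
  + 128 / 5 * dR * a_ nu * aW * nu ^+ 2 * normgradV0 ^+ 2
  + 12 * a_ nu ^+ 3 / (5 * aW) * (dR - 1) ^+ 2 * dR ^+ 2 * torus_volume * T.

Definition bound_chi (nu : R) : R :=
  2 * (3 + dR) / dR * a_ nu * aW * normVbar ^+ 2
  + 14 * aW ^+ 2 * normWbar ^+ 2
  + 16 * dR * a_ nu * aW * normV0 ^+ 2
  + 32 * aW ^+ 2 * nu ^+ 2 * normgradV0 ^+ 2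
  + 3 * a_ nu ^+ 2 * (dR - 1) ^+ 2 * dR * torus_volume * T.

Definition bound_B (nu : R) : R := Num.sqrt dR * ((dR - 1) / 2) * a_ nu.

Definition bounded_set (nu0 : R) : set dual_triple := [set u |
  [/\ in_L2_Loo_L2 u,
      Lp_norm mu 2%:E (dualE u) ^+ 2 <= bound_E nu0,
      Lp_norm mu 2%:E (dualchi u) ^+ 2 <= bound_chi nu0 &
      Lp_norm mu +oo%E (dualB u) <= bound_B nu0]].

Definition EBPsi_w (nu0 : R) : set dual_triple :=
  EBPsi_union `&` bounded_set nu0.

Definition cvg_EBPsi_w (nu0 : R) (u : nat -> dual_triple)
    (l : dual_triple) : Prop :=
  [/\ forall k, EBPsi_w nu0 (u k), EBPsi_w nu0 l,
      cvg_against mu 2%:E (fun k => dualE (u k)) (dualE l),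
      cvg_against mu 1%:E (fun k => dualB (u k)) (dualB l) &
      cvg_against mu 2%:E (fun k => dualchi (u k)) (dualchi l)].

End navier_stokes.

(* Main.v *)
Require Import Defs.
From HB Require Import structures.
From mathcomp Require Import all_boot all_order all_algebra.
From mathcomp Require Import all_classical all_reals all_analysis.
From mathcomp Require Import measurable_realfun ess_sup_inf.
From mathcomp Require Import ring lra.
Set Implicit Arguments.
Unset Strict Implicit.
Unset Printing Implicit Defensive.
Import Order.TTheory GRing.Theory Num.Theory.
Import numFieldNormedType.Exports.
Local Open Scope classical_set_scope.
Local Open Scope ring_scope.

(* Fix Z and M in the definition of the action: what remains is, for each nu,
   affine in (E, B) plus a convex quadratic function of chi - B. So the bound
   "action <= c" is a family of inequalities that survive weak limits (sublevel),
   and testing with Z and M gives the a priori bounds: M = p xi (x) xi with p >= 0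
   arbitrary shows N = a Id + 2 B >= 0, and since the constraint forces tr B = 0
   (test with psi = phi Id), |N|^2 <= (tr N)^2 = (d a)^2, which bounds |B|; then
   N <= d a Id, so the kinetic part dominates |E - a Vbar|^2 / (2 d a), and
   comparison with the zero triple, whose action is at most 0, bounds E and chi.
   Hence a sequence of minimisers with nu -> 0 has a weakly convergent
   subsequence, and the constraint passes to the limit.
     For the minimality of the limit, a competitor (E, B, chi) of the nu = 0
   problem is replaced by ((1 - delta) E + 2 nu div chi', (1 - delta) B, chi') with
   chi' smooth and close to chi, which satisfies the constraint for nu. The factor
   1 - delta leaves a positive multiple of M >= Z (x) Z in the kinetic part; it
   absorbs the perturbation of E for every nu > 0. Let nu -> 0, and then chi' -> chi
   and delta -> 0. *)

(** * Square-integrable matrix fields *)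

(** The class [EBPsi nu] changes with nu, so a competitor at viscosity 0 is not one at positive
    viscosity, and correcting E by 2 nu div chi' may cost infinite kinetic energy: N = aV Id + 2 B
    is only positive semidefinite. Shrinking B gives N >= delta aV Id, for which every L^2
    perturbation of E has finite energy. Since div chi' is under no uniform control as chi' tends to
    chi, the viscosity limit has to precede the other two.

    Extended real values are confined to the supremum [calM]: all comparisons are made between
    sublevels at real c, where each pair Z, M contributes one real inequality. The constants of
    [bound_E] and [bound_chi] come from a single linear combination of squares, [energy_inequality].

    Tests use continuous or smooth periodic fields only, while the conclusions concern L^2 fields.
    The bridge is the density of explicit smooth periodic bumps, obtained from a Dynkin argument on
    quadrants and the projection theorem rather than from mollification. *)

Lemma discriminant_le (R : realFieldType) (a b c : R) : 0 <= c ->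
  (forall s, 0 <= a + 2 * s * b + s ^+ 2 * c) -> b ^+ 2 <= a * c.
Proof.
rewrite le_eqVlt => /predU1P[<- h|c0 h].
  rewrite mulr0; case: (eqVneq b 0) => [->|n0]; first by rewrite expr0n.
  (* Case c = 0 with b nonzero: the affine function takes the value -1 at this s. *)
  have := h (- (a + 1) / (2 * b)).
  have -> : 2 * (- (a + 1) / (2 * b)) * b = - (a + 1) by field.
  by lra.
(* The minimiser of the quadratic in s. *)
have := h (- b / c).
have -> : a + 2 * (- b / c) * b + (- b / c) ^+ 2 * c = a - b ^+ 2 / c.
  by field; rewrite gt_eqF.
by rewrite subr_ge0 ler_pdivrMr.
Qed.

Section frobenius_product.
Variables (R : realType) (m n : nat).
Implicit Types A B C : 'M[R]_(m, n).

Lemma frob_dotC A B : frob_dot A B = frob_dot B A.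
Proof. by do 2 apply: eq_bigr => ? _; rewrite mulrC. Qed.

Lemma frob_dotDl A B C : frob_dot (A + B) C = frob_dot A C + frob_dot B C.
Proof.
rewrite -big_split; apply: eq_bigr => i _; rewrite -big_split.
by apply: eq_bigr => j _; rewrite mxE mulrDl.
Qed.

Lemma frob_dotZl a A B : frob_dot (a *: A) B = a * frob_dot A B.
Proof.
rewrite mulr_sumr; apply: eq_bigr => i _; rewrite mulr_sumr.
by apply: eq_bigr => j _; rewrite mxE mulrA.
Qed.

Lemma frob_dotNl A B : frob_dot (- A) B = - frob_dot A B.
Proof. by rewrite -scaleN1r frob_dotZl mulN1r. Qed.

Lemma frob_dotBl A B C : frob_dot (A - B) C = frob_dot A C - frob_dot B C.
Proof. by rewrite frob_dotDl frob_dotNl. Qed.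

Lemma frob_dotDr A B C : frob_dot A (B + C) = frob_dot A B + frob_dot A C.
Proof. by rewrite !(frob_dotC A) frob_dotDl. Qed.

Lemma frob_dotZr a A B : frob_dot A (a *: B) = a * frob_dot A B.
Proof. by rewrite !(frob_dotC A) frob_dotZl. Qed.

Lemma frob_dotNr A B : frob_dot A (- B) = - frob_dot A B.
Proof. by rewrite !(frob_dotC A) frob_dotNl. Qed.

Lemma frob_dotBr A B C : frob_dot A (B - C) = frob_dot A B - frob_dot A C.
Proof. by rewrite !(frob_dotC A) frob_dotBl. Qed.

Lemma frob_dot0l A : frob_dot 0 A = 0.
Proof. by rewrite -(scale0r A) frob_dotZl mul0r. Qed.

Lemma frob_dot_ge0 A : 0 <= frob_dot A A.
Proof. by do 2 apply: sumr_ge0 => ? _; rewrite -expr2 sqr_ge0. Qed.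

Lemma frob_dot_entry A i j : A i j ^+ 2 <= frob_dot A A.
Proof.
rewrite /frob_dot (bigD1 i)//= (bigD1 j)//= -addrA -expr2 lerDl addr_ge0//.
  by apply: sumr_ge0 => ? _; rewrite -expr2 sqr_ge0.
by do 2 apply: sumr_ge0 => ? _; rewrite -expr2 sqr_ge0.
Qed.

Lemma normr_frob_dot A B : `|frob_dot A B| <= frob_dot A A + frob_dot B B.
Proof.
have := frob_dot_ge0 (A + B); have := frob_dot_ge0 (A - B).
rewrite !(frob_dotDl, frob_dotDr, frob_dotNl, frob_dotNr) (frob_dotC B A).
have := frob_dot_ge0 A; have := frob_dot_ge0 B.
by rewrite ler_norml; move=> *; apply/andP; split; lra.
Qed.

Lemma frob_sqr_le A B : frob_dot A B ^+ 2 <= frob_dot A A * frob_dot B B.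
Proof.
apply: discriminant_le (frob_dot_ge0 B) _ => s.
have := frob_dot_ge0 (A + s *: B).
rewrite frob_dotDl !frob_dotDr !frob_dotZl !frob_dotZr (frob_dotC B A).
by move=> h; apply: (le_trans h); rewrite le_eqVlt; apply/orP; left; apply/eqP; ring.
Qed.

Lemma frobenius_ge0 A : 0 <= frobenius A.
Proof. exact: sqrtr_ge0. Qed.

Lemma sqr_frobenius A : frobenius A ^+ 2 = frob_dot A A.
Proof. by rewrite sqr_sqrtr ?frob_dot_ge0. Qed.

End frobenius_product.

Lemma frob_dot_trace (R : realType) (d : nat) (c : R) (M : 'M[R]_d) : frob_dot c%:M M = c * \tr M.
Proof.
rewrite /mxtrace mulr_sumr; apply: eq_bigr => i _.
rewrite (bigD1 i)//= big1 => [|j ji]; last by rewrite mxE eq_sym (negbTE ji) mul0r.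
by rewrite mxE eqxx addr0 mulr1n.
Qed.

Section integrable_functions.
Context {disp} {X : measurableType disp} {R : realType}.
Variable mu : {measure set X -> \bar R}.
Implicit Types f g : X -> R.

Definition intg f := mu.-integrable setT (EFin \o f).

Lemma intg_mfun f : intg f -> measurable_fun setT f.
Proof. by move=> /measurable_int /measurable_EFinP. Qed.

Lemma le_intg f g : measurable_fun setT f -> intg g ->
  (forall x, `|f x| <= `|g x|) -> intg f.
Proof.
move=> mf ig fg; apply: (le_integrable _ _ _ ig) => //.
  exact/measurable_EFinP.
by move=> x _ /=; rewrite lee_fin.
Qed.

Lemma intgD f g : intg f -> intg g -> intg (fun x => f x + g x).
Proof. by move=> hf hg; exact: (integrableD measurableT hf hg). Qed.

Lemma intgZ a f : intg f -> intg (fun x => a * f x).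
Proof. by move=> hf; exact: (integrableZl measurableT a hf). Qed.

Lemma intgN f : intg f -> intg (fun x => - f x).
Proof. by move=> hf; exact: (integrableN hf). Qed.

Lemma intgB f g : intg f -> intg g -> intg (fun x => f x - g x).
Proof. by move=> hf hg; apply: intgD => //; exact: intgN. Qed.

Lemma intg_sum (I : Type) (s : seq I) (F : I -> X -> R) :
  (forall i, intg (F i)) -> intg (fun x => \sum_(i <- s) F i x).
Proof.
move=> hF; rewrite /intg; have -> : EFin \o (fun x => \sum_(i <- s) F i x) =
   (fun x => (\sum_(i <- s) (F i x)%:E)%E).
  by apply/funext => x /=; rewrite sumEFin.
by apply: (integrable_sum measurableT) => i _; exact: hF.
Qed.

Lemma RintD f g : intg f -> intg g ->
  \int[mu]_x (f x + g x) = \int[mu]_x f x + \int[mu]_x g x.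
Proof. by move=> hf hg; rewrite RintegralD. Qed.

Lemma RintB f g : intg f -> intg g ->
  \int[mu]_x (f x - g x) = \int[mu]_x f x - \int[mu]_x g x.
Proof. by move=> hf hg; rewrite RintegralB. Qed.

Lemma RintZ a f : intg f -> \int[mu]_x (a * f x) = a * \int[mu]_x f x.
Proof. by move=> hf; rewrite RintegralZl. Qed.

Lemma RintN f : intg f -> \int[mu]_x (- f x) = - \int[mu]_x f x.
Proof.
move=> hf; rewrite -mulN1r -RintZ//.
by apply: eq_Rintegral => x _; rewrite mulN1r.
Qed.

Lemma Rint_sum (I : Type) (s : seq I) (F : I -> X -> R) :
  (forall i, intg (F i)) ->
  \int[mu]_x (\sum_(i <- s) F i x) = \sum_(i <- s) \int[mu]_x F i x.
Proof.
move=> hF; elim: s => [|i s IHs].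
  under eq_Rintegral do rewrite big_nil.
  by rewrite big_nil Rintegral_cst// mul0r.
under eq_Rintegral do rewrite big_cons.
by rewrite big_cons RintD// ?IHs//; exact: intg_sum.
Qed.

Lemma le_Rint f g : intg f -> intg g -> (forall x, f x <= g x) ->
  \int[mu]_x f x <= \int[mu]_x g x.
Proof. by move=> hf hg fg; apply: le_Rintegral. Qed.

Lemma ae_le_Rint f g : intg f -> intg g -> {ae mu, forall x, f x <= g x} ->
  \int[mu]_x f x <= \int[mu]_x g x.
Proof.
move=> hf hg fg; rewrite -subr_ge0 -RintB//.
(* The difference is replaced by its positive part, which agrees with it almost everywhere and is
   non-negative everywhere. *)
rewrite /Rintegral (ae_eq_integral (fun x => (Num.max (g x - f x) 0)%:E)) //.
- by apply: Rintegral_ge0 => x _; rewrite le_max lexx orbT.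
- exact/measurable_EFinP/intg_mfun/intgB.
- apply/measurable_EFinP; apply: measurable_maxr => //.
  exact/intg_mfun/intgB.
- by apply: filterS fg => x fg _; rewrite max_l ?subr_ge0.
Qed.

Lemma ae_eq_Rint f g : measurable_fun setT f -> measurable_fun setT g ->
  {ae mu, forall x, f x = g x} -> \int[mu]_x f x = \int[mu]_x g x.
Proof.
move=> mf mg fg; congr fine; apply: ae_eq_integral => //; try exact/measurable_EFinP.
by apply: filterS fg => x fg _; rewrite fg.
Qed.

Lemma ae_le_intg f g : measurable_fun setT f -> intg g ->
  {ae mu, forall x, `|f x| <= g x} -> intg f.
Proof.
move=> mf ig fg; apply/integrableP; split; first exact/measurable_EFinP.
move/integrableP : (ig) => [_]; apply: le_lt_trans.
apply: ae_ge0_le_integral => //.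
- by apply: measurableT_comp => //; apply/measurable_EFinP.
- apply: measurableT_comp => //; apply/measurable_EFinP; exact: intg_mfun.
by apply: filterS fg => x fg _ /=; rewrite lee_fin (le_trans fg)// ler_norm.
Qed.

Lemma ge0_Rint_eq0 f : intg f -> {ae mu, forall x, 0 <= f x} ->
  \int[mu]_x f x <= 0 -> {ae mu, forall x, f x = 0}.
Proof.
move=> hf f0 i0.
have h : (\int[mu]_x `|(f x)%:E| = 0)%E.
  have mf := intg_mfun hf.
  rewrite (ae_eq_integral (EFin \o f))//.
  - rewrite -[LHS]fineK ?integrable_fin_num//.
    congr EFin; apply/eqP; rewrite eq_le i0/=.
    suff: \int[mu]_x (0 * f x) <= \int[mu]_x f x by rewrite RintZ ?mul0r.
    apply: ae_le_Rint => //; first exact: intgZ.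
    by apply: filterS f0 => x; rewrite mul0r.
  - by apply: measurableT_comp => //; apply/measurable_EFinP.
  - exact/measurable_EFinP.
  - by apply: filterS f0 => x f0 _ /=; rewrite ger0_norm.
have hae := proj1 (ae_eq_integral_abs mu measurableT
   (proj2 (measurable_EFinP setT f) (intg_mfun hf))) h.
by apply: filterS hae => x /(_ I) /= [].
Qed.

End integrable_functions.

Section square_integrable_fields.
Context {disp} {X : measurableType disp} {R : realType}.
Variable mu : {measure set X -> \bar R}.
Variables m n : nat.
Implicit Types F G H : X -> 'M[R]_(m, n).

Definition ip F G : R := \int[mu]_z frob_dot (F z) (G z).

Lemma measurable_frob_dot F G :
  measurable_fun setT F -> measurable_fun setT G ->
  measurable_fun setT (fun z => frob_dot (F z) (G z)).
Proof.
move=> /measurable_fun_matrixP mF /measurable_fun_matrixP mG.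
apply: measurable_sum => i; apply: measurable_sum => j.
exact: measurable_funM.
Qed.

Lemma measurable_frobenius F :
  measurable_fun setT F -> measurable_fun setT (@frobenius R m n \o F).
Proof.
move=> mF; apply: (@measurableT_comp _ _ _ _ _ _ (@Num.sqrt R)).
  exact: (continuous_measurable_fun (@sqrt_continuous R)).
exact: measurable_frob_dot.
Qed.

Lemma in_L2P F : in_Lp mu 2%:E F <->
  measurable_fun setT F /\ intg mu (fun z => frob_dot (F z) (F z)).
Proof.
split=> -[mF fF]; split=> //; have mf := measurable_frobenius mF.
  have : (@frobenius R m n \o F) \in Lfun mu 2%:E.
    by apply/andP; split; rewrite inE.
  move=> /Lfun2_integrable_sqr; congr (mu.-integrable _ _).
  by apply/funext => z /=; rewrite sqr_frobenius.
rewrite /finite_norm unlock; apply: poweR_lty.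
move/integrableP : fF => [_]; congr (_ < _)%E; apply: eq_integral => z _ /=.
by rewrite powR_mulrn ?normr_ge0// -normrX sqr_frobenius.
Qed.

Lemma Lp_norm_sqr F : in_Lp mu 2%:E F -> Lp_norm mu 2%:E F ^+ 2 = ip F F.
Proof.
move=> /[dup] [[mF fF]] /in_L2P[_ iF]; rewrite /Lp_norm.
rewrite -[LHS]powR_mulrn ?fine_ge0 ?Lnorm_ge0//.
rewrite -fine_poweR powR_Lnorm//; congr fine; apply: eq_integral => z _ /=.
by rewrite powR_mulrn ?normr_ge0// -normrX sqr_frobenius ger0_norm ?frob_dot_ge0.
Qed.

Lemma L2_intg F G : in_Lp mu 2%:E F -> in_Lp mu 2%:E G ->
  intg mu (fun z => frob_dot (F z) (G z)).
Proof.
move=> /in_L2P[mF iF] /in_L2P[mG iG].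
apply: (le_intg _ (intgD iF iG)); first exact: measurable_frob_dot.
by move=> z; rewrite (le_trans (normr_frob_dot _ _))// ler_norm.
Qed.

Lemma L2D F G : in_Lp mu 2%:E F -> in_Lp mu 2%:E G ->
  in_Lp mu 2%:E (fun z => F z + G z).
Proof.
move=> /[dup] hF /in_L2P[mF iF] /[dup] hG /in_L2P[mG iG]; apply/in_L2P.
split.
  move/measurable_fun_matrixP : mF => mF; move/measurable_fun_matrixP : mG => mG.
  apply/measurable_fun_matrixP => i j.
  by under eq_fun do rewrite mxE; exact: measurable_funD.
have := intgD (intgD iF iG) (intgZ 2 (L2_intg hF hG)).
congr intg; apply/funext => z.
by rewrite frob_dotDl !frob_dotDr (frob_dotC (G z)); ring.
Qed.

Lemma L2Z a F : in_Lp mu 2%:E F -> in_Lp mu 2%:E (fun z => a *: F z).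
Proof.
move=> /in_L2P[mF iF]; apply/in_L2P; split.
  move/measurable_fun_matrixP : mF => mF.
  apply/measurable_fun_matrixP => i j.
  by under eq_fun do rewrite mxE; exact: measurable_funM.
have := intgZ (a * a) iF; congr intg; apply/funext => z.
by rewrite frob_dotZl frob_dotZr mulrA.
Qed.

Lemma L2N F : in_Lp mu 2%:E F -> in_Lp mu 2%:E (fun z => - F z).
Proof.
by move=> /(L2Z (-1)); congr in_Lp; apply/funext => z; rewrite scaleN1r.
Qed.

Lemma L2B F G : in_Lp mu 2%:E F -> in_Lp mu 2%:E G ->
  in_Lp mu 2%:E (fun z => F z - G z).
Proof. by move=> hF /L2N; exact: L2D. Qed.

Lemma L2_0 : in_Lp mu 2%:E (fun _ : X => 0 : 'M[R]_(m, n)).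
Proof.
apply/in_L2P; split; first exact: measurable_cst.
have -> : (fun _ : X => frob_dot (0 : 'M[R]_(m, n)) 0) = cst 0.
  by apply/funext => z; rewrite frob_dot0l.
exact: integrable0.
Qed.

Lemma ipC F G : ip F G = ip G F.
Proof. by apply: eq_Rintegral => z _; rewrite frob_dotC. Qed.

Lemma ipDl F G H : in_Lp mu 2%:E F -> in_Lp mu 2%:E G -> in_Lp mu 2%:E H ->
  ip (fun z => F z + G z) H = ip F H + ip G H.
Proof.
move=> hF hG hH; rewrite /ip -RintD; [|exact: L2_intg..].
by apply: eq_Rintegral => z _; rewrite frob_dotDl.
Qed.

Lemma ipZl a F G : in_Lp mu 2%:E F -> in_Lp mu 2%:E G ->
  ip (fun z => a *: F z) G = a * ip F G.
Proof.
move=> hF hG; rewrite /ip -RintZ; last exact: L2_intg.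
by apply: eq_Rintegral => z _; rewrite frob_dotZl.
Qed.

Lemma ipNl F G : in_Lp mu 2%:E F -> in_Lp mu 2%:E G ->
  ip (fun z => - F z) G = - ip F G.
Proof.
move=> hF hG; rewrite -mulN1r -ipZl//.
by apply: eq_Rintegral => z _; rewrite scaleN1r.
Qed.

Lemma ipBl F G H : in_Lp mu 2%:E F -> in_Lp mu 2%:E G -> in_Lp mu 2%:E H ->
  ip (fun z => F z - G z) H = ip F H - ip G H.
Proof. by move=> hF hG hH; rewrite (ipDl hF (L2N hG) hH) ipNl. Qed.

Lemma ipDr F G H : in_Lp mu 2%:E F -> in_Lp mu 2%:E G -> in_Lp mu 2%:E H ->
  ip F (fun z => G z + H z) = ip F G + ip F H.
Proof. by move=> hF hG hH; rewrite !(ipC F) ipDl. Qed.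

Lemma ipZr a F G : in_Lp mu 2%:E F -> in_Lp mu 2%:E G ->
  ip F (fun z => a *: G z) = a * ip F G.
Proof. by move=> hF hG; rewrite !(ipC F) ipZl. Qed.

Lemma ipBr F G H : in_Lp mu 2%:E F -> in_Lp mu 2%:E G -> in_Lp mu 2%:E H ->
  ip F (fun z => G z - H z) = ip F G - ip F H.
Proof. by move=> hF hG hH; rewrite !(ipC F) ipBl. Qed.

Lemma ip_ge0 F : 0 <= ip F F.
Proof. by apply: Rintegral_ge0 => z _; exact: frob_dot_ge0. Qed.

Lemma ipDD F G : in_Lp mu 2%:E F -> in_Lp mu 2%:E G ->
  ip (fun z => F z + G z) (fun z => F z + G z) = ip F F + 2 * ip F G + ip G G.
Proof.
move=> hF hG; rewrite ipDl ?ipDr//; [|exact: L2D..].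
by rewrite (ipC G F); ring.
Qed.

Lemma ipBB F G : in_Lp mu 2%:E F -> in_Lp mu 2%:E G ->
  ip (fun z => F z - G z) (fun z => F z - G z) = ip F F - 2 * ip F G + ip G G.
Proof.
move=> hF hG; rewrite ipBl ?ipBr//; [|exact: L2B..].
by rewrite (ipC G F); ring.
Qed.

Lemma ip_sqr_le F G : in_Lp mu 2%:E F -> in_Lp mu 2%:E G ->
  ip F G ^+ 2 <= ip F F * ip G G.
Proof.
move=> hF hG; have h s : 0 <= ip F F + 2 * s * ip F G + s ^+ 2 * ip G G.
  have := ip_ge0 (fun z => F z + s *: G z).
  have hsG := L2Z s hG.
  rewrite (ipDD hF hsG) (ipZr _ hF hG) (ipZl _ hG hsG) (ipZr _ hG hG).
  by move=> h; apply: (le_trans h); rewrite le_eqVlt; apply/orP; left; apply/eqP; ring.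
exact: discriminant_le (ip_ge0 G) h.
Qed.

Lemma in_L2_entry F :
  in_Lp mu 2%:E F <-> forall i j, measurable_fun setT (fun z => F z i j) /\
    intg mu (fun z => F z i j ^+ 2).
Proof.
split=> [/in_L2P[mF iF] i j|h].
  have mij := proj1 (measurable_fun_matrixP F) mF i j; split=> //.
  apply: (le_intg _ iF); first exact: measurable_funX.
  move=> z; rewrite ger0_norm ?sqr_ge0// ger0_norm ?frob_dot_ge0//.
  exact: frob_dot_entry.
apply/in_L2P; split.
  by apply/measurable_fun_matrixP => i j; have [] := h i j.
do 2 apply: intg_sum => ?; rewrite /=.
by under eq_fun do rewrite -expr2; exact: (h _ _).2.
Qed.

Hypothesis mu_fin : (mu setT < +oo)%E.

Lemma intg_cst (a : R) : intg mu (fun => a).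
Proof.
apply/integrableP; split; first exact/measurable_EFinP.
by rewrite /= integral_cst// lte_mul_pinfty.
Qed.

Lemma L2_ae_bounded F M : measurable_fun setT F ->
  {ae mu, forall z, frobenius (F z) <= M} -> in_Lp mu 2%:E F.
Proof.
move=> mF FM; apply/in_L2P; split=> //.
apply: (ae_le_intg (g := fun => M ^+ 2)); first exact: measurable_frob_dot.
  exact: intg_cst.
apply: filterS FM => z FM; rewrite ger0_norm ?frob_dot_ge0// -sqr_frobenius.
by rewrite lerXn2r ?nnegrE ?frobenius_ge0// (le_trans _ FM)// frobenius_ge0.
Qed.

Lemma L2_bounded F M : measurable_fun setT F ->
  (forall z, frobenius (F z) <= M) -> in_Lp mu 2%:E F.
Proof. by move=> mF FM; apply: (L2_ae_bounded mF (M := M)); apply/nearW. Qed.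

Hypothesis mu_gt0 : (0 < mu setT)%E.

(** Positivity of the total mass selects the branch of the L^oo norm that is the essential
    supremum. *)
Lemma Loo_ae F : in_Lp mu +oo%E F ->
  {ae mu, forall z, frobenius (F z) <= Lp_norm mu +oo%E F}.
Proof.
move=> [_]; rewrite /finite_norm /Lp_norm unlock mu_gt0 => foo.
have := ess_sup_ge mu (abse \o (EFin \o (@frobenius R m n \o F))).
apply: filterS => z; rewrite /= => h; rewrite -lee_fin fineK; last first.
  rewrite ge0_fin_numE//; apply: (@le_trans _ _ (`|frobenius (F z)|)%:E) => //.
by rewrite (le_trans _ h)// lee_fin ler_norm.
Qed.

Lemma in_LyP F M : measurable_fun setT F ->
  {ae mu, forall z, frobenius (F z) <= M} -> in_Lp mu +oo%E F.
Proof.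
move=> mF FM; split=> //; rewrite /finite_norm unlock mu_gt0.
apply: (@le_lt_trans _ _ M%:E); last exact: ltry.
apply/ess_supP; apply: filterS FM => z FM /=.
by rewrite lee_fin ger0_norm ?frobenius_ge0.
Qed.

Lemma Loo_norm_le F M : in_Lp mu +oo%E F ->
  {ae mu, forall z, frobenius (F z) <= M} ->
  Lp_norm mu +oo%E F <= M.
Proof.
move=> [_]; rewrite /finite_norm /Lp_norm unlock mu_gt0 => foo FM.
have le : (ess_sup mu (abse \o (EFin \o (@frobenius R m n \o F))) <= M%:E)%E.
  apply/ess_supP; apply: filterS FM => z FM /=.
  by rewrite lee_fin ger0_norm ?frobenius_ge0.
rewrite -lee_fin fineK// ge0_fin_numE//.
apply: ess_sup_gee => //; apply/nearW => z /=; exact: normr_ge0.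
Qed.

Lemma Loo_L2 F : in_Lp mu +oo%E F -> in_Lp mu 2%:E F.
Proof. by move=> hF; apply: (L2_ae_bounded hF.1 (Loo_ae hF)). Qed.

End square_integrable_fields.

(** * Real sequences and diagonal extraction *)

Section real_sequences.
Variable R : realType.
Implicit Types u v : nat -> R.

Lemma invS_small (e : R) : 0 < e -> exists N : nat, forall n, (N <= n)%N ->
  n.+1%:R^-1 < e.
Proof.
move=> e0; have [N _ h] := near_infty_natSinv_lt (PosNum e0).
by exists N => n Nn; exact: h.
Qed.

Lemma cvg_seqP u (l : R) : u @ \oo --> l <->
  forall e : R, 0 < e -> exists N : nat, forall n, (N <= n)%N -> `|u n - l| < e.
Proof.
split=> [/cvgrPdist_lt h e /h [N _ hN]|h].
  by exists N => n Nn; rewrite distrC; exact: hN.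
apply/cvgrPdist_lt => e /h [N hN]; exists N => // n /= Nn.
by rewrite distrC hN.
Qed.

Lemma cauchy_seq_cvg u :
  (forall e : R, 0 < e -> exists N : nat, forall p q, (N <= p)%N -> (N <= q)%N ->
    `|u p - u q| < e) -> cvgn u.
Proof.
move=> h; apply: cauchy_cvg; apply: cauchy_exP => e /h [N hN].
exists (u N); exists N => // n /= Nn.
by rewrite /ball/= hN.
Qed.

Lemma increasing_seq_ge (s : nat -> nat) : (forall k, (s k < s k.+1)%N) ->
  forall k, (k <= s k)%N.
Proof. by move=> h; elim=> // k IHk; rewrite (leq_ltn_trans IHk). Qed.

Lemma increasing_seq_leq (s : nat -> nat) : (forall k, (s k < s k.+1)%N) ->
  {homo s : i j / (i <= j)%N}.
Proof.
move=> h i j; elim: j => [|j IHj]; first by rewrite leqn0 => /eqP ->.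
rewrite leq_eqVlt => /predU1P[->//|]; rewrite ltnS => /IHj ij.
by rewrite (leq_trans ij)// ltnW.
Qed.

Lemma cvg_subsequence u (l : R) (s : nat -> nat) :
  (forall k, (s k < s k.+1)%N) -> u @ \oo --> l -> (u \o s) @ \oo --> l.
Proof.
move=> hs /cvg_seqP h; apply/cvg_seqP => e /h [N hN]; exists N => n Nn.
by apply: hN; rewrite (leq_trans Nn)// increasing_seq_ge.
Qed.

(** Tychonoff's theorem on the product of the segments [- M j, M j] yields a cluster point c of the
    sequence of columns of [a]. Requiring the first k coordinates to be close to those of c defines
    a neighbourhood of c, so suitable indices exist beyond any given one. *)
Lemma diagonal_extraction (a : nat -> nat -> R) (M : nat -> R) :
  (forall j k, `|a j k| <= M j) ->
  exists2 s : nat -> nat, (forall k, (s k < s k.+1)%N) &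
    forall j, cvgn (a j \o s).
Proof.
move=> aM.
pose K := prod_topology (fun _ : nat => R : topologicalType).
pose b (k : nat) : K := fun j => a j k.
have cA := @tychonoff nat (fun _ => R : topologicalType)
  (fun j => [set` `[- M j, M j]]) (fun j => @segment_compact R (- M j) (M j)).
have PF : ProperFilter (b @ \oo) by exact: fmap_proper_filter.
have [|c [_ cc]] := cA (b @ \oo) PF.
  by exists 0%N => // k _ j; rewrite /= in_itv/= -ler_norml; exact: aM.
have nb k (e : R) : 0 < e ->
    nbhs (c : K) [set f : K | forall j, (j <= k)%N -> `|f j - c j| < e].
  move=> e0.
  have nj j : nbhs (c : K) [set f : K | `|f j - c j| < e].
    have := @proj_continuous nat (fun _ => R : topologicalType) j c.
    move=> h; apply: (h [set y : R | `|y - c j| < e]).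
    have := nbhsx_ballx (c j : R) e e0; apply: filterS => y.
    by rewrite /ball/= distrC.
  elim: k => [|k IHk].
    by apply: filterS (nj 0%N) => f fj j; rewrite leqn0 => /eqP ->.
  apply: filterS (filterI IHk (nj k.+1)) => f [f1 f2] j.
  by rewrite leq_eqVlt => /predU1P[->//|]; rewrite ltnS; exact: f1.
have ex k N : exists n, (N <= n)%N /\
    forall j, (j <= k)%N -> `|a j n - c j| < k.+1%:R^-1.
  have [||f [[n Nn <-] h]] := cc [set b n | n in [set n | (N <= n)%N]] _ _ (nb k k.+1%:R^-1 _).
  - by exists N => // n /= Nn; exists n.
  - by rewrite invr_gt0 ltr0n.
  - by exists n.
have [g hg] : {g : nat -> nat -> nat | forall k N, (N <= g k N)%N /\
    forall j, (j <= k)%N -> `|a j (g k N) - c j| < k.+1%:R^-1}.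
  exists (fun k N => sval (cid (ex k N))) => k N.
  by case: (cid _).
(* Choosing beyond [(s k').+1] makes the extraction strictly increasing; at stage k the coordinates
   0 to k are within 1/(k+1) of c. *)
pose s := fix s k := if k is k'.+1 then g k (s k').+1 else g 0%N 0%N.
exists s => [k|j]; first exact: (hg k.+1 (s k).+1).1.
apply/cvg_ex; exists (c j); apply/cvg_seqP => e e0.
(* Coordinate j is controlled only from stage j on, hence the maximum. *)
have [N hN] := invS_small e0; exists (maxn j N) => n; rewrite geq_max => /andP[jn Nn].
rewrite /= (lt_trans _ (hN _ Nn))//.
by case: n jn {Nn} => [|n] jn; apply: (hg _ _).2.
Qed.

Lemma cvg_bigsum (I : Type) (r : seq I) (u : I -> nat -> R) (l : I -> R) :
  (forall i, u i @ \oo --> l i) ->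
  (fun k => \sum_(i <- r) u i k) @ \oo --> \sum_(i <- r) l i.
Proof.
move=> h; elim: r => [|i r IHr].
  by under eq_fun do rewrite big_nil; rewrite big_nil; exact: cvg_cst.
by under eq_fun do rewrite big_cons; rewrite big_cons; exact: cvgD.
Qed.

End real_sequences.

(** * Strong convergence and completeness of L^2 *)

Section L2_limits.
Context {disp} {X : measurableType disp} {R : realType}.
Variable mu : {measure set X -> \bar R}.
Variables m n : nat.
Implicit Types F G H : X -> 'M[R]_(m, n).
Local Notation L2 := (in_Lp mu 2%:E).
Local Notation dst F G := (ip mu (fun z => F z - G z) (fun z => F z - G z)).

Lemma cvg_ip (F : nat -> X -> 'M[R]_(m, n)) G H :
  (forall k, L2 (F k)) -> L2 G -> L2 H ->
  (fun k => dst (F k) G) @ \oo --> 0 ->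
  (fun k => ip mu (F k) H) @ \oo --> ip mu G H.
Proof.
move=> hF hG hH /cvg_seqP h; apply/cvg_seqP => e e0.
(* Threshold for Cauchy-Schwarz in squared form; the [+ 1] covers the case of vanishing H. *)
have [|N hN] := h (e ^+ 2 / (ip mu H H + 1)).
  by rewrite divr_gt0 ?exprn_gt0// ltr_wpDl ?ip_ge0.
exists N => k /hN; rewrite subr0 ger0_norm ?ip_ge0// => hk.
rewrite -ipBl// -(@ltr_pXn2r _ 2)// ?nnegrE ?normr_ge0 ?ltW//.
rewrite real_normK ?num_real//.
have hFG := L2B (hF k) hG.
rewrite (le_lt_trans (ip_sqr_le hFG hH))//.
rewrite (@le_lt_trans _ _ (dst (F k) G * (ip mu H H + 1)))//.
  by rewrite ler_wpM2l ?ip_ge0// lerDl.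
by rewrite -ltr_pdivlMr// ltr_wpDl ?ip_ge0.
Qed.

(** [dst] is the square of the distance, so the triangle inequality takes a factor 2, from the
    parallelogram law. *)
Lemma dst_triangle F G H : L2 F -> L2 G -> L2 H ->
  dst F H <= 2 * dst F G + 2 * dst G H.
Proof.
move=> hF hG hH; have hFG := L2B hF hG; have hGH := L2B hG hH.
have -> : dst F H = ip mu (fun z => (F z - G z) + (G z - H z))
                         (fun z => (F z - G z) + (G z - H z)).
  by congr ip; apply/funext => z; rewrite addrA subrK.
have := ip_ge0 mu (fun z => (F z - G z) - (G z - H z)).
by rewrite (ipDD hFG hGH) (ipBB hFG hGH); lra.
Qed.


Lemma ae_imp (P Q : X -> Prop) : {ae mu, forall z, P z} ->
  (forall z, P z -> Q z) -> {ae mu, forall z, Q z}.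
Proof. by move=> h PQ; apply: filterS h. Qed.

Lemma ae_and (P Q : X -> Prop) : {ae mu, forall z, P z} ->
  {ae mu, forall z, Q z} -> {ae mu, forall z, P z /\ Q z}.
Proof. by move=> hP hQ; apply: filterS2 hP hQ. Qed.

Lemma ae_forall_count (I : countType) (P : I -> X -> Prop) :
  (forall i, {ae mu, forall z, P i z}) -> {ae mu, forall z, forall i, P i z}.
Proof.
move=> h; pose Q k z := if unpickle k is Some i then P i z else True.
have : {ae mu, forall z, forall k, Q k z}.
  by apply/ae_foralln => k; rewrite /Q; case: unpickle => [i|]; [exact: h|exact: nearW].
by apply: filterS => z hz i; have := hz (pickle i); rewrite /Q pickleK.
Qed.

Hypothesis mu_fin : (mu setT < +oo)%E.

(** The inequality 2 |x| <= 2^k x^2 + 2^-k, which expands the square of 2^k |x| - 1, turns the L^2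
    bounds 4^-k into L^1 bounds of order 2^-k on the increments. These are summable, so the
    telescoping series converges absolutely almost everywhere. *)
Lemma ae_cvg_of_fast_Cauchy (f : nat -> X -> R) :
  (forall k, measurable_fun setT (f k)) ->
  (forall k, intg mu (fun z => (f k.+1 z - f k z) ^+ 2)) ->
  (forall k, \int[mu]_z ((f k.+1 z - f k z) ^+ 2) <= 4^-1 ^+ k) ->
  {ae mu, forall z, cvgn (fun k => f k z)}.
Proof.
move=> mf hi hf.
pose g k z : \bar R := (`|f k.+1 z - f k z|)%:E.
have mg k : measurable_fun setT (g k).
  apply/measurable_EFinP; apply: measurableT_comp => //.
  exact: measurable_funB.
have g0 k z : (0 <= g k z)%E by rewrite lee_fin.
pose C := 1 + fine (mu setT).
have gk k : (\int[mu]_z g k z <= (C * 2^-1 ^+ k)%:E)%E.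
  have ig : intg mu (fun z => 2 ^+ k * (f k.+1 z - f k z) ^+ 2 + 2^-1 ^+ k).
    by apply: intgD; [exact: intgZ|exact: intg_cst].
  apply: (@le_trans _ _ (\int[mu]_z (2 ^+ k * (f k.+1 z - f k z) ^+ 2 + 2^-1 ^+ k)%:E)%E).
    apply: ge0_le_integral => //.
      exact/measurable_EFinP/(intg_mfun ig).
    move=> z _; rewrite lee_fin.
    set a := `|_|; rewrite -real_normK ?num_real// -/a.
    have := sqr_ge0 (2 ^+ k * a - 1); have p0 : (0 : R) < 2 ^+ k by rewrite exprn_gt0.
    rewrite exprVn; have q0 : (0 : R) < (2 ^+ k)^-1 by rewrite invr_gt0.
    move=> h; have h2 : 0 <= (2 ^+ k)^-1 * (2 ^+ k * a - 1) ^+ 2 by rewrite mulr_ge0// ltW.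
    have e2 : (2 ^+ k)^-1 * (2 ^+ k * a - 1) ^+ 2 = 2 ^+ k * a ^+ 2 - 2 * a + (2 ^+ k)^-1.
      by field; rewrite gt_eqF.
    have : 0 <= a by rewrite normr_ge0.
    by move: h2; rewrite e2; lra.
  rewrite -[leLHS]fineK ?integrable_fin_num// lee_fin -/(Rintegral _ _ _).
  rewrite RintD ?RintZ ?Rintegral_cst//; [|exact: intgZ|exact: intg_cst].
  rewrite /C mulrDl mul1r [fine _ * _]mulrC lerD2r.
  rewrite (@le_trans _ _ (2 ^+ k * 4^-1 ^+ k))// ?ler_wpM2l ?exprn_ge0//.
  rewrite -exprMn; suff -> : (2 * 4^-1 = 2^-1 :> R) by [].
  by field.
have fin : (\int[mu]_z (\sum_(k <oo) g k z) < +oo)%E.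
  rewrite integral_nneseries//.
  apply: (@le_lt_trans _ _ (\sum_(k <oo) (C * 2^-1 ^+ k)%:E)%E).
    by apply: lee_nneseries => k *; [exact: integral_ge0|exact: gk].
  have C0 : 0 <= C by rewrite addr_ge0// fine_ge0.
  apply: (@le_lt_trans _ _ (C * (1 - 2^-1)^-1)%:E); last exact: ltry.
  apply: lime_le.
    by apply: is_cvg_nneseries => k _ _; rewrite lee_fin mulr_ge0// exprn_ge0.
  apply: nearW => k; rewrite sumEFin lee_fin.
  apply: (@geometric_le_lim R k C 2^-1) => //.
  by rewrite ger0_norm// invf_lt1// ltr1n.
have ae : {ae mu, forall z, (\sum_(k <oo) g k z \is a fin_num)%E}.
  have mG : measurable_fun setT (fun z => (\sum_(k <oo) g k z)%E).
    by apply: ge0_emeasurable_sum.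
  have : mu.-integrable setT (fun z => (\sum_(k <oo) g k z)%E).
    apply/integrableP; split => //.
    under eq_integral do rewrite gee0_abs ?nneseries_ge0//.
    exact: fin.
  move=> /integrable_ae -/(_ measurableT).
  by apply: filterS => z; apply.
apply: filterS ae => z hz.
have cs : cvgn (series (fun k => f k.+1 z - f k z)).
  apply: normed_cvg.
  have /cvg_ex[l] : cvgn (fun k => \sum_(0 <= i < k) g i z)%E by exact: is_cvg_nneseries.
  move=> hl; have lE : l = (\sum_(k <oo) g k z)%E by apply/esym/cvg_lim.
  rewrite -lE in hz; apply/cvg_ex; exists (fine l).
  have {}hl : (\sum_(0 <= i < k) g i z)%E @[k --> \oo] --> (fine l)%:E.
    by rewrite fineK.
  have h : (fine \o (fun k => (\sum_(0 <= i < k) g i z)%E)) @ \oo --> fine l.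
    exact: fine_cvg hl.
  rewrite (_ : [normed _] = fine \o (fun k => (\sum_(0 <= i < k) g i z)%E))//.
  by apply/funext => k /=; rewrite /g sumEFin.
have -> : (fun k => f k z) = (fun k => f 0%N z + series (fun k => f k.+1 z - f k z) k).
  by apply/funext => k; rewrite /series/= telescope_sumr// addrC subrK.
by apply: is_cvgD => //; exact: is_cvg_cst.
Qed.


Lemma fast_subsequence (F : nat -> X -> 'M[R]_(m, n)) :
  (forall e : R, 0 < e -> exists N : nat, forall p q, (N <= p)%N -> (N <= q)%N ->
    dst (F p) (F q) < e) ->
  exists2 s : nat -> nat, (forall k, (s k < s k.+1)%N) &
    forall k, dst (F (s k.+1)) (F (s k)) <= 4^-1 ^+ k.
Proof.
move=> h.
have [N hN] : {N : nat -> nat | forall k p q, (N k <= p)%N -> (N k <= q)%N ->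
    dst (F p) (F q) < 4^-1 ^+ k}.
  have p0 k : 0 < 4^-1 ^+ k :> R by rewrite exprn_gt0// invr_gt0.
  by exists (fun k => sval (cid (h _ (p0 k)))) => k; case: (cid _).
pose s := fix s k := if k is k'.+1 then maxn (N k) (s k').+1 else N 0%N.
have Ns k : (N k <= s k)%N by case: k => [//|k]; rewrite leq_maxl.
have s1 k : (s k < s k.+1)%N by rewrite /= leq_maxr.
exists s => // k; apply/ltW/hN => //.
by rewrite (leq_trans (Ns k))// ltnW.
Qed.

Lemma measurable_mxB F G : measurable_fun setT F -> measurable_fun setT G ->
  measurable_fun setT (fun z => F z - G z).
Proof.
move=> /measurable_fun_matrixP mF /measurable_fun_matrixP mG.
apply/measurable_fun_matrixP => i j; under eq_fun do rewrite !mxE.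
exact: measurable_funB.
Qed.

(** Riesz-Fischer: a rapidly Cauchy subsequence converges almost everywhere, entry by entry, and
    Fatou's lemma bounds the distance from [F p] to the pointwise limit by the Cauchy bound at p. *)
Lemma L2_complete (F : nat -> X -> 'M[R]_(m, n)) :
  (forall k, L2 (F k)) ->
  (forall e : R, 0 < e -> exists N : nat, forall p q, (N <= p)%N -> (N <= q)%N ->
    dst (F p) (F q) < e) ->
  exists G, L2 G /\ (fun k => dst (F k) G) @ \oo --> 0.
Proof.
move=> hF hC; have [s s1 hs] := fast_subsequence hC.
have mF k i j : measurable_fun setT (fun z => F k z i j).
  by have [] := proj1 (in_L2_entry _ _) (hF k) i j.
have aeF i j : {ae mu, forall z, cvgn (fun k => F (s k) z i j)}.
  apply: ae_cvg_of_fast_Cauchy => // k.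
    have := proj1 (in_L2_entry _ _) (L2B (hF (s k.+1)) (hF (s k))) i j.
    by case=> _; under eq_fun do rewrite !mxE.
  apply: le_trans (hs k).
  have hB := L2B (hF (s k.+1)) (hF (s k)).
  apply: le_Rint; last by move=> z; apply: le_trans (frob_dot_entry _ i j); rewrite !mxE.
    have := proj1 (in_L2_entry _ _) hB i j.
    by case=> _; under eq_fun do rewrite !mxE.
  exact: L2_intg.
have aeF' : {ae mu, forall z, forall i j, cvgn (fun k => F (s k) z i j)}.
  by apply: ae_forall_count => i; apply: ae_forall_count => j; exact: aeF.
(* The upper limit is defined and measurable everywhere and agrees with the limit wherever the
   latter exists. *)
pose G z : 'M[R]_(m, n) :=
  \matrix_(i, j) fine (limn_esup (fun k => (F (s k) z i j)%:E)).
have GE z i j : cvgn (fun k => F (s k) z i j) -> (fun k => F (s k) z i j) @ \oo --> G z i j.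
  move=> c; rewrite mxE; have -> // : fine (limn_esup (fun k => (F (s k) z i j)%:E)) = limn (fun k => F (s k) z i j).
  have ce : (fun k => (F (s k) z i j)%:E) @ \oo --> (limn (fun k => F (s k) z i j))%:E.
    by apply/fine_cvgP; split; [exact: nearW|exact: c].
  by rewrite is_cvg_limn_esupE ?(cvg_lim _ ce)//; apply/cvg_ex; eexists; exact: ce.
have mG : measurable_fun setT G.
  apply/measurable_fun_matrixP => i j; under eq_fun do rewrite mxE.
  apply: measurableT_comp => //.
  by apply: measurable_fun_limn_esup => k; apply/measurable_EFinP.
have key e p : 0 < e -> (forall k, (p <= k)%N -> dst (F p) (F k) < e) ->
    (\int[mu]_z (frob_dot (F p z - G z) (F p z - G z))%:E <= e%:E)%E.
  move=> e0 hp.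
  pose f k z := (frob_dot (F p z - F (s k) z) (F p z - F (s k) z))%:E.
  have mf k : measurable_fun setT (f k).
    apply/measurable_EFinP; apply: measurable_frob_dot; exact: (L2B (hF p) (hF (s k))).1.
  have f0 k z : setT z -> (0 <= f k z)%E by move=> _; rewrite lee_fin frob_dot_ge0.
  have := fatou mu measurableT mf f0.
  rewrite (ae_eq_integral (fun z => (frob_dot (F p z - G z) (F p z - G z))%:E)) //.
  - move=> h; apply: (le_trans h); rewrite limn_einf_lim.
    have cv := @is_cvg_einfs R (fun k => \int[mu]_z f k z)%E.
    apply: lime_le => //; apply: nearW => k.
    (* The infimum over the tail from k is tested at [maxn p k], because the Cauchy bound at p needs
       an index at least p. *)
    apply: (@le_trans _ _ (\int[mu]_z f (maxn p k) z)%E).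
      by apply: ereal_inf_lbound; exists (maxn p k) => //=; exact: leq_maxr.
    rewrite -[leLHS]fineK ?lee_fin; last first.
      by apply: integrable_fin_num => //; apply: L2_intg; exact: L2B.
    apply/ltW/hp; rewrite (leq_trans (leq_maxl p k))//.
    exact: increasing_seq_ge.
  - apply: measurableT_comp => //; apply: measurable_fun_limn_esup => k.
    exact: measurableT_comp.
  - by apply/measurable_EFinP; apply: measurable_frob_dot;
      apply: measurable_mxB => //; exact: (hF p).1.
  - apply: filterS aeF' => z hz _.
    have cz : (fun k => frob_dot (F p z - F (s k) z) (F p z - F (s k) z)) @ \oo -->
        frob_dot (F p z - G z) (F p z - G z).
      apply: cvg_bigsum => i; apply: cvg_bigsum => j.
      have cij : (fun k => (F p z - F (s k) z) i j) @ \oo --> (F p z - G z) i j.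
        have -> : (F p z - G z) i j = F p z i j - G z i j by rewrite mxE mxE.
        under eq_fun do rewrite mxE mxE.
        by apply: cvgB; [exact: cvg_cst|exact: GE].
      exact: cvgM.
    rewrite is_cvg_limn_einfE; first by apply/cvg_lim => //; apply/fine_cvgP; split; [exact: nearW|exact: cz].
    by apply/cvg_ex; eexists; apply/fine_cvgP; split; [exact: nearW|exact: cz].
have iG e p : 0 < e -> (forall k, (p <= k)%N -> dst (F p) (F k) < e) ->
    L2 (fun z => F p z - G z) /\ dst (F p) G <= e.
  move=> e0 hp; have h := key e p e0 hp.
  have mFG : measurable_fun setT (fun z => F p z - G z).
    by apply: measurable_mxB => //; exact: (hF p).1.
  have hL : L2 (fun z => F p z - G z).
    apply/in_L2P; split=> //; apply/integrableP; split.
      exact/measurable_EFinP/measurable_frob_dot.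
    under eq_integral do rewrite /= ger0_norm ?frob_dot_ge0//.
    exact: le_lt_trans h (ltry _).
  split=> //; rewrite -lee_fin; apply: le_trans h; rewrite fineK//.
  by apply: integrable_fin_num => //; exact: L2_intg.
have hG : L2 G.
  have [N hN] := hC 1 ltr01.
  have [h _] := iG 1 N ltr01 (fun k Nk => hN N k (leqnn N) Nk).
  have := L2B (hF N) h; congr in_Lp; apply/funext => z.
  by rewrite opprB addrC subrK.
exists G; split=> //; apply/cvg_seqP => e e0.
have e20 : 0 < e / 2 by rewrite divr_gt0.
have [N hN] := hC _ e20; exists N => p Np.
rewrite subr0 ger0_norm ?ip_ge0//.
have [_ h] := iG _ p e20 (fun k pk => hN p k Np (leq_trans Np pk)).
by rewrite (le_lt_trans h)// ltr_pdivrMr// ltr_pMr// ltr1n.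
Qed.

End L2_limits.

(** * Riesz representation, density criterion and weak compactness in L^2 *)

Section L2_Hilbert.
Context {disp} {X : measurableType disp} {R : realType}.
Variable mu : {measure set X -> \bar R}.
Hypothesis mu_fin : (mu setT < +oo)%E.
Variables m n : nat.
Implicit Types F G H : X -> 'M[R]_(m, n).
Local Notation L2 := (in_Lp mu 2%:E).
Local Notation dst F G := (ip mu (fun z => F z - G z) (fun z => F z - G z)).

Definition L2_subspace (S : (X -> 'M[R]_(m, n)) -> Prop) : Prop :=
  [/\ forall F, S F -> L2 F, S (fun=> 0),
      forall F G, S F -> S G -> S (fun z => F z + G z) &
      forall a F, S F -> S (fun z => a *: F z)].

(* The minimiser of |s|^2 - 2 l s over S, which lies in the closure of S. *)
Lemma Riesz_subspace (S : (X -> 'M[R]_(m, n)) -> Prop)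
    (l : (X -> 'M[R]_(m, n)) -> R) (C : R) : 0 <= C ->
  L2_subspace S ->
  (forall F G, S F -> S G -> l (fun z => F z + G z) = l F + l G) ->
  (forall a F, S F -> l (fun z => a *: F z) = a * l F) ->
  (forall F, S F -> l F ^+ 2 <= C * ip mu F F) ->
  exists P, [/\ L2 P, exists s : nat -> X -> 'M[R]_(m, n),
      (forall k, S (s k)) /\ (fun k => dst (s k) P) @ \oo --> 0 &
    forall F, S F -> ip mu P F = l F].
Proof.
move=> C0 [SL2 S0 SD SZ] lD lZ lC.
pose J F := ip mu F F - 2 * l F.
have JC F : S F -> - C <= J F.
  move=> SF; have := lC _ SF; rewrite /J; set x := ip _ _ _; set y := l F => yx.
  have x0 : 0 <= x by exact: ip_ge0.
  suff : 2 * y <= x + C by lra.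
  rewrite leNgt; apply/negP => h.
  have : (x + C) ^+ 2 < (2 * y) ^+ 2.
    by rewrite ltr_pXn2r// nnegrE ?addr_ge0// ltW// (le_lt_trans _ h)// addr_ge0.
  have : 0 <= (x - C) ^+ 2 by exact: sqr_ge0.
  have -> : (2 * y) ^+ 2 = 4 * y ^+ 2 by ring.
  have -> : (x + C) ^+ 2 = (x - C) ^+ 2 + 4 * (C * x) by ring.
  by lra.
pose E := [set J F | F in [set F | S F]].
have hE : has_inf E.
  split; first by exists (J (fun=> 0)), (fun=> 0).
  by exists (- C) => _ [F SF <-]; exact: JC.
pose j := inf E.
have jJ F : S F -> j <= J F by move=> SF; apply: ge_inf; [exact: hE.2|exists F].
have exs k : exists F, S F /\ J F < j + k.+1%:R^-1.
  have [|_ [F SF <-] h] := @inf_adherent _ E k.+1%:R^-1 _ hE.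
    by rewrite invr_gt0 ltr0n.
  by exists F.
have [s hs] : {s : nat -> X -> 'M[R]_(m, n) | forall k, S (s k) /\ J (s k) < j + k.+1%:R^-1}.
  by exists (fun k => sval (cid (exs k))) => k; case: (cid _).
have Ss k : S (s k) by have [] := hs k.
have Ls k := SL2 _ (Ss k).
(* Parallelogram law: J at the midpoint of F and G is not below the infimum, so almost minimal
   elements are close to each other. *)
have par F G : S F -> S G -> dst F G <= 2 * (J F - j) + 2 * (J G - j).
  move=> SF SG; have LF := SL2 _ SF; have LG := SL2 _ SG.
  have := jJ _ (SZ 2^-1 _ (SD _ _ SF SG)).
  have LFG := L2D LF LG.
  rewrite /J (lZ _ _ (SD _ _ SF SG)) (lD _ _ SF SG).
  rewrite (ipZl _ LFG (L2Z _ LFG)) (ipZr _ LFG LFG) (ipDD LF LG) (ipBB LF LG).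
  by lra.
have [|P [LP sP]] := L2_complete mu_fin Ls.
  move=> e e0; have [|N hN] := @invS_small R (e / 4); first by rewrite divr_gt0.
  exists N => p q Np Nq; have := par _ _ (Ss p) (Ss q).
  have := hN _ Np; have := hN _ Nq; have := (hs p).2; have := (hs q).2.
  move: (dst _ _) (J (s p)) (J (s q)) (p.+1%:R^-1) (q.+1%:R^-1) => *; lra.
exists P; split=> //; first by exists s.
move=> F SF; have LF := SL2 _ SF.
(* First-order condition. As [s k] is within 1/(k+1) of the infimum, J at [s k] + t F exceeds J at
   [s k] by at least -1/(k+1); the inequality is then passed to the limit in k. *)
have var t : 0 <= 2 * t * (ip mu P F - l F) + t ^+ 2 * ip mu F F.
  pose w k := k.+1%:R^-1 + 2 * t * (ip mu (s k) F - l F) + t ^+ 2 * ip mu F F.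
  have w0 k : 0 <= w k.
    have SZF := SZ t _ SF; have LZF := SL2 _ SZF.
    have := jJ _ (SD _ _ (Ss k) SZF); rewrite /J.
    rewrite (lD _ _ (Ss k) SZF) (lZ _ _ SF) (ipDD (Ls k) LZF).
    rewrite (ipZr _ (Ls k) LF) (ipZl _ LF LZF) (ipZr _ LF LF).
    have := (hs k).2; rewrite /J /w expr2; move: (k.+1%:R^-1) => *; lra.
  have cw : w @ \oo --> 0 + 2 * t * (ip mu P F - l F) + t ^+ 2 * ip mu F F.
    apply: cvgD; last exact: cvg_cst.
    apply: cvgD.
      apply/cvg_seqP => e /invS_small[N hN]; exists N => k /hN.
      by rewrite subr0 ger0_norm// invr_ge0.
    apply: cvgM; first exact: cvg_cst.
    by apply: cvgB; [exact: cvg_ip|exact: cvg_cst].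
  rewrite add0r in cw; rewrite -(cvg_lim _ cw)//.
  by apply: limr_ge; [apply/cvg_ex; eexists; exact: cw|exact: nearW].
apply/eqP; rewrite -subr_eq0; set a := ip mu P F - l F in var *.
set b := ip mu F F in var; have b0 : 0 <= b by exact: ip_ge0.
(* The [+ 1] keeps the denominator positive when b = 0; the resulting value is still negative unless
   a = 0. *)
have := var (- a / (b + 1)).
have -> : 2 * (- a / (b + 1)) * a + (- a / (b + 1)) ^+ 2 * b =
    - (a ^+ 2 * (b + 2) / (b + 1) ^+ 2).
  by field; rewrite gt_eqF// ltr_wpDl.
rewrite oppr_ge0 => h; apply/negP => /negP a0.
have : 0 < a ^+ 2 * (b + 2) / (b + 1) ^+ 2.
  apply: divr_gt0; last by rewrite exprn_gt0 ?ltr_wpDl.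
  by rewrite mulr_gt0 ?ltr_wpDl// exprn_even_gt0.
by rewrite ltNge h.
Qed.

(** P is the projection of F onto the closure of S: it represents the functional [ip mu F] on S, so
    F - P is orthogonal to S. The conclusion of the hypothesis is a vanishing norm and not F = 0,
    since fields are functions and not classes. *)
Lemma L2_dense (S : (X -> 'M[R]_(m, n)) -> Prop) : L2_subspace S ->
  (forall F, L2 F -> (forall G, S G -> ip mu F G = 0) -> ip mu F F = 0) ->
  forall F, L2 F -> exists s : nat -> X -> 'M[R]_(m, n),
    (forall k, S (s k)) /\ (fun k => dst (s k) F) @ \oo --> 0.
Proof.
move=> hS; case: (hS) => SL2 S0 SD SZ h F LF.
have [||||P [LP [s [Ss sP]] Pl]] := @Riesz_subspace S (fun G => ip mu F G) (ip mu F F) _ hS.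
- exact: ip_ge0.
- by move=> G H /SL2 LG /SL2 LH; rewrite ipDr.
- by move=> a G /SL2 LG; rewrite ipZr.
- by move=> G /SL2 LG; apply: ip_sqr_le.
have Ls k := SL2 _ (Ss k).
exists s; split=> //.
have d0 : dst P F = 0.
  apply: h; first exact: L2B.
  by move=> G SG; rewrite ipBl ?Pl ?subrr//; exact: SL2.
apply/cvg_seqP => e e0.
have [|N hN] := proj1 (cvg_seqP _ _) sP (e / 2); first by rewrite divr_gt0.
exists N => k /hN; rewrite !subr0 !ger0_norm ?ip_ge0// => hk.
by have := dst_triangle (Ls k) LP LF; rewrite d0; lra.
Qed.

(** Separability is bypassed. A diagonal extraction makes the products with every [F j] converge;
    the H whose products with the subsequence converge form a closed subspace S containing all
    [F j]. An arbitrary H is its projection onto S plus a field orthogonal to every [F k], so S is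
    everything, and the limit functional is represented by the Riesz lemma. *)
Lemma L2_weak_compact (F : nat -> X -> 'M[R]_(m, n)) (C : R) :
  (forall k, L2 (F k)) -> (forall k, ip mu (F k) (F k) <= C) ->
  exists s : nat -> nat, exists G, [/\ forall k, (s k < s k.+1)%N, L2 G &
    forall H, L2 H -> (fun k => ip mu (F (s k)) H) @ \oo --> ip mu G H].
Proof.
move=> LF FC.
have C0 : 0 <= C by rewrite (le_trans _ (FC 0%N))// ip_ge0.
have bnd k H : L2 H -> ip mu (F k) H ^+ 2 <= C * ip mu H H.
  move=> LH; apply: le_trans (ip_sqr_le (LF k) LH) _.
  by rewrite ler_wpM2r ?ip_ge0.
have [|s s1 hs] := @diagonal_extraction R (fun j k => ip mu (F k) (F j)) (fun=> C).
  move=> j k; rewrite -(@ler_pXn2r _ 2)// ?nnegrE// real_normK ?num_real//.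
  by rewrite (le_trans (bnd k _ (LF j)))// expr2 ler_wpM2l.
pose S H := L2 H /\ cvgn (fun k => ip mu (F (s k)) H).
have hS : L2_subspace S.
  split.
  - by move=> H [].
  - split; first exact: L2_0.
    have z0 : (fun _ : X => 0 : 'M[R]_(m, n)) = fun z => 0 *: (fun=> 0) z.
      by apply/funext => z; rewrite scale0r.
    rewrite z0; under eq_fun do rewrite (ipZr _ (LF _) (L2_0 mu m n)) mul0r.
    exact: is_cvg_cst.
  - move=> G H [LG cG] [LH cH]; split; first exact: L2D.
    by under eq_fun do rewrite ipDr//; exact: is_cvgD.
  - move=> a G [LG cG]; split; first exact: L2Z.
    by under eq_fun do rewrite ipZr//; apply: is_cvgM => //; exact: is_cvg_cst.
have Scl H (t : nat -> X -> 'M[R]_(m, n)) : L2 H -> (forall k, S (t k)) ->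
    (fun k => dst (t k) H) @ \oo --> 0 -> S H.
  move=> LH St tH; split=> //; apply: cauchy_seq_cvg => e e0.
  pose e3 := e / 4; have e30 : 0 < e3 by rewrite divr_gt0.
  have [|N hN] := proj1 (cvg_seqP _ _) tH (e3 ^+ 2 / (C + 1)).
    by rewrite divr_gt0 ?exprn_gt0 ?ltr_wpDl.
  have := hN _ (leqnn N); rewrite subr0 ger0_norm ?ip_ge0// => {hN}hN.
  have near k : `|ip mu (F k) (t N) - ip mu (F k) H| < e3.
    have [LN _] := St N; rewrite -ipBr//.
    rewrite -(@ltr_pXn2r _ 2)// ?nnegrE ?normr_ge0 ?ltW// real_normK ?num_real//.
    apply: le_lt_trans (bnd k _ (L2B LN LH)) _.
    apply: (@le_lt_trans _ _ ((C + 1) * dst (t N) H)).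
      by rewrite ler_wpM2r ?ip_ge0// lerDl.
    by rewrite mulrC -ltr_pdivlMr// ltr_wpDl.
  have /cvg_ex[l /cvg_seqP /(_ _ e30) [M hM]] := (St N).2.
  exists M => p q Mp Mq.
  have := near (s p); have := near (s q); have := hM _ Mp; have := hM _ Mq.
  by rewrite !ltr_norml /e3 => /andP[? ?] /andP[? ?] /andP[? ?] /andP[? ?]; apply/andP; split; lra.
have Sall H : L2 H -> S H.
  move=> LH.
  have [||||P [LP [t [St tP]] Pl]] := @Riesz_subspace S (fun G => ip mu H G) (ip mu H H) _ hS.
  - exact: ip_ge0.
  - by move=> G1 G2 [L1 _] [L2' _]; rewrite ipDr.
  - by move=> a G [LG _]; rewrite ipZr.
  - by move=> G [LG _]; apply: ip_sqr_le.
  have SP := Scl _ _ LP St tP.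
  (* All products of [H - P] with the subsequence vanish, because each [F (s k)] itself lies in
     S. *)
  have SHP : S (fun z => H z - P z).
    split; first exact: L2B.
    have -> : (fun k => ip mu (F (s k)) (fun z => H z - P z)) = fun=> 0.
      apply/funext => k; rewrite ipBr// !(ipC _ (F (s k))) (Pl (F (s k))) ?subrr//.
      by split=> //; exact: hs.
    exact: is_cvg_cst.
  have [_ _ SD _] := hS; have := SD _ _ SP SHP; congr S.
  by apply/funext => z; rewrite addrC subrK.
have hT : L2_subspace L2.
  by split=> //; [exact: L2_0|exact: L2D|exact: L2Z].
pose l H := limn (fun k => ip mu (F (s k)) H).
have lP H : L2 H -> (fun k => ip mu (F (s k)) H) @ \oo --> l H.
  by move=> /Sall[].
have [|||P [LP _ Pl]] := @Riesz_subspace L2 l C C0 hT.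
- move=> G H LG LH; apply/cvg_lim => //.
  by under eq_fun do rewrite ipDr//; apply: cvgD; exact: lP.
- move=> a G LG; apply/cvg_lim => //.
  by under eq_fun do rewrite ipZr//; apply: cvgM; [exact: cvg_cst|exact: lP].
- move=> G LG; have cl : (fun k => ip mu (F (s k)) G ^+ 2) @ \oo --> l G ^+ 2.
    by rewrite expr2; under eq_fun do rewrite expr2; apply: cvgM; exact: lP.
  rewrite -(cvg_lim _ cl)//; apply: limr_le; first by apply/cvg_ex; eexists; exact: cl.
  by apply: nearW => k; exact: bnd.
exists s, P; split=> // H LH; rewrite (Pl _ LH); exact: lP.
Qed.

(** From 2 <F k, G> <= |F k|^2 + |G|^2, letting k tend to infinity on the left. *)
Lemma weak_limit_norm_le (F : nat -> X -> 'M[R]_(m, n)) G (C : R) :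
  (forall k, L2 (F k)) -> (forall k, ip mu (F k) (F k) <= C) -> L2 G ->
  (fun k => ip mu (F k) G) @ \oo --> ip mu G G -> ip mu G G <= C.
Proof.
move=> LF FC LG cG.
have h k : 2 * ip mu (F k) G <= C + ip mu G G.
  by have := ip_ge0 mu (fun z => F k z - G z); rewrite ipBB//; have := FC k; lra.
suff : 2 * ip mu G G <= C + ip mu G G by lra.
have c2 : (fun k => 2 * ip mu (F k) G) @ \oo --> 2 * ip mu G G.
  by apply: cvgM => //; exact: cvg_cst.
rewrite -(cvg_lim _ c2)//; apply: limr_le; last exact: nearW.
by apply/cvg_ex; eexists; exact: c2.
Qed.

End L2_Hilbert.

(** * Continuous fields and the torus measure *)

Section continuity_of_fields.
Variable R : realType.

Lemma filter_forall_fin (T : Type) (I : finType) (G : set_system T)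
    {GF : Filter G} (P : I -> set T) :
  (forall i, G (P i)) -> G [set x | forall i, P i x].
Proof.
move=> h; suff : G [set x | forall i, i \in enum I -> P i x].
  by apply: filterS => x hx i; apply: hx; rewrite mem_enum.
elim: (enum I) => [|i s IHs]; first by apply: filterS filterT => x _ i.
apply: filterS (filterI (h i) IHs) => x [xi xs] j.
by rewrite in_cons => /predU1P[->|/xs].
Qed.

Lemma continuous_mxP (T : topologicalType) m n (F : T -> 'M[R]_(m, n)) :
  (forall i j, continuous (fun z => F z i j)) -> continuous F.
Proof.
move=> h z A [P nP sP]; rewrite nbhs_simpl /=.
have nz i j : nbhs z [set y | P i j (F y i j)] by exact: (h i j z _ (nP i j)).
have n2 : nbhs z [set y | forall i j, P i j (F y i j)].
  by apply: filter_forall_fin => i; apply: filter_forall_fin => j; exact: nz.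
by apply: filterS n2 => y hy; apply: sP.
Qed.

Lemma continuous_mx_entry (T : topologicalType) m n (F : T -> 'M[R]_(m, n)) i j :
  continuous F -> continuous (fun z => F z i j).
Proof.
move=> cF z; apply: (@continuous_comp _ _ _ F (fun M : 'M[R]_(m, n) => M i j)).
  exact: cF.
exact: coord_continuous.
Qed.

Lemma continuous_bigsum (T : topologicalType) (I : Type) (s : seq I) (f : I -> T -> R) :
  (forall i, continuous (f i)) -> continuous (fun z => \sum_(i <- s) f i z).
Proof.
move=> cf; elim: s => [|i s IHs].
  by under eq_fun do rewrite big_nil; move=> z; exact: cvg_cst.
under eq_fun do rewrite big_cons.
by move=> z; apply: cvgD; [exact: cf|exact: IHs].
Qed.

Lemma continuous_rV_cons n :
  continuous (fun p : R * 'rV[R]_n => rV_cons (p : measurableTypeR R * 'rV[R]_n)).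
Proof.
apply: continuous_mxP => i j; rewrite /rV_cons.
case: (split_ordP (j : 'I_(1 + n))) => k ->.
  rewrite [X in continuous X](_ : _ = fst); first by move=> z; exact: cvg_fst.
  by apply/funext => p; rewrite (row_mxEl (p.1%:M : 'rV[R]_1)) !ord1 mxE eqxx.
rewrite [X in continuous X](_ : _ = (fun p : R * 'rV[R]_n => p.2 i k)).
  by apply: continuous_mx_entry => z; exact: cvg_snd.
by apply/funext => p; rewrite (row_mxEr (p.1%:M : 'rV[R]_1)).
Qed.

Lemma measurable_countable_factor d (X : measurableType d) (C : countType)
    (q : X -> C) (g : C -> R) :
  (forall c, measurable (q @^-1` [set c])) -> measurable_fun setT (g \o q).
Proof.
move=> mq _ B mB; rewrite setTI.
have -> : (g \o q) @^-1` B = \bigcup_k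
    (if unpickle k is Some c then
       (if `[< B (g c) >] then q @^-1` [set c] else set0) else set0).
  apply/seteqP; split=> [x Bx|x [k _]].
    exists (pickle (q x)) => //; rewrite pickleK.
    by case: asboolP.
  by case: unpickle => // c; case: asboolP => // Bc qx; rewrite /preimage/= qx.
apply: bigcup_measurable => k _; case: unpickle => // c.
by case: ifP.
Qed.

Definition grid (k : nat) (t : R) : R := (Num.floor (k.+1%:R * t))%:~R / k.+1%:R.

Lemma grid_close k t : `|t - grid k t| <= k.+1%:R^-1.
Proof.
rewrite /grid; have k0 : (0 : R) < k.+1%:R by rewrite ltr0n.
have h : t = k.+1%:R * t / k.+1%:R by field; rewrite gt_eqF.
rewrite {1}h -mulrBl normrM normfV (gtr0_norm k0) ler_pdivrMr// mulVf ?gt_eqF//.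
have /andP[h1 h2] := real_floor_itv (num_real (k.+1%:R * t)).
rewrite ger0_norm ?subr_ge0//; move: h2; rewrite intrD => h2; lra.
Qed.

Lemma measurable_floor_eq d (X : measurableType d) (f : X -> R) (c : int) :
  measurable_fun setT f -> measurable [set x | Num.floor (f x) = c].
Proof.
move=> mf; have -> : [set x | Num.floor (f x) = c] = f @^-1` `[c%:~R, (c + 1)%:~R[.
  apply/seteqP; split=> x /=; rewrite in_itv/=.
    by move=> <-; exact: (real_floor_itv (num_real (f x))).
  exact: floor_def.
by rewrite -[X in measurable X]setTI; apply: mf => //; exact: measurable_itv.
Qed.

Lemma continuous_field_ball n (f : R * 'rV[R]_n -> R) (z : R * 'rV[R]_n) (e : R) :
  continuous f -> 0 < e -> exists2 d : R, 0 < d & forall y : R * 'rV[R]_n,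
    `|z.1 - y.1| < d -> (forall j, `|z.2 0 j - y.2 0 j| < d) ->
    `|f z - f y| < e.
Proof.
move=> cf e0; have nz : nbhs z [set t | `|f z - f t| < e].
  by have /cvgrPdist_lt /(_ e e0) := cf z.
have /nbhs_ballP[d d0 hd] := nz.
exists d => // y y1 y2; apply: hd; split=> //; split=> // i j.
by rewrite !ord1; exact: y2.
Qed.

(** The sigma-algebra is the product one, generated by coordinates and not by open sets. Here f is
    the pointwise limit of its samples on the grids of step 1/(k+1), each of which factors through a
    countable type. *)
Lemma continuous_measurable_field n (f : R * 'rV[R]_n -> R) : continuous f ->
  measurable_fun setT (f : measurableTypeR R * 'rV[R]_n -> R).
Proof.
move=> cf.
pose q k (z : measurableTypeR R * 'rV[R]_n) : int * 'rV[int]_n :=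
  (Num.floor (k.+1%:R * z.1), \row_j Num.floor (k.+1%:R * z.2 0 j)).
pose g k (c : int * 'rV[int]_n) :=
  f (c.1%:~R / k.+1%:R, \row_j ((c.2 0 j)%:~R / k.+1%:R)).
apply: (@measurable_fun_cvg _ _ R setT (fun k => g k \o q k)) => //.
  move=> k; apply: measurable_countable_factor => -[c1 c2].
  have -> : q k @^-1` [set (c1, c2)] =
     [set z : measurableTypeR R * 'rV[R]_n | Num.floor (k.+1%:R * z.1) = c1] `&`
     \bigcap_(j in [set: 'I_n])
       [set z : measurableTypeR R * 'rV[R]_n | Num.floor (k.+1%:R * z.2 0 j) = c2 0 j].
    apply/seteqP; split=> [z [<- <-]|z [h1 h2]].
      by split=> // j _; rewrite /= mxE.
    rewrite /preimage/= /q; congr pair => //.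
    by apply/rowP => j; rewrite mxE h2.
  apply: measurableI.
    by apply: measurable_floor_eq; apply: measurable_funM => //; exact: measurable_fst.
  apply: fin_bigcap_measurable => // j _; apply: measurable_floor_eq.
  apply: measurable_funM => //.
  exact: (measurableT_comp (measurable_fun_entry 0 j) measurable_snd).
move=> z _; apply/cvg_seqP => e e0.
have [d d0 hd] := continuous_field_ball (z : R * 'rV[R]_n) cf e0.
have [N hN] := invS_small d0; exists N => k /hN hk.
rewrite distrC; apply: hd => [|j].
  exact: le_lt_trans (grid_close k z.1) hk.
rewrite !mxE /=; exact: le_lt_trans (grid_close k (z.2 0 j)) hk.
Qed.

Definition cell (T : R) n : set (R * 'rV[R]_n) :=
  [set z : R * 'rV[R]_n | 0 <= z.1 <= T /\ forall i, 0 <= z.2 ord0 i <= 1].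

Lemma compact_cell T n : compact (@cell T n).
Proof.
have -> : @cell T n = [set` `[0, T]] `*` [set x : 'rV[R]_n | forall i, [set` `[0, 1]] (x ord0 i)].
  apply/seteqP; split=> z [z1 z2]; split.
  - by rewrite /= in_itv.
  - by move=> i; rewrite /= in_itv /= z2.
  - by move: z1; rewrite /= in_itv.
  - by move=> i; have := z2 i; rewrite /= in_itv.
apply: compact_setX; first exact: segment_compact.
exact: (@rV_compact (R : ptopologicalType) n (fun=> [set` `[0 : R, 1]]) (fun i => @segment_compact R 0 1)).
Qed.

Lemma continuous_bounded_cell T n (f : R * 'rV[R]_n -> R) : continuous f ->
  exists M : R, forall z, cell T z -> `|f z| <= M.
Proof.
move=> cf; have := @continuous_compact _ _ f (cell T (n := n)) _ (@compact_cell T n).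
move=> /(_ (continuous_subspaceT cf)) /compact_bounded [M [_ hM]].
exists (M + 1) => z cz; apply: (hM (M + 1)); first by rewrite ltrDl.
by exists z.
Qed.

End continuity_of_fields.

(** * Negligible sets and integrability for the space-time measure *)

Section torus_measure_facts.
Variable R : realType.

Lemma interval_measure_out (a b : R) : interval_measure a b (~` `[a, b]) = 0%E.
Proof. by rewrite /interval_measure /mrestr setICl measure0. Qed.

Lemma interval_measure1 (a b c : R) : interval_measure a b [set c] = 0%E.
Proof.
apply/eqP; rewrite -measure_le0 /=; apply: (@le_trans _ _ (lebesgue_measure [set c])).
  by rewrite /interval_measure /mrestr le_measure// ?inE//; exact: measurableI.
by rewrite lebesgue_measure_set1.
Qed.

Lemma interval_measureT (a b : R) : a <= b -> interval_measure a b setT = (b - a)%:E.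
Proof.
move=> ab; rewrite /interval_measure /mrestr setTI lebesgue_measure_itv /= lte_fin.
case: ltP => [_|ba]; first by rewrite EFinB.
by rewrite (@le_anti _ _ a b) ?subrr ?ab.
Qed.

Lemma torus_measure_coord n (i : 'I_n) (N : set (measurableTypeR R)) :
  measurable N -> interval_measure 0 1 N = 0%E ->
  torus_measure R n [set x | N (x 0 i)] = 0%E.
Proof.
move=> mN N0; elim: n i => [[]//|n IHn] i.
suff : (interval_measure 0 1 \x torus_measure R n)%E
    ((@rV_cons R n) @^-1` [set x | N (x 0 i)]) = 0%E by [].
rewrite /rV_cons; case: (split_ordP (i : 'I_(1 + n))) => k ->.
  have -> : (fun p : measurableTypeR R * 'rV[R]_n =>
      (row_mx (p.1)%:M p.2 : 'rV[R]_n.+1)) @^-1` [set x : 'rV[R]_n.+1 | N (x 0 (lshift n k))] = N `*` setT.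
    apply/seteqP; split=> [p|p [Np _]].
      by rewrite /preimage/= (row_mxEl (p.1%:M : 'rV[R]_1)) !ord1 mxE eqxx.
    by rewrite /preimage/= (row_mxEl (p.1%:M : 'rV[R]_1)) !ord1 mxE eqxx.
  rewrite product_measure1E//; transitivity (0 * torus_measure R n setT)%E; last exact: mul0e.
  by congr (_ * _)%E; exact: N0.
have -> : (fun p : measurableTypeR R * 'rV[R]_n =>
    (row_mx (p.1)%:M p.2 : 'rV[R]_n.+1)) @^-1` [set x : 'rV[R]_n.+1 | N (x 0 (rshift 1 k))] =
    setT `*` [set y : 'rV[R]_n | N (y 0 k)].
  apply/seteqP; split=> [p|p [_ Np]].
    by rewrite /preimage/= (row_mxEr (p.1%:M : 'rV[R]_1)).
  by rewrite /preimage/= (row_mxEr (p.1%:M : 'rV[R]_1)).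
rewrite product_measure1E//.
  transitivity (@interval_measure R 0 1 setT * 0)%E; last exact: mule0.
  by congr (_ * _)%E; exact: (IHn k).
rewrite -[X in measurable X]setTI; exact: (measurable_fun_entry 0 k).
Qed.

(** The faces of the cell are null. On the open cell the periodic bumps used for density converge to
    indicators. *)
Lemma torus_measure_ae n : {ae torus_measure R n, forall x : 'rV[R]_n, forall i, 0 < x 0 i < 1}.
Proof.
apply: ae_forall_count => i.
pose N : set (measurableTypeR R) := ~` `[0, 1] `|` [set 0] `|` [set 1].
have mN : measurable N.
  by apply: measurableU => //; apply: measurableU => //; exact: measurableC.
exists [set x : 'rV[R]_n | N (x 0 i)]; split.
- by rewrite -[X in measurable X]setTI; exact: (measurable_fun_entry 0 i).
- suff N0 : interval_measure 0 1 N = 0%E by exact: (torus_measure_coord i mN N0).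
  rewrite /N !measureU0//; [exact: interval_measure_out|exact: measurableC
    |exact: interval_measure1|by apply: measurableU => //; exact: measurableC
    |exact: interval_measure1].
- move=> x; rewrite /= /N /= in_itv/= => h.
  have [x0|x0] := eqVneq (x 0 i) 0; first by left; right.
  have [x1|x1] := eqVneq (x 0 i) 1; first by right.
  left; left => /andP[x0' x1']; apply: h.
  by rewrite !lt_neqAle x0' x1' x1 eq_sym x0.
Qed.

Variables (T : R) (d : nat).
Hypothesis T0 : 0 < T.
Local Notation mu := (spacetime_measure T d).

Lemma spacetime_measureE (A : set (measurableTypeR R)) (B : set 'rV[R]_d) :
  measurable A -> measurable B ->
  mu (A `*` B) = (interval_measure 0 T A * torus_measure R d B)%E.
Proof. exact: product_measure1E. Qed.

Lemma spacetime_measureT : mu setT = T%:E.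
Proof.
rewrite -setXTT spacetime_measureE// torus_measureT mule1.
by rewrite interval_measureT ?subr0// ltW.
Qed.

Lemma spacetime_fin : (mu setT < +oo)%E.
Proof. by rewrite spacetime_measureT ltry. Qed.

Lemma spacetime_gt0 : (0 < mu setT)%E.
Proof. by rewrite spacetime_measureT lte_fin. Qed.

Lemma spacetime_ae_time (P : R -> Prop) :
  {ae interval_measure 0 T, forall t, P t} -> {ae mu, forall z, P z.1}.
Proof.
move=> [N [mN N0 hN]]; exists (N `*` setT); split.
- exact: measurableX.
- by rewrite spacetime_measureE// N0 mul0e.
- by move=> z Pz; split=> //; apply: hN.
Qed.

Lemma spacetime_ae_space (P : 'rV[R]_d -> Prop) :
  {ae torus_measure R d, forall x, P x} -> {ae mu, forall z, P z.2}.
Proof.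
move=> [N [mN N0 hN]]; exists (setT `*` N); split.
- exact: measurableX.
- by rewrite spacetime_measureE// N0 mule0.
- by move=> z Pz; split=> //; apply: hN.
Qed.

Lemma spacetime_ae_interior :
  {ae mu, forall z : R * 'rV[R]_d, 0 <= z.1 <= T /\ forall i, 0 < z.2 0 i < 1}.
Proof.
have h1 : {ae mu, forall z : R * 'rV[R]_d, 0 <= z.1 <= T}.
  apply: (@spacetime_ae_time (fun t => 0 <= t <= T)); exists (~` `[0, T]); split.
  - exact: measurableC.
  - exact: interval_measure_out.
  - by move=> t /= h; rewrite in_itv.
have h2 : {ae mu, forall z : R * 'rV[R]_d, forall i, 0 < z.2 0 i < 1}.
  exact: (@spacetime_ae_space (fun x : 'rV[R]_d => forall i, 0 < x 0 i < 1) (@torus_measure_ae d)).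
exact: ae_and h1 h2.
Qed.

Lemma spacetime_ae_cell : {ae mu, forall z, cell T z}.
Proof.
apply: (ae_imp spacetime_ae_interior) => z [z1 z2]; split=> // i.
by have /andP[/ltW -> /ltW ->] := z2 i.
Qed.

Lemma continuous_Loo m n (F : R * 'rV[R]_d -> 'M[R]_(m, n)) :
  (forall i j, continuous (fun z => F z i j)) -> in_Lp mu +oo%E F.
Proof.
move=> cF.
have mF : measurable_fun setT (F : measurableTypeR R * 'rV[R]_d -> 'M[R]_(m, n)).
  by apply/measurable_fun_matrixP => i j; exact: continuous_measurable_field.
have cf : continuous (fun z => frob_dot (F z) (F z)).
  apply: continuous_bigsum => i; apply: continuous_bigsum => j z.
  by apply: cvgM; exact: cF.
have [M hM] := continuous_bounded_cell T cf.
apply: (in_LyP spacetime_gt0 (M := Num.sqrt M) mF).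
apply: (ae_imp spacetime_ae_cell) => z /hM h.
by rewrite /frobenius ler_wsqrtr// (le_trans (ler_norm _) h).
Qed.

Lemma continuous_L2 m n (F : R * 'rV[R]_d -> 'M[R]_(m, n)) :
  (forall i j, continuous (fun z => F z i j)) -> in_Lp mu 2%:E F.
Proof.
by move=> cF; apply: (Loo_L2 spacetime_fin spacetime_gt0); exact: continuous_Loo.
Qed.

Lemma continuous_intg (f : R * 'rV[R]_d -> R) : continuous f -> intg mu f.
Proof.
move=> cf; have [M hM] := continuous_bounded_cell T cf.
apply: (ae_le_intg (g := fun=> M)).
- exact: continuous_measurable_field.
- by apply: intg_cst; exact: spacetime_fin.
- by apply: (ae_imp spacetime_ae_cell) => z /hM.
Qed.

End torus_measure_facts.

(** * Derivatives of periodic functions integrate to zero *)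

Section integration_by_parts_on_the_torus.
Variable R : realType.

(** [phi] carries the line through p in direction v to the line through [phi p] in direction w, so
    the two difference quotients are the same function of h. *)
Lemma derive_affine (V W : normedModType R) (phi : V -> W) (F : W -> R) p v w :
  (forall h : R, phi (h *: v + p) = h *: w + phi p) ->
  'D_v (F \o phi) p = 'D_w F (phi p) /\
  (derivable F (phi p) w -> derivable (F \o phi) p v).
Proof.
move=> hphi; have E : (fun h : R => h^-1 *: (((F \o phi) \o shift p) (h *: v) - (F \o phi) p)) =
    (fun h : R => h^-1 *: ((F \o shift (phi p)) (h *: w) - F (phi p))).
  by apply/funext => h /=; rewrite hphi.
by rewrite /derive /derivable E.
Qed.

Lemma interval_integral (a b : R) (f : R -> R) : continuous f ->
  (\int[interval_measure a b]_t (f t)%:E =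
   \int[lebesgue_measure]_(t in `[a, b]) (f t)%:E)%E.
Proof.
move=> cf.
have mf : measurable_fun setT f by exact: continuous_measurable_fun.
have cw : {within `[a, b], continuous f} by exact: continuous_subspaceT.
have [M hM] : exists M : R, forall t, t \in `[a, b] -> `|f t| <= M.
  have /compact_bounded[M [_ hM]] := continuous_compact cw (@segment_compact R a b).
  exists (M + 1) => t tab; apply: (hM (M + 1)); first by rewrite ltrDl.
  by exists t.
have ae : {ae interval_measure a b, forall t, `|f t| <= M}.
  exists (~` `[a, b]); split; [exact: measurableC|exact: interval_measure_out|].
  by move=> t /= h tab; apply: h; exact: hM.
have fin : (interval_measure a b setT < +oo)%E.
  by rewrite ltey_eq fin_num_measure.
have iF : intg (interval_measure a b) f.
  by apply: (ae_le_intg (g := fun=> M)) => //; exact: intg_cst.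
transitivity (\int[interval_measure a b]_(t in setT `\` ~` `[a, b]) (f t)%:E)%E.
  apply: negligible_integral => //; first exact: measurableC.
  exact: interval_measure_out.
rewrite setTD setCK; apply: eq_measure_integral => A mA Aab.
by rewrite /interval_measure /= /mrestr; congr (lebesgue_measure _); exact/setIidPl.
Qed.

Lemma interval_integral_derive_periodic (a b : R) (g : R -> R) : a < b ->
  continuous g -> (forall s, derivable g s 1) -> continuous (fun s => 'D_1 g s) ->
  g b = g a ->
  (\int[interval_measure a b]_t ('D_1 g t)%:E = 0)%E.
Proof.
move=> ab cg dg cdg gab; rewrite interval_integral//.
rewrite (@continuous_FTC2 _ (fun s => 'D_1 g s) g a b ab).
- by rewrite gab -EFinB subrr.
- exact: continuous_subspaceT.
- split.
  + by move=> x _; exact: dg.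
  + by apply: cvg_at_right_filter; exact: cg.
  + by apply: cvg_at_left_filter; exact: cg.
- by move=> x _; rewrite derive1E.
Qed.

Lemma continuous_slice_time n (f : R * 'rV[R]_n -> R) y : continuous f ->
  continuous (fun t : R => f (t, y)).
Proof.
move=> cf t; apply: (@continuous_comp _ _ _ (fun s : R => (s, y)) f); last exact: cf.
exact: (@cvg_pair _ _ _ (nbhs t) (nbhs t) (nbhs y) _ _ _ id (fun=> y) cvg_id (cvg_cst y)).
Qed.

Lemma continuous_slice_space n (f : R * 'rV[R]_n -> R) t : continuous f ->
  continuous (fun y : 'rV[R]_n => f (t, y)).
Proof.
move=> cf y; apply: (@continuous_comp _ _ _ (fun y : 'rV[R]_n => (t, y)) f); last exact: cf.
exact: (@cvg_pair _ _ _ (nbhs y) (nbhs t) (nbhs y) _ _ _ (fun=> t) id (cvg_cst t) cvg_id).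
Qed.

Lemma time_line n (y : 'rV[R]_n) (s h : R) :
  (h *: (1 : R) + s, y) = h *: ((1, 0) : R * 'rV[R]_n) + (s, y).
Proof.
have -> : h *: ((1, 0) : R * 'rV[R]_n) + (s, y) = (h *: 1 + s, h *: 0 + y) by [].
by rewrite scaler0 add0r.
Qed.

Lemma space_line n (t : R) (y e : 'rV[R]_n) (h : R) :
  (t, h *: e + y) = h *: ((0, e) : R * 'rV[R]_n) + (t, y).
Proof.
have -> : h *: ((0, e) : R * 'rV[R]_n) + (t, y) = (h *: 0 + t, h *: e + y) by [].
by rewrite scaler0 add0r.
Qed.

Lemma spacetime_integral_dt_periodic (T : R) n (G : R * 'rV[R]_n -> R) : 0 < T ->
  continuous G -> (forall z, derivable G z (1, 0)) -> continuous (dt G) ->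
  (forall y, G (T, y) = G (0, y)) ->
  (\int[spacetime_measure T n]_z (dt G z)%:E = 0)%E.
Proof.
move=> T0 cG dG cdG G1.
rewrite /spacetime_measure -integral21_prod_meas1; last exact: continuous_intg.
rewrite -[RHS](@integral0 _ _ _ (torus_measure R n) setT).
apply: eq_integral => y _; rewrite /fubini_G.
have e s := @derive_affine R (R * 'rV[R]_n)%type (fun s : R => (s, y)) G s 1 (1, 0)
  (fun h => time_line y s h).
transitivity (\int[interval_measure 0 T]_t ('D_1 (fun s => G (s, y)) t)%:E)%E.
  by apply: eq_integral => t _; rewrite /dt -(e t).1.
apply: interval_integral_derive_periodic => //.
- exact: continuous_slice_time.
- by move=> s; exact: (e s).2.
- rewrite (_ : (fun s => _) = (fun s => dt G (s, y))).
    exact: (continuous_slice_time cdG).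
  by apply/funext => s; rewrite /dt -(e s).1.
Qed.

(** The vanishing on the torus is taken as a hypothesis because the lemma serves twice: inside the
    induction on the dimension, where the first torus coordinate plays the part of time, and again
    once that induction is complete. *)
Lemma spacetime_integral_dx_of_torus (T : R) n (i : 'I_n) : 0 < T ->
  (forall F : 'rV[R]_n -> R, continuous F -> (forall x, F (x + basis_vec R i) = F x) ->
    (forall x, derivable F x (basis_vec R i)) ->
    continuous (fun x => 'D_(basis_vec R i) F x) ->
    (\int[torus_measure R n]_x ('D_(basis_vec R i) F x)%:E = 0)%E) ->
  forall G : R * 'rV[R]_n -> R,
  continuous G -> (forall t x, G (t, x + basis_vec R i) = G (t, x)) ->
  (forall z, derivable G z (0, basis_vec R i)) -> continuous (dx i G) ->
  (\int[spacetime_measure T n]_z (dx i G z)%:E = 0)%E.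
Proof.
move=> T0 IH G cG pG dG cdG.
rewrite /spacetime_measure -integral12_prod_meas1; last exact: continuous_intg.
rewrite -[RHS](@integral0 _ _ _ (interval_measure 0 T) setT).
apply: eq_integral => t _; rewrite /fubini_F.
have e y := @derive_affine 'rV[R]_n (R * 'rV[R]_n)%type (fun y : 'rV[R]_n => (t, y)) G y
  (basis_vec R i) (0, basis_vec R i) (fun h => space_line t y (basis_vec R i) h).
transitivity (\int[torus_measure R n]_y ('D_(basis_vec R i) (fun y => G (t, y)) y)%:E)%E.
  by apply: eq_integral => y _; rewrite /dx -(e y).1.
apply: IH => //.
- exact: continuous_slice_space.
- by move=> y; exact: (e y).2.
- rewrite (_ : (fun x => _) = (fun y => dx i G (t, y))).
    exact: (continuous_slice_space cdG).
  by apply/funext => y; rewrite /dx -(e y).1.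
Qed.

Lemma rV_cons_l n (p : R * 'rV[R]_n) (k : 'I_1) :
  @rV_cons R n p 0 (lshift n k : 'I_n.+1) = p.1.
Proof. by rewrite /rV_cons (row_mxEl (p.1%:M : 'rV[R]_1)) !ord1 mxE eqxx. Qed.

Lemma rV_cons_r n (p : R * 'rV[R]_n) (k : 'I_n) :
  @rV_cons R n p 0 (rshift 1 k : 'I_n.+1) = p.2 0 k.
Proof. by rewrite /rV_cons (row_mxEr (p.1%:M : 'rV[R]_1)). Qed.

Lemma rV_cons_time n (p : R * 'rV[R]_n) (h : R) :
  @rV_cons R n (h *: ((1, 0) : R * 'rV[R]_n) + p) =
  h *: basis_vec R (lshift n (ord0 : 'I_1) : 'I_n.+1) + @rV_cons R n p.
Proof.
case: p => s y; rewrite -time_line.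
apply/rowP => j; rewrite [RHS]mxE [X in _ = X + _]mxE.
case: (split_ordP (j : 'I_(1 + n))) => k ->.
  by rewrite !rV_cons_l /basis_vec mxE !ord1 !eqxx.
by rewrite !rV_cons_r /basis_vec mxE (_ : rshift 1 k == _ = false) ?andbF ?mulr0 ?add0r.
Qed.

Lemma rV_cons_space n (p : R * 'rV[R]_n) (k : 'I_n) (h : R) :
  @rV_cons R n (h *: ((0, basis_vec R k) : R * 'rV[R]_n) + p) =
  h *: basis_vec R (rshift 1 k : 'I_n.+1) + @rV_cons R n p.
Proof.
case: p => s y; rewrite -space_line.
apply/rowP => j; rewrite [RHS]mxE [X in _ = X + _]mxE.
case: (split_ordP (j : 'I_(1 + n))) => l ->.
  by rewrite !rV_cons_l /basis_vec mxE (_ : lshift n l == _ = false) ?andbF ?mulr0 ?add0r// !ord1.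
rewrite !rV_cons_r /basis_vec !mxE.
by have -> : ((rshift 1 l : 'I_n.+1) == rshift 1 k) = (l == k) by rewrite -!val_eqE.
Qed.

(** Induction on the dimension: by construction of the measure, the torus of dimension n + 1 is the
    cylinder over [0, 1] and the torus of dimension n. The first coordinate is then a time in which
    F is periodic, and the others are covered by the induction hypothesis. *)
Lemma torus_integral_derive n (i : 'I_n) (F : 'rV[R]_n -> R) :
  continuous F -> (forall x, F (x + basis_vec R i) = F x) ->
  (forall x, derivable F x (basis_vec R i)) ->
  continuous (fun x => 'D_(basis_vec R i) F x) ->
  (\int[torus_measure R n]_x ('D_(basis_vec R i) F x)%:E = 0)%E.
Proof.
elim: n i F => [[]//|n IHn] i F cF pF dF cdF.
have cc : continuous (fun p : R * 'rV[R]_n => F (@rV_cons R n p)).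
  move=> p; apply: (@continuous_comp _ _ _ (fun p : R * 'rV[R]_n => @rV_cons R n p) F).
    exact: continuous_rV_cons.
  exact: cF.
have cdc : continuous (fun p : R * 'rV[R]_n => 'D_(basis_vec R i) F (@rV_cons R n p)).
  move=> p; apply: (@continuous_comp _ _ _ (fun p : R * 'rV[R]_n => @rV_cons R n p)
    (fun x => 'D_(basis_vec R i) F x)).
    exact: continuous_rV_cons.
  exact: cdF.
have mdF : measurable_fun setT (fun x => 'D_(basis_vec R i) F x).
  have c2 : continuous (fun p : R * 'rV[R]_n.+1 => 'D_(basis_vec R i) F p.2).
    move=> p; apply: (@continuous_comp _ _ _ snd (fun x => 'D_(basis_vec R i) F x)).
      exact: cvg_snd.
    exact: cdF.
  exact: (measurableT_comp (continuous_measurable_field c2) (pair1_measurable (0 : measurableTypeR R))).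
transitivity (\int[spacetime_measure 1 n]_p ('D_(basis_vec R i) F (@rV_cons R n p))%:E)%E.
  rewrite [LHS](@integral_pushforward _ _ _ _ R (@rV_cons R n) (@measurable_rV_cons R n)
    (spacetime_measure 1 n) setT (fun x => ('D_(basis_vec R i) F x)%:E)).
  - by rewrite preimage_setT.
  - exact/measurable_EFinP.
  - by rewrite preimage_setT; exact: continuous_intg.
  - exact: measurableT.
move: i pF dF cdF cdc mdF => i; case: (split_ordP (i : 'I_(1 + n))) => k -> pF dF cdF cdc _.
  have -> : k = ord0 by rewrite ord1.
  rewrite (_ : k = ord0) in pF dF cdF cdc; last by rewrite ord1.
  have e p := derive_affine F (fun h => @rV_cons_time n p h).
  transitivity (\int[spacetime_measure 1 n]_p (dt (fun p : R * 'rV[R]_n => F (@rV_cons R n p)) p)%:E)%E.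
    by apply: eq_integral => p _; rewrite /dt -(e p).1.
  apply: spacetime_integral_dt_periodic => //.
  - by move=> p; exact: (e p).2.
  - rewrite (_ : dt _ = fun p => 'D_(basis_vec R (lshift n (ord0 : 'I_1))) F (@rV_cons R n p))//.
    by apply/funext => p; rewrite -(e p).1.
  - move=> y; rewrite -[RHS]pF; congr F.
    have := rV_cons_time ((0, y) : R * 'rV[R]_n) 1.
    have -> : 1 *: ((1, 0) : R * 'rV[R]_n) + (0, y) = (1, y).
      by rewrite scale1r -[LHS]/(1 + 0, 0 + y) addr0 add0r.
    by move=> ->; rewrite scale1r addrC.
have e p := derive_affine F (fun h => @rV_cons_space n p k h).
transitivity (\int[spacetime_measure 1 n]_p (dx k (fun p : R * 'rV[R]_n => F (@rV_cons R n p)) p)%:E)%E.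
  by apply: eq_integral => p _; rewrite /dx -(e p).1.
apply: (@spacetime_integral_dx_of_torus 1 n k ltr01 (IHn k)) => //.
- move=> t x; rewrite -[RHS]pF; congr F.
  have := rV_cons_space ((t, x) : R * 'rV[R]_n) k 1.
  have -> : 1 *: ((0, basis_vec R k) : R * 'rV[R]_n) + (t, x) = (t, x + basis_vec R k).
    by rewrite scale1r -[LHS]/(0 + t, basis_vec R k + x) add0r addrC.
  by move=> ->; rewrite scale1r addrC.
- by move=> p; exact: (e p).2.
- rewrite (_ : dx k _ = fun p => 'D_(basis_vec R (rshift 1 k : 'I_n.+1)) F (@rV_cons R n p))//.
  by apply/funext => p; rewrite -(e p).1.
Qed.

Lemma Rint_dx (T : R) n (i : 'I_n) (G : R * 'rV[R]_n -> R) : 0 < T ->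
  continuous G -> (forall t, Zn_periodic (fun x => G (t, x))) ->
  (forall z, derivable G z (0, basis_vec R i)) -> continuous (dx i G) ->
  \int[spacetime_measure T n]_z dx i G z = 0.
Proof.
move=> T0 cG pG dG cdG; rewrite /Rintegral (spacetime_integral_dx_of_torus (i := i) T0)//.
- exact: torus_integral_derive.
- by move=> t x; exact: pG.
Qed.

Lemma L2_space_field (T : R) n m p (V : 'rV[R]_n -> 'M[R]_(m, p)) : 0 < T ->
  in_Lp (torus_measure R n) 2%:E V ->
  in_Lp (spacetime_measure T n) 2%:E (fun z => V z.2).
Proof.
move=> T0 /in_L2P[mV iV]; apply/in_L2P; split.
  exact: (measurableT_comp mV measurable_snd).
have mf : measurable_fun setT (fun x => frob_dot (V x) (V x)) by exact: measurable_frob_dot.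
apply/integrableP; split.
  apply/measurable_EFinP.
  exact: (measurableT_comp mf measurable_snd).
under eq_integral do rewrite /= ger0_norm ?frob_dot_ge0//.
rewrite /spacetime_measure fubini_tonelli1; last 2 first.
- by apply/measurable_EFinP; exact: (measurableT_comp mf measurable_snd).
- by move=> z; rewrite lee_fin frob_dot_ge0.
rewrite /fubini_F /=.
have fin : (\int[torus_measure R n]_x (frob_dot (V x) (V x))%:E < +oo)%E.
  move/integrableP : iV => [_]; congr (_ < _)%E; apply: eq_integral => x _ /=.
  by rewrite ger0_norm ?frob_dot_ge0.
rewrite integral_cst//= lte_mul_pinfty//.
- by apply: integral_ge0 => x _; rewrite lee_fin frob_dot_ge0.
- by rewrite ge0_fin_numE// integral_ge0// => x _; rewrite lee_fin frob_dot_ge0.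
- by rewrite ltey_eq fin_num_measure.
Qed.

End integration_by_parts_on_the_torus.

(** * Smooth fields and their density *)

Section smooth_functions.
Variable R : realType.

Lemma is_derive_line (V : normedModType R) (f : V -> R) (z v : V) (df : R) :
  is_derive z v f df <-> is_derive (0 : R) 1 (fun h : R => f (h *: v + z)) df.
Proof.
have E : (fun h : R => h^-1 *: ((f \o shift z) (h *: v) - f z)) =
    (fun h : R => h^-1 *: (((fun h : R => f (h *: v + z)) \o shift 0) (h *: (1 : R)) -
      (fun h : R => f (h *: v + z)) 0)).
  apply/funext => h /=; rewrite addr0 scale0r add0r.
  by rewrite [h *: 1](_ : _ = h)// /GRing.scale /= mulr1.
by split=> -[ex dv]; split; move: ex dv; rewrite /derivable /derive E.
Qed.

Lemma is_derive_chain (V : normedModType R) (g : R -> R) (f : V -> R) (z v : V) (dg df : R) :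
  is_derive (f z) 1 g dg -> is_derive z v f df ->
  is_derive z v (fun y => g (f y)) (dg * df).
Proof.
move=> hg /is_derive_line hf; apply/is_derive_line.
apply: (@is_derive1_comp R g (fun h => f (h *: v + z)) 0 dg df) => //.
by rewrite scale0r add0r.
Qed.

(* A class of functions closed under all directional derivatives; membership
   yields smoothness without computing higher derivatives. *)
Inductive elementary (V : normedModType R) : (V -> R) -> Prop :=
| elem_cst c : elementary (fun=> c)
| elem_lin (L : V -> R) : continuous L ->
    (forall (h : R) v p, L (h *: v + p) = h * L v + L p) -> elementary L
| elem_add f g : elementary f -> elementary g -> elementary (fun z => f z + g z)
| elem_mul f g : elementary f -> elementary g -> elementary (fun z => f z * g z)
| elem_exp f : elementary f -> elementary (fun z => expR (f z))
| elem_sin f : elementary f -> elementary (fun z => sin (f z))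
| elem_cos f : elementary f -> elementary (fun z => cos (f z))
| elem_inv f : elementary f -> (forall z, 0 < f z) -> elementary (fun z => (f z)^-1)
| elem_ln f : elementary f -> (forall z, 0 < f z) -> elementary (fun z => ln (f z)).

Lemma elementary_derive (V : normedModType R) (f : V -> R) : elementary f ->
  continuous f /\ forall v, (forall z, derivable f z v) /\
    elementary (fun z => 'D_v f z).
Proof.
(* The induction carries explicit derivatives, so that each case can assemble its own from those of
   its parts without leaving the class. *)
move=> ef; suff : continuous f /\ forall v, exists2 df : V -> R, elementary df &
    forall z, is_derive z v f (df z).
  move=> [cf h]; split=> // v; have [df edf hdf] := h v; split.
    by move=> z; case: (hdf z).
  by rewrite (_ : (fun z => _) = df)//; apply/funext => z; case: (hdf z).
elim: f / ef => [c|L cL hL|f g ef [cf df] eg [cg dg]|f g ef [cf df] eg [cg dg]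
  |f ef [cf df]|f ef [cf df]|f ef [cf df]|f ef [cf df] f0|f ef [cf df] f0].
- split; first by move=> z; exact: cvg_cst.
  by move=> v; exists (fun=> 0) => [|z]; [exact: elem_cst|exact: is_derive_cst].
- split=> // v; exists (fun=> L v) => [|z]; first exact: elem_cst.
  apply/is_derive_line; rewrite (_ : (fun h => _) = (fun h : R => h * L v + L z)); last first.
    by apply/funext => h; rewrite hL.
  have h1 : is_derive (0 : R) 1 (fun h : R => h * L v) (L v).
    have h := @is_deriveM R R id (cst (L v)) 0 1 1 0 (is_derive_id _ _) (is_derive_cst _ _ _).
    by move: h; rewrite /GRing.scale /= mul0r add0r mulr1.
  have h2 : is_derive (0 : R) 1 (fun _ : R => L z) 0 by exact: is_derive_cst.
  by have := is_deriveD h1 h2; rewrite addr0.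
- split; first by move=> z; apply: cvgD; [exact: cf|exact: cg].
  move=> v; have [f' ef' hf'] := df v; have [g' eg' hg'] := dg v.
  exists (fun z => f' z + g' z) => [|z]; first exact: elem_add.
  exact: is_deriveD.
- split; first by move=> z; apply: cvgM; [exact: cf|exact: cg].
  move=> v; have [f' ef' hf'] := df v; have [g' eg' hg'] := dg v.
  exists (fun z => f z * g' z + g z * f' z) => [|z].
    by apply: elem_add; apply: elem_mul.
  exact: is_deriveM.
- split; first by move=> z; apply: continuous_comp; [exact: cf|exact: continuous_expR].
  move=> v; have [f' ef' hf'] := df v.
  exists (fun z => expR (f z) * f' z) => [|z]; first by apply: elem_mul => //; exact: elem_exp.
  by apply: is_derive_chain.
- split; first by move=> z; apply: continuous_comp; [exact: cf|exact: continuous_sin].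
  move=> v; have [f' ef' hf'] := df v.
  exists (fun z => cos (f z) * f' z) => [|z]; first by apply: elem_mul => //; exact: elem_cos.
  by apply: is_derive_chain.
- split; first by move=> z; apply: continuous_comp; [exact: cf|exact: continuous_cos].
  move=> v; have [f' ef' hf'] := df v.
  exists (fun z => (-1 * sin (f z)) * f' z) => [|z].
    by apply: elem_mul => //; apply: elem_mul; [exact: elem_cst|exact: elem_sin].
  by rewrite mulN1r; apply: is_derive_chain.
- split; first by move=> z; apply: cvgV; [rewrite gt_eqF|exact: cf].
  move=> v; have [f' ef' hf'] := df v.
  exists (fun z => (-1 * ((f z)^-1 * (f z)^-1)) * f' z) => [|z].
    apply: elem_mul => //; apply: elem_mul; first exact: elem_cst.
    by apply: elem_mul; apply: elem_inv.
  apply: (@is_derive_chain V (fun y => y^-1)) => //.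
  have := @is_deriveV R id (f z) 1 1 _ (is_derive_id _ _).
  rewrite /= gt_eqF// => /(_ isT).
  by rewrite /GRing.scale /= mulr1 mulN1r expr2 invfM.
- split; first by move=> z; apply: continuous_comp; [exact: cf|exact: continuous_ln].
  move=> v; have [f' ef' hf'] := df v.
  exists (fun z => (f z)^-1 * f' z) => [|z]; first by apply: elem_mul => //; exact: elem_inv.
  by apply: is_derive_chain; exact: is_derive1_ln.
Qed.

Lemma elementary_smooth (V : normedModType R) (f : V -> R) : elementary f -> smooth f.
Proof.
move=> ef k; elim: k f ef => [|k IHk] f /elementary_derive[cf df].
  by split.
split=> // v; have [dv ev] := df v; split=> //.
exact: IHk.
Qed.

Section smooth_properties.
Variable V : normedModType R.
Implicit Types f : V -> R.

Lemma smooth_continuous f : smooth f -> continuous f.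
Proof. by move=> /(_ 0%N)[]. Qed.

Lemma smooth_derivable f z v : smooth f -> derivable f z v.
Proof. by move=> /(_ 1%N)[_ /(_ v)[]]. Qed.

Lemma smooth_derive f v : smooth f -> smooth (fun z => 'D_v f z).
Proof. by move=> sf k; have [_ /(_ v)[]] := sf k.+1. Qed.

End smooth_properties.

Variable d : nat.

Lemma smooth_periodic_derive (f : R * 'rV[R]_d -> R) v :
  smooth_periodic f -> smooth_periodic (fun z => 'D_v f z).
Proof.
move=> [sf pf]; split; first exact: smooth_derive.
move=> t i x; pose w : R * 'rV[R]_d := (0, basis_vec R i).
have pw y : f (y + w) = f y.
  by case: y => s y; rewrite -[X in f X]/(s + 0, y + basis_vec R i) addr0 pf.
have -> : (t, x + basis_vec R i) = (t, x) + w :> R * 'rV[R]_d.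
  by rewrite -[RHS]/(t + 0, x + basis_vec R i) addr0.
have E : (fun h : R => h^-1 *: ((f \o shift ((t, x) + w)) (h *: v) - f ((t, x) + w))) =
    (fun h : R => h^-1 *: ((f \o shift (t, x)) (h *: v) - f (t, x))).
  by apply/funext => h /=; rewrite addrA !pw.
by rewrite /derive E.
Qed.

(* The sharpness n^2 beats the prefactor n, so that the limit at s = 0 is 0. *)
Definition step (n : nat) (s : R) : R := (1 + n.+1%:R * expR (- (n.+1%:R ^+ 2 * s)))^-1.

Lemma step_den_gt1 n s : 1 < 1 + n.+1%:R * expR (- (n.+1%:R ^+ 2 * s)) :> R.
Proof. by rewrite ltrDl mulr_gt0 ?ltr0n ?expR_gt0. Qed.

Lemma step_ge0 n s : 0 <= step n s.
Proof. by rewrite /step invr_ge0 ltW// (lt_trans _ (step_den_gt1 _ _)). Qed.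

Lemma step_le1 n s : step n s <= 1.
Proof. by rewrite /step invf_le1 ?ltW ?step_den_gt1// (lt_trans _ (step_den_gt1 _ _)). Qed.

(** With N = n + 1: for s > 0 the bound e^y >= y gives N e^(-N^2 s) <= 1/(N s); for s <= 0 the
    denominator is at least N. *)
Lemma cvg_step s : (fun n => step n s) @ \oo --> (if 0 < s then 1 else 0 : R).
Proof.
case: ltP => s0; apply/cvg_seqP => e e0.
  have [N hN] := invS_small (mulr_gt0 e0 s0); exists N => n /hN hn.
  have n0 : 0 < n.+1%:R :> R by rewrite ltr0n.
  set x := n.+1%:R * expR (- (n.+1%:R ^+ 2 * s)).
  have x0 : 0 < x by rewrite mulr_gt0 ?expR_gt0.
  have xe : x < e.
    have y0 : 0 < n.+1%:R ^+ 2 * s by rewrite mulr_gt0// exprn_gt0.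
    have h : expR (- (n.+1%:R ^+ 2 * s)) * (n.+1%:R ^+ 2 * s) <= 1.
      rewrite expRN ler_pdivrMl ?expR_gt0// mulr1.
      by rewrite (le_trans _ (expR_ge1Dx _))// lerDr.
    have : x * (n.+1%:R * s) <= 1.
      by apply: le_trans h; rewrite /x le_eqVlt; apply/orP; left; apply/eqP; ring.
    rewrite -ler_pdivlMr ?mulr_gt0// => /le_lt_trans; apply.
    by rewrite div1r invfM -ltr_pdivlMr ?invr_gt0// invrK.
  have d0 : 0 < 1 + x by rewrite addr_gt0.
  rewrite /step -/x (_ : _ - 1 = - (x / (1 + x))); last by field; rewrite gt_eqF.
  rewrite normrN ger0_norm ?divr_ge0 ?ltW//.
  by rewrite (le_lt_trans _ xe)// ler_pdivrMr// ler_pMr// lerDl ltW.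
have [N hN] := invS_small e0; exists N => n /hN hn.
rewrite subr0 ger0_norm ?step_ge0// (le_lt_trans _ hn)//.
have dp := lt_trans ltr01 (step_den_gt1 n s); rewrite /step lef_pV2 ?posrE ?ltr0n//.
rewrite -[leLHS]add0r lerD// ler_peMr ?ler0n//.
by rewrite -[leLHS]expR0 ler_expR oppr_ge0 mulr_ge0_le0// exprn_ge0.
Qed.


Lemma elementary_step (V : normedModType R) (f : V -> R) n : elementary f ->
  elementary (fun z => step n (f z)).
Proof.
move=> ef; apply: elem_inv; last by move=> z; exact: lt_trans (step_den_gt1 _ _).
apply: elem_add; first exact: elem_cst.
apply: elem_mul; first exact: elem_cst.
have := elem_exp (elem_mul (elem_cst _ (- (n.+1%:R ^+ 2))) ef).
by congr elementary; apply/funext => z; rewrite mulNr.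
Qed.

Lemma elementary_prod (V : normedModType R) (I : Type) (r : seq I) (f : I -> V -> R) :
  (forall i, elementary (f i)) -> elementary (fun z => \prod_(i <- r) f i z).
Proof.
move=> ef; elim: r => [|i r IHr].
  by under eq_fun do rewrite big_nil; exact: elem_cst.
by under eq_fun do rewrite big_cons; exact: elem_mul.
Qed.

Lemma elementary_time : elementary (fun z : R * 'rV[R]_d => z.1).
Proof. by apply: elem_lin => // z; exact: cvg_fst. Qed.

Lemma elementary_coord i : elementary (fun z : R * 'rV[R]_d => z.2 0 i).
Proof.
apply: elem_lin => [|h v p].
  by apply: (@continuous_mx_entry R _ 1 d snd 0 i) => z; exact: cvg_snd.
by rewrite -[LHS]/((h *: v.2 + p.2) 0 i) !mxE.
Qed.

(** Corners of a quadrant range over all reals, whereas [below] requires 0 <= b <= 1; for x in ]0,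
    1[ truncating b to [0, 1] does not affect whether x < b. *)
Definition clamp (b : R) : R := Num.max 0 (Num.min 1 b).

(* For 0 <= b <= 1 this is 1-periodic in x and, on ]0, 1[, positive exactly
   when x < b. *)
Definition below (b x : R) : R := sin (pi * x) * sin (pi * (b - x)).

Lemma below_gt0 b x : 0 < x < 1 -> (0 < below (clamp b) x) = (x < b).
Proof.
move=> /andP[x0 x1]; have p0 := @pi_gt0 R.
have sx : 0 < sin (pi * x).
  by rewrite sin_gt0_pi// mulr_gt0//= -[ltRHS]mulr1 ltr_pM2l.
rewrite /below pmulr_rgt0//.
have [c0 c1] : 0 <= clamp b /\ clamp b <= 1.
  by rewrite /clamp le_max lexx ge_max ler01 ge_min lexx.
have -> : (x < b) = (x < clamp b) by rewrite /clamp lt_max lt_min x1 ltNge (ltW x0).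
set c := clamp b in c0 c1 *.
case: (ltP x c) => xc.
  rewrite sin_gt0_pi// mulr_gt0 ?subr_gt0//= -[ltRHS]mulr1 ltr_pM2l//; lra.
apply/negbTE; rewrite -leNgt -oppr_ge0 -sinN -mulrN opprB.
rewrite sin_ge0_pi// mulr_ge0 ?subr_ge0//; last exact: ltW.
rewrite /= -[leRHS]mulr1 ler_pM2l//; lra.
Qed.

(** Both sines change sign under a unit shift of x. *)
Lemma below_periodic b x : below b (x + 1) = below b x.
Proof.
have -> : below b (x + 1) = sin (pi * x + pi) * sin (pi * (b - x) - pi).
  by rewrite /below; congr (sin _ * sin _); ring.
have e : sin (pi * (b - x)) = - sin (pi * (b - x) - pi).
  by rewrite -[in LHS](subrK pi (pi * (b - x))) sinDpi.
by rewrite sinDpi /below e mulNr mulrN.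
Qed.

Definition box_bump_space (n : nat) (b : 'rV[R]_d) (x : 'rV[R]_d) : R :=
  \prod_i step n (below (clamp (b 0 i)) (x 0 i)).

Definition box_bump (n : nat) (c : R) (b : 'rV[R]_d) (z : R * 'rV[R]_d) : R :=
  step n (z.1 - c) * box_bump_space n b z.2.

(** Despite the name a quadrant: times after c, points strictly below b in every coordinate. Such
    sets are stable under intersection and generate the sigma-algebra. *)
Definition box (c : R) (b : 'rV[R]_d) : set (R * 'rV[R]_d) :=
  [set z : R * 'rV[R]_d | c < z.1 /\ forall i, z.2 0 i < b 0 i].

Lemma elementary_box_bump_space n b :
  elementary (fun z : R * 'rV[R]_d => box_bump_space n b z.2).
Proof.
apply: elementary_prod => i; apply: elementary_step; apply: elem_mul; apply: elem_sin.
  by apply: elem_mul; [exact: elem_cst|exact: elementary_coord].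
apply: elem_mul; first exact: elem_cst.
have := elem_add (elem_cst _ (clamp (b 0 i))) (elem_mul (elem_cst _ (-1)) (elementary_coord i)).
by congr elementary; apply/funext => z; rewrite mulN1r.
Qed.

Lemma elementary_box_bump n c b : elementary (box_bump n c b).
Proof.
apply: elem_mul; last exact: elementary_box_bump_space.
by apply: elementary_step; apply: elem_add; [exact: elementary_time|exact: elem_cst].
Qed.

Lemma box_bump_space_periodic n b : Zn_periodic (box_bump_space n b).
Proof.
move=> i x; apply: eq_bigr => j _; rewrite mxE /basis_vec mxE eqxx /=.
by case: eqP => _; rewrite ?addr0// below_periodic.
Qed.

Lemma box_bump_smooth n c b : smooth_periodic (box_bump n c b).
Proof.
split; first exact/elementary_smooth/elementary_box_bump.
by move=> t i x; rewrite /box_bump /= box_bump_space_periodic.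
Qed.

Lemma box_bump_space_ge0 n b x : 0 <= box_bump_space n b x.
Proof. by apply: prodr_ge0 => i _; exact: step_ge0. Qed.

Lemma box_bump_space_le1 n b x : box_bump_space n b x <= 1.
Proof.
by apply: prodr_ile1 => i _; rewrite step_ge0 step_le1.
Qed.

Lemma box_bump_norm n c b z : `|box_bump n c b z| <= 1.
Proof.
rewrite ger0_norm ?mulr_ge0 ?step_ge0 ?box_bump_space_ge0//.
by rewrite mulr_ile1 ?step_ge0 ?box_bump_space_ge0 ?step_le1 ?box_bump_space_le1.
Qed.

Lemma cvg_box_bump c b (z : R * 'rV[R]_d) : (forall i, 0 < z.2 0 i < 1) ->
  (fun n => box_bump n c b z) @ \oo --> (\1_(box c b) z : R).
Proof.
move=> hz.
have cs : (fun n => box_bump_space n b z.2) @ \oo -->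
    \prod_i (if z.2 0 i < b 0 i then 1 else 0 : R).
  rewrite /box_bump_space; elim: (index_enum _) => [|i r IHr].
    by under eq_fun do rewrite big_nil; rewrite big_nil; exact: cvg_cst.
  under eq_fun do rewrite big_cons; rewrite big_cons; apply: cvgM => //.
  by rewrite -(below_gt0 _ (hz i)); exact: cvg_step.
have ct := @cvg_step (z.1 - c); rewrite subr_gt0 in ct.
rewrite (_ : \1_(box c b) z = (if c < z.1 then 1 else 0) *
    \prod_i (if z.2 0 i < b 0 i then 1 else 0 : R)); first exact: cvgM.
rewrite indicE; case: (boolP (z \in box c b)) => [/set_mem[-> hb]|].
  by rewrite mul1r big1// => i _; rewrite hb.
rewrite notin_setE => nb; case: ifPn => [cz|_]; last by rewrite mul0r.
rewrite mul1r; have [i hi] : exists i, ~ (z.2 0 i < b 0 i).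
  by apply/existsNP => h; apply: nb.
by move/negP : hi => hi; rewrite (bigD1 i)//= (negbTE hi) mul0r.
Qed.

End smooth_functions.

Section bounded_convergence.
Context {disp} {X : measurableType disp} {R : realType}.
Variable mu : {measure set X -> \bar R}.

Lemma cvg_Rint_dominated (f : nat -> X -> R) (g h : X -> R) :
  (forall n, measurable_fun setT (f n)) -> measurable_fun setT g -> intg mu h ->
  (forall n, {ae mu, forall x, `|f n x| <= h x}) ->
  {ae mu, forall x, (fun n => f n x) @ \oo --> g x} ->
  (fun n => \int[mu]_x f n x) @ \oo --> \int[mu]_x g x.
Proof.
move=> mf mg ih fh fg.
have hE n : measurable_fun setT (EFin \o f n) by exact/measurable_EFinP.
have gE : measurable_fun setT (EFin \o g) by exact/measurable_EFinP.
have aE : {ae mu, forall x, setT x -> (fun n => (f n x)%:E) @ \oo --> (g x)%:E}.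
  apply: filterS fg => x fx _.
  by apply/fine_cvgP; split; [exact: nearW|exact: fx].
have bE : {ae mu, forall x n, setT x -> (`|(f n x)%:E| <= (h x)%:E)%E}.
  have := ae_foralln fh; apply: filterS => x fx n _.
  by rewrite lee_fin.
have [ig _ cv] := dominated_convergence measurableT hE gE aE ih bE.
have cv' : (fun n => \int[mu]_x (f n x)%:E)%E @ \oo --> (\int[mu]_x g x)%:E.
  by rewrite /Rintegral fineK; [exact: cv|exact: integrable_fin_num].
exact: fine_cvg cv'.
Qed.

Lemma intg_eq0 (f : X -> R) : intg mu f ->
  (forall A, measurable A -> (\int[mu]_(x in A) (f x)%:E = 0)%E) ->
  {ae mu, forall x, f x = 0}.
Proof.
move=> hf h; have := @integral_ae_eq _ _ _ mu setT measurableT (cst 0%E) (EFin \o f) hf.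
move=> /(_ (measurable_cst _)) H.
have {}H : ae_eq mu setT (EFin \o f) (cst 0%E).
  by apply: H => E _ mE; rewrite integral0; exact: h.
by apply: filterS H => x /(_ I) /= [].
Qed.

(** The measurable sets over which f integrates to 0 form a Dynkin system, the vanishing total
    integral giving stability under complement; f then vanishes almost everywhere. *)
Lemma Rint_eq0_induction (G : set (set X)) (f : X -> R) :
  @measurable _ X = <<s G>> -> setI_closed G -> intg mu f ->
  \int[mu]_x f x = 0 ->
  (forall A, G A -> \int[mu]_(x in A) f x = 0) ->
  {ae mu, forall x, f x = 0}.
Proof.
move=> mG GI hf f0 fG; apply: (intg_eq0 hf) => A mA.
have mf := intg_mfun hf.
have fin B : measurable B -> (\int[mu]_(x in B) (f x)%:E)%E \is a fin_num.
  by move=> mB; apply: integrable_fin_num => //; apply: integrableS hf.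
have zero B : measurable B -> \int[mu]_(x in B) f x = 0 ->
    (\int[mu]_(x in B) (f x)%:E = 0)%E.
  by move=> mB h; rewrite -(fineK (fin B mB)); congr EFin.
have GM B : G B -> measurable B by move=> GB; rewrite mG; exact: sub_sigma_algebra.
apply: (@dynkin_induction _ X G (fun B => (\int[mu]_(x in B) (f x)%:E = 0)%E) mG GI) => //.
- exact: zero.
- by move=> B GB; apply: zero; [exact: GM|exact: fG].
- move=> B mB B0.
  have := @integral_setU_EFin _ _ _ mu B (~` B) f mB (measurableC mB).
  rewrite setUCr => /(_ (measurable_funTS mf)).
  rewrite B0 add0e => <-; last by apply/disj_setPS; rewrite setICr.
  exact: zero.
- move=> F mF tF F0; rewrite integral_bigcup//.
    by rewrite eseries0.
  by apply: integrableS hf => //; exact: bigcupT_measurable.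
- by rewrite -mG.
Qed.

End bounded_convergence.

(** * Density of elementary fields in L^2 *)

Section boxes.
Variables (R : realType) (T : R) (d : nat).
Hypothesis T0 : 0 < T.
Local Notation mu := (spacetime_measure T d).
Local Notation ST := (measurableTypeR R * 'rV[R]_d)%type.

Definition boxes : set (set ST) := [set A | exists c b, A = @box R d c b].

Lemma boxI c c' (b b' : 'rV[R]_d) : box c b `&` box c' b' =
  box (Num.max c c') (\row_i Num.min (b 0 i) (b' 0 i)).
Proof.
apply/seteqP; split=> z.
  move=> [[cz bz] [cz' bz']]; split; first by rewrite gt_max cz.
  by move=> i; rewrite mxE lt_min bz bz'.
move=> [+ h]; rewrite gt_max => /andP[cz cz'].
split; split=> // i; have := h i; rewrite mxE lt_min => /andP[? ?] //.
Qed.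

Lemma boxes_setI : setI_closed boxes.
Proof.
move=> _ _ [c [b ->]] [c' [b' ->]].
by eexists; eexists; exact: boxI.
Qed.

Lemma measurable_box c b : measurable (@box R d c b : set ST).
Proof.
have -> : (box c b : set ST) = [set z : ST | c < z.1] `&`
    \bigcap_(i in [set: 'I_d]) [set z : ST | z.2 0 i < b 0 i].
  apply/seteqP; split=> z [cz hz]; split=> // i; first by move=> _; exact: hz.
  by exact: hz.
apply: measurableI.
  rewrite (_ : [set _ | _] = fst @^-1` `]c, +oo[%classic).
    by rewrite -[X in measurable X]setTI; exact: measurable_fst.
  by apply/seteqP; split=> z; rewrite /= in_itv/= andbT.
apply: fin_bigcap_measurable => // i _.
rewrite (_ : [set _ | _] = (fun z : ST => z.2 0 i) @^-1` `]-oo, b 0 i[%classic).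
  rewrite -[X in measurable X]setTI.
  apply: (measurableT_comp (measurable_fun_entry 0 i) measurable_snd) => //.
by apply/seteqP; split=> z; rewrite /= in_itv.
Qed.

(** Half-spaces generate the product sigma-algebra, and each is a countable union of quadrants whose
    remaining bounds go to infinity. *)
Lemma measurable_boxes : @measurable _ ST = <<s boxes >>.
Proof.
apply/seteqP; split; last first.
  apply: smallest_sub; first exact: sigma_algebra_measurable.
  by move=> _ [c [b ->]]; exact: measurable_box.
pose S := g_sigma_algebraType boxes.
have mbox c b : measurable (box c b : set S).
  by apply: sub_sigma_algebra; exists c, b.
have exn (x : R) : exists k : nat, x < k%:R.
  by exists (Num.bound `|x|); rewrite (le_lt_trans (ler_norm x))// archi_boundP.
have bnd (x : 'rV[R]_d) : exists k : nat, forall i, x 0 i < k%:R.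
  exists (\max_i Num.bound `|x 0%R i|)%N => i.
  rewrite (le_lt_trans (ler_norm _))// (lt_le_trans (archi_boundP _))//.
  by rewrite ler_nat; exact: leq_bigmax.
have m1 : measurable_fun setT (fun z : S => (z : ST).1).
  apply: (@measurability _ _ _ (measurableTypeR R) _ _ _ (RGenOInfty.measurableE R)).
  move=> _ [_ [c ->] <-]; rewrite setTI.
  rewrite (_ : _ @^-1` _ = \bigcup_k box c (\row_i (k%:R : R)))//; last first.
    apply/seteqP; split=> [z|z [k _ [cz _]]]; last by rewrite /= in_itv/= andbT.
    rewrite /= in_itv/= andbT => cz; have [k hk] := bnd (z : ST).2.
    by exists k => //; split=> // i; rewrite mxE.
  by apply: bigcup_measurable => k _; exact: mbox.
have m2 : measurable_fun setT (fun z : S => (z : ST).2).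
  apply/measurable_fun_matrixP => i j; rewrite ord1.
  apply: (@measurability _ _ _ (measurableTypeR R) _ _ _ (RGenInftyO.measurableE R)).
  move=> _ [_ [c ->] <-]; rewrite setTI.
  rewrite (_ : _ @^-1` _ = \bigcup_k box (- k%:R) (\row_l (if l == j then c else k%:R)))//; last first.
    apply/seteqP; split=> [z|z [k _ [_ hz]]]; last first.
      by rewrite /= in_itv/=; have := hz j; rewrite mxE eqxx.
    rewrite /= in_itv/= => cz; have [k hk] := bnd (z : ST).2.
    have [l hl] := exn (- (z : ST).1).
    exists (maxn k l) => //; split.
      by rewrite ltrNl (lt_le_trans hl)// ler_nat leq_maxr.
    move=> i'; rewrite mxE; case: eqP => [->//|_].
    by rewrite (lt_le_trans (hk i'))// ler_nat leq_maxl.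
  by apply: bigcup_measurable => k _; exact: mbox.
have mid : measurable_fun setT (fun z : S => (z : ST)).
  by have := measurable_fun_pair m1 m2; apply: eq_measurable_fun => -[].
by move=> A mA; have := mid measurableT A mA; rewrite setTI.
Qed.

Lemma box_bump_measurable n c b : measurable_fun setT (@box_bump R d n c b : ST -> R).
Proof.
exact: continuous_measurable_field (smooth_continuous (box_bump_smooth n c b).1).
Qed.

(** Dominated convergence carries orthogonality from the bumps to the indicators of quadrants, on
    which the Dynkin argument runs. *)
Lemma orthogonal_box_bump_eq0 (f : ST -> R) : intg mu f ->
  (forall n c b, \int[mu]_z (f z * box_bump n c b z) = 0) ->
  {ae mu, forall z, f z = 0}.
Proof.
move=> hf h; have mf := intg_mfun hf.
have hb c b : \int[mu]_z (f z * \1_(box c b) z) = 0.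
  have : (fun n => \int[mu]_z (f z * box_bump n c b z)) @ \oo -->
      \int[mu]_z (f z * \1_(box c b) z).
    apply: (cvg_Rint_dominated (h := fun z => `|f z|)).
    - by move=> n; apply: measurable_funM => //; exact: box_bump_measurable.
    - by apply: measurable_funM => //; apply: measurable_indic; exact: measurable_box.
    - exact: integrable_norm.
    - move=> n; apply: nearW => z.
      by rewrite normrM ler_piMr// box_bump_norm.
    - have im (z : ST) : (0 <= z.1 <= T /\ forall i, 0 < z.2 0 i < 1) ->
          (fun n => f z * box_bump n c b z) @ \oo --> f z * \1_(box c b) z.
        by move=> [_ hz]; apply: cvgM; [exact: cvg_cst|exact: cvg_box_bump].
      exact: (ae_imp (@spacetime_ae_interior R T d) im).
  move=> cv; rewrite -(cvg_lim _ cv)//.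
  by under eq_fun do rewrite h; exact: lim_cst.
apply: (Rint_eq0_induction measurable_boxes boxes_setI hf).
  (* This quadrant contains the whole cell, so its integral is the total integral. *)
  have := hb (-1) (const_mx 2) => <-; apply: ae_eq_Rint => //.
    by apply: measurable_funM => //; apply: measurable_indic; exact: measurable_box.
  apply: (@ae_imp _ ST R mu _ _ (@spacetime_ae_interior R T d)) => z [/andP[z1 _] z2].
  rewrite indicE mem_set ?mulr1//; split; first by rewrite (lt_le_trans _ z1).
  move=> i; rewrite mxE; have /andP[_ /lt_trans] := z2 i; apply.
  by rewrite ltr1n.
move=> _ [c [b ->]]; rewrite Rintegral_mkcond -[RHS](hb c b).
apply: eq_Rintegral => z _; rewrite patchE indicE.
by case: ifP; rewrite ?mulr1 ?mulr0.
Qed.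


Definition elementary_field m n (F : R * 'rV[R]_d -> 'M[R]_(m, n)) : Prop :=
  forall i j, elementary (fun z => F z i j) /\
    forall t, Zn_periodic (fun x => F (t, x) i j).

Lemma elementary_field_smooth m n (F : R * 'rV[R]_d -> 'M[R]_(m, n)) i j :
  elementary_field F -> smooth_periodic (fun z => F z i j).
Proof. by move=> /(_ i j)[eF pF]; split=> //; exact: elementary_smooth. Qed.

Lemma elementary_field_continuous m n (F : R * 'rV[R]_d -> 'M[R]_(m, n)) i j :
  elementary_field F -> continuous (fun z => F z i j).
Proof. by move=> /(elementary_field_smooth i j)[/smooth_continuous]. Qed.

Lemma elementary_field_L2 m n (F : R * 'rV[R]_d -> 'M[R]_(m, n)) :
  elementary_field F -> in_Lp mu 2%:E F.
Proof.
by move=> eF; apply: continuous_L2 => // i j; exact: elementary_field_continuous.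
Qed.

Lemma elementary_field_subspace m n :
  L2_subspace mu (@elementary_field m n).
Proof.
split.
- exact: elementary_field_L2.
- move=> i j; split; last by [].
  by under eq_fun do rewrite mxE; exact: elem_cst.
- move=> F G eF eG i j; have [eFij pF] := eF i j; have [eGij pG] := eG i j; split.
    by under eq_fun do rewrite mxE; exact: elem_add.
  by move=> t k x; rewrite !mxE pF pG.
- move=> a F eF i j; have [eFij pF] := eF i j; split.
    by under eq_fun do rewrite mxE; apply: elem_mul => //; exact: elem_cst.
  by move=> t k x; rewrite !mxE pF.
Qed.

(** By [L2_dense] it is enough that a field orthogonal to the class vanishes almost everywhere; a
    bump times a matrix unit singles out one entry. *)
Lemma elementary_field_dense m n (F : R * 'rV[R]_d -> 'M[R]_(m, n)) :
  in_Lp mu 2%:E F -> exists s : nat -> R * 'rV[R]_d -> 'M[R]_(m, n),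
    (forall k, elementary_field (s k)) /\
    (fun k => ip mu (fun z => s k z - F z) (fun z => s k z - F z)) @ \oo --> 0.
Proof.
apply: (L2_dense (spacetime_fin d T0) (@elementary_field_subspace m n)) => {}F LF orth.
have z0 i j : {ae mu, forall z, F z i j = 0}.
  have [mF iF] := proj1 (in_L2_entry _ _) LF i j.
  apply: orthogonal_box_bump_eq0.
    apply: (le_intg mF (intgD iF (intg_cst (spacetime_fin d T0) 1))) => z.
    rewrite [leRHS]ger0_norm ?addr_ge0 ?sqr_ge0//.
    have := sqr_ge0 (`|F z i j| - 1); rewrite sqrrB real_normK ?num_real//.
    have := sqr_ge0 (F z i j); rewrite mulr1 expr1n mulr2n.
    by have := normr_ge0 (F z i j); lra.
  move=> k c b; pose G z : 'M[R]_(m, n) := box_bump k c b z *: delta_mx i j.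
  have eG : elementary_field G.
    move=> i' j'; split.
      under eq_fun do rewrite !mxE; apply: elem_mul; last exact: elem_cst.
      exact: elementary_box_bump.
    by move=> t l x; rewrite !mxE (box_bump_smooth k c b).2.
  rewrite -[RHS](orth _ eG); apply: eq_Rintegral => z _.
  rewrite frob_dotZr mulrC; congr (_ * _).
  rewrite /frob_dot (bigD1 i)//= (bigD1 j)//= !mxE !eqxx mulr1.
  rewrite !big1 ?addr0// => [i' i'i|j' j'j].
    by rewrite big1// => j' _; rewrite mxE (negbTE i'i) mulr0.
  by rewrite mxE (negbTE j'j) andbF mulr0.
have [mF iF] := proj1 (in_L2P _ _) LF.
transitivity (\int[mu]_z (0 : R)); last by rewrite Rintegral_cst// mul0r.
apply: ae_eq_Rint => //; first exact: intg_mfun iF.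
have z0' : {ae mu, forall z, forall i j, F z i j = 0}.
  by apply: ae_forall_count => i; apply: ae_forall_count => j; exact: z0.
apply: ae_imp z0' _ => z hz.
by apply: big1 => i _; apply: big1 => j _; rewrite hz mulr0.
Qed.

End boxes.

(** * The constraint *)

Section weak_formulation.
Variables (R : realType) (T : R) (d : nat).
Hypothesis T0 : 0 < T.
Local Notation mu := (spacetime_measure T d).
Local Notation L2 := (in_Lp mu 2%:E).
Implicit Types (psi chi : R * 'rV[R]_d -> 'M[R]_d) (q : R * 'rV[R]_d -> R).

Definition dt_field psi (z : R * 'rV[R]_d) : 'M[R]_d :=
  \matrix_(i, j) dt (fun y => psi y i j) z.
Definition div_field psi (z : R * 'rV[R]_d) : 'rV[R]_d :=
  \row_i \sum_j dx j (fun y => psi y i j) z.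
Definition grad_field q (z : R * 'rV[R]_d) : 'rV[R]_d := \row_l dx l q z.
Definition hess_field q (z : R * 'rV[R]_d) : 'M[R]_d :=
  \matrix_(l, k) dx l (dx k q) z.
Definition grad_div_field psi (z : R * 'rV[R]_d) : 'M[R]_d :=
  \matrix_(l, i) \sum_j dx l (dx j (fun y => psi y i j)) z.
Definition div2 psi (z : R * 'rV[R]_d) : R :=
  \sum_i \sum_j dx i (dx j (fun y => psi y i j)) z.

Lemma smooth_periodic_continuous (f : R * 'rV[R]_d -> R) :
  smooth_periodic f -> continuous f.
Proof. by move=> [/smooth_continuous]. Qed.

Lemma smooth_periodic_dx i (f : R * 'rV[R]_d -> R) :
  smooth_periodic f -> smooth_periodic (dx i f).
Proof. exact: smooth_periodic_derive. Qed.

Lemma smooth_periodic_dt (f : R * 'rV[R]_d -> R) :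
  smooth_periodic f -> smooth_periodic (dt f).
Proof. exact: smooth_periodic_derive. Qed.

Lemma dt_field_L2 psi : is_test_field psi -> L2 (dt_field psi).
Proof.
move=> [sp _ _]; apply: continuous_L2 => // i j; under eq_fun do rewrite mxE.
exact/smooth_periodic_continuous/smooth_periodic_dt.
Qed.

Lemma div_field_L2 psi : is_test_field psi -> L2 (div_field psi).
Proof.
move=> [sp _ _]; apply: continuous_L2 => // i j; under eq_fun do rewrite mxE.
apply: continuous_bigsum => k.
exact/smooth_periodic_continuous/smooth_periodic_dx.
Qed.

Lemma grad_div_field_L2 psi : is_test_field psi -> L2 (grad_div_field psi).
Proof.
move=> [sp _ _]; apply: continuous_L2 => // i j; under eq_fun do rewrite mxE.
apply: continuous_bigsum => k.
exact/smooth_periodic_continuous/smooth_periodic_dx/smooth_periodic_dx.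
Qed.

Lemma grad_field_L2 q : smooth_periodic q -> L2 (grad_field q).
Proof.
move=> sq; apply: continuous_L2 => // i j; under eq_fun do rewrite mxE.
exact/smooth_periodic_continuous/smooth_periodic_dx.
Qed.

Lemma hess_field_L2 q : smooth_periodic q -> L2 (hess_field q).
Proof.
move=> sq; apply: continuous_L2 => // i j; under eq_fun do rewrite mxE.
exact/smooth_periodic_continuous/smooth_periodic_dx/smooth_periodic_dx.
Qed.

(** The constraint moved to one side and written with inner products against fixed L^2 fields, hence
    linear in the triple and stable under weak convergence. *)
Definition weak_form (nu : R) (E : R * 'rV[R]_d -> 'rV[R]_d) B chi psi q : R :=
  ip mu B (dt_field psi) - ip mu E (div_field psi) + ip mu E (grad_field q)
  + 2 * nu * (ip mu chi (hess_field q) - ip mu chi (grad_div_field psi)).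

Lemma frob_dot_rV n (A B : 'rV[R]_n) : frob_dot A B = \sum_j A 0 j * B 0 j.
Proof. by rewrite /frob_dot big_ord1. Qed.

Lemma weak_form_integral nu (E : R * 'rV[R]_d -> 'rV[R]_d) chi psi q :
  L2 E -> L2 chi -> is_test_field psi -> smooth_periodic q ->
  \int[mu]_z
    (- (\sum_i \sum_j E z 0 i * dx j (fun y => psi y i j) z)
     + (\sum_l E z 0 l * dx l q z)
     + 2 * nu * (\sum_l \sum_k chi z l k * dx l (dx k q) z)
     - 2 * nu * (\sum_i \sum_j \sum_l
         chi z l i * dx l (dx j (fun y => psi y i j)) z)) =
  - ip mu E (div_field psi) + ip mu E (grad_field q)
  + 2 * nu * (ip mu chi (hess_field q) - ip mu chi (grad_div_field psi)).
Proof.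
move=> LE Lchi tpsi sq.
have Lv := div_field_L2 tpsi; have Lg := grad_div_field_L2 tpsi.
have Lq := grad_field_L2 sq; have Lh := hess_field_L2 sq.
have i1 := L2_intg LE Lv; have i2 := L2_intg LE Lq.
have i3 := L2_intg Lchi Lh; have i4 := L2_intg Lchi Lg.
rewrite mulrBr /ip -!RintZ// -RintN// -RintD//; last exact: intgN.
rewrite -RintB; [|exact: intgZ|exact: intgZ].
rewrite -RintD; [|by apply: intgD => //; exact: intgN|by apply: intgB; exact: intgZ].
apply: eq_Rintegral => z _; rewrite addrA; congr (- _ + _ + 2 * nu * _ - 2 * nu * _).
- rewrite frob_dot_rV; apply: eq_bigr => i _; rewrite mxE mulr_sumr.
  by apply: eq_bigr => j _.
- by rewrite frob_dot_rV; apply: eq_bigr => l _; rewrite mxE.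
- by apply: eq_bigr => l _; apply: eq_bigr => k _; rewrite mxE.
- rewrite /frob_dot [RHS]exchange_big; apply: eq_bigr => i _.
  rewrite exchange_big; apply: eq_bigr => l _; rewrite mxE mulr_sumr.
  by apply: eq_bigr => j _.
Qed.

Lemma EBPsiP nu (u : dual_triple R d) : EBPsi T nu u <->
  in_L2_Loo_L2 T u /\ forall psi q, is_test_field psi ->
    is_inv_laplacian (div2 psi) q ->
    weak_form nu (dualE u) (dualB u) (dualchi u) psi q = 0.
Proof.
case: u => E B chi; rewrite /EBPsi /weak_form /=.
have eB psi : \int[mu]_z (\sum_i \sum_j B z i j * dt (fun y => psi y i j) z) =
    ip mu B (dt_field psi).
  apply: eq_Rintegral => z _; apply: eq_bigr => i _; apply: eq_bigr => j _.
  by rewrite mxE.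
split=> -[hu h]; split=> // psi q tpsi tq; have [LE _ Lchi _ _] := hu.
  have := h _ _ tpsi tq; rewrite weak_form_integral//; last by case: tq.
  by rewrite eB; move: (ip _ _ _) (ip _ _ _) (ip _ _ _) (2 * nu * _) => *; lra.
rewrite weak_form_integral//; last by case: tq.
have := h _ _ tpsi tq.
by rewrite eB; move: (ip _ _ _) (ip _ _ _) (ip _ _ _) (2 * nu * _) => *; lra.
Qed.

(* Closed form of the integral of step n (. - c) from 0 to t. *)
Definition primitive_step (n : nat) (c t : R) : R :=
  (n.+1%:R ^+ 2)^-1 * (ln (expR (n.+1%:R ^+ 2 * (t - c)) + n.+1%:R)
    - ln (expR (n.+1%:R ^+ 2 * (0 - c)) + n.+1%:R)).

Lemma elementary_primitive_step n c :
  elementary (fun z : R * 'rV[R]_d => primitive_step n c z.1).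
Proof.
apply: elem_mul; first exact: elem_cst.
apply: elem_add; last exact: elem_cst.
apply: elem_ln; last by move=> z; rewrite addr_gt0 ?expR_gt0 ?ltr0n.
apply: elem_add; last exact: elem_cst.
apply: elem_exp; apply: elem_mul; first exact: elem_cst.
by apply: elem_add; [exact: elementary_time|exact: elem_cst].
Qed.

Lemma is_derive_primitive_step n c (t : R) :
  is_derive t 1 (primitive_step n c) (step n (t - c)).
Proof.
have N0 : n.+1%:R != 0 :> R by rewrite pnatr_eq0.
set N := n.+1%:R in N0 *.
have h1 : is_derive t 1 (fun t => t - c) 1.
  by have := is_deriveB (is_derive_id t 1) (is_derive_cst c t 1); rewrite subr0.
have h2 : is_derive t 1 (fun t => N ^+ 2 * (t - c)) (N ^+ 2).
  by have := is_deriveZ (N ^+ 2) h1; rewrite /GRing.scale /= mulr1.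
have h3 := is_derive_chain (is_derive_expR _) h2.
have h4 := is_deriveD h3 (is_derive_cst N t 1).
have p0 : 0 < expR (N ^+ 2 * (t - c)) + N by rewrite addr_gt0 ?expR_gt0 ?ltr0n.
have h5 := @is_derive_chain _ R (@ln R) (fun y => expR (N ^+ 2 * (y - c)) + N) t 1
  _ _ (is_derive1_ln p0) h4.
have h6 := is_deriveB h5 (is_derive_cst (ln (expR (N ^+ 2 * (0 - c)) + N)) t 1).
have := is_deriveZ ((N ^+ 2)^-1) h6.
rewrite /primitive_step /step /GRing.scale /= -/N subr0 addr0 expRN.
congr is_derive; field.
have q0 : 0 < expR (N ^+ 2 * (t - c)) by exact: expR_gt0.
have m0 : (0 : R) < 1 + n%:R by rewrite ltr_pwDl.
by rewrite !gt_eqF// addr_gt0.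
Qed.

Lemma derive_eq_increment (V : normedModType R) (f g : V -> R) z v :
  (forall h : R, f (h *: v + z) - f z = g (h *: v + z) - g z) ->
  'D_v f z = 'D_v g z.
Proof.
move=> h; have E : (fun h : R => h^-1 *: ((f \o shift z) (h *: v) - f z)) =
    (fun h : R => h^-1 *: ((g \o shift z) (h *: v) - g z)).
  by apply/funext => s /=; rewrite h.
by rewrite /derive E.
Qed.

Lemma dt_product (g : R -> R) (h : 'rV[R]_d -> R) dg (z : R * 'rV[R]_d) :
  is_derive z.1 1 g dg -> dt (fun y => g y.1 * h y.2) z = dg * h z.2.
Proof.
case: z => t x /= hg.
suff [_ e] : is_derive ((t, x) : R * 'rV[R]_d) ((1, 0) : R * 'rV[R]_d)
    (fun y => g y.1 * h y.2) (dg * h x) by exact: e.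
apply/is_derive_line.
have -> : (fun s : R => g (s *: ((1, 0) : R * 'rV[R]_d) + (t, x)).1 *
    h (s *: ((1, 0) : R * 'rV[R]_d) + (t, x)).2) = fun s => h x * g (s *: 1 + t).
  by apply/funext => s; rewrite -time_line /= mulrC.
have := is_deriveZ (h x) (proj1 (is_derive_line g t 1 dg) hg).
by rewrite /GRing.scale /= mulrC.
Qed.

Lemma dx_cst (c : R) i (z : R * 'rV[R]_d) : dx i (fun=> c) z = 0.
Proof. exact: derive_cst. Qed.

(* Test with psi = phi Id, where d/dt phi runs through the bumps: its inverse
   Laplacian q is phi minus its spatial mean, so all terms but B : d/dt psi cancel. *)
Lemma trace_free nu (u : dual_triple R d) : EBPsi T nu u ->
  {ae mu, forall z, \tr (dualB u z) = 0}.
Proof.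
move=> /EBPsiP[[_ LooB _ _ _] hw].
have LB := Loo_L2 (spacetime_fin d T0) (spacetime_gt0 d T0) LooB.
have LI : L2 (fun=> 1%:M : 'M[R]_d).
  by apply: continuous_L2 => // i j z; exact: cvg_cst.
have trE z (a : R) : frob_dot (dualB u z) a%:M = a * \tr (dualB u z).
  by rewrite frob_dotC frob_dot_trace.
have itr : intg mu (fun z => \tr (dualB u z)).
  by have := L2_intg LB LI; congr intg; apply/funext => z; rewrite trE mul1r.
apply: (orthogonal_box_bump_eq0 itr) => n c b.
pose phi (z : R * 'rV[R]_d) := primitive_step n c z.1 * box_bump_space n b z.2.
pose m := \int[torus_measure R d]_x box_bump_space n b x.
pose q (z : R * 'rV[R]_d) := primitive_step n c z.1 * (box_bump_space n b z.2 - m).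
pose psi (z : R * 'rV[R]_d) : 'M[R]_d := (phi z)%:M.
have sphi : smooth_periodic phi.
  split; last by move=> t i x; rewrite /phi /= box_bump_space_periodic.
  apply/elementary_smooth/elem_mul; first exact: elementary_primitive_step.
  exact: elementary_box_bump_space.
have sq : smooth_periodic q.
  split; last by move=> t i x; rewrite /q /= box_bump_space_periodic.
  apply/elementary_smooth/elem_mul; first exact: elementary_primitive_step.
  by apply: elem_add; [exact: elementary_box_bump_space|exact: elem_cst].
have psiE i j : (fun z => psi z i j) = if i == j then phi else fun=> 0.
  by apply/funext => z; rewrite mxE; case: eqP; rewrite ?mulr1n ?mulr0n.
have dxq i : dx i q = dx i phi.
  apply/funext => -[t x]; apply: derive_eq_increment => h.
  by rewrite -space_line /q /phi /=; ring.
have tpsi : is_test_field psi.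
  split.
  - move=> i j; rewrite psiE; case: eqP => // _; split; last by [].
    exact/elementary_smooth/elem_cst.
  - by move=> z; rewrite tr_scalar_mx.
  - by move=> x; apply/matrixP => i j; rewrite !mxE /phi /primitive_step /= subrr !(mulr0, mul0r) mul0rn.
have divE z i : \sum_j dx j (fun y => psi y i j) z = dx i phi z.
  rewrite (bigD1 i)//= psiE eqxx big1 ?addr0// => j ji.
  by rewrite psiE eq_sym (negbTE ji) dx_cst.
have ddE z i l : \sum_j dx l (dx j (fun y => psi y i j)) z = dx l (dx i phi) z.
  rewrite (bigD1 i)//= psiE eqxx big1 ?addr0// => j ji.
  rewrite psiE eq_sym (negbTE ji) (_ : dx j _ = fun=> 0) ?dx_cst//.
  by apply/funext => y; rewrite dx_cst.
have tq : is_inv_laplacian (div2 psi) q.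
  split=> //.
  - move=> t; rewrite /q /=.
    have tf : (torus_measure R d setT < +oo)%E by have -> := torus_measureT R d; exact: ltry.
    have ih : intg (torus_measure R d) (box_bump_space n b).
      apply: (ae_le_intg (g := fun=> 1)).
      + have c1 := continuous_measurable_field (smooth_continuous (elementary_smooth (elementary_box_bump_space n b))).
        exact: (measurableT_comp c1 (pair1_measurable (0 : measurableTypeR R))).
      + by apply: intg_cst; exact: tf.
      + apply: nearW => x; rewrite ger0_norm ?box_bump_space_ge0//.
        exact: box_bump_space_le1.
    have im : intg (torus_measure R d) (fun=> m) by apply: intg_cst; exact: tf.
    rewrite RintZ; last exact: intgB.
    rewrite RintB// Rintegral_cst// -/m.
    rewrite (_ : fine _ = 1); first by rewrite mulr1 subrr mulr0.
    exact: (congr1 fine (torus_measureT R d)).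
  - by move=> z; rewrite /div2; apply: eq_bigr => i _; rewrite ddE dxq.
have := hw _ _ tpsi tq; rewrite /weak_form.
have -> : div_field psi = grad_field q.
  by apply/funext => z; apply/rowP => i; rewrite !mxE divE dxq.
have -> : grad_div_field psi = hess_field q.
  by apply/funext => z; apply/matrixP => l i; rewrite !mxE ddE dxq.
rewrite subrr mulr0 addr0 subrK => <-; apply: eq_Rintegral => z _.
have -> : dt_field psi z = (step n (z.1 - c) * box_bump_space n b z.2)%:M.
  apply/matrixP => i j; rewrite !mxE psiE; case: eqP => _; last by rewrite mulr0n; exact: derive_cst.
  by rewrite mulr1n; apply: dt_product; exact: is_derive_primitive_step.
by rewrite trE mulrC.
Qed.

End weak_formulation.

(** * Competitors for positive viscosity, and the constraint under weak limits *)

Section recovery_and_closedness.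
Variables (R : realType) (T : R) (d : nat).
Hypothesis T0 : 0 < T.
Local Notation mu := (spacetime_measure T d).
Local Notation L2 := (in_Lp mu 2%:E).
Implicit Types (psi chi : R * 'rV[R]_d -> 'M[R]_d) (q : R * 'rV[R]_d -> R).

Lemma Rint_by_parts i (f g : R * 'rV[R]_d -> R) :
  smooth_periodic f -> smooth_periodic g ->
  \int[mu]_z (dx i f z * g z + f z * dx i g z) = 0.
Proof.
move=> sf sg.
have cf := smooth_periodic_continuous sf; have cg := smooth_periodic_continuous sg.
have cdf := smooth_periodic_continuous (smooth_periodic_dx i sf).
have cdg := smooth_periodic_continuous (smooth_periodic_dx i sg).
have hd z : is_derive z (0, basis_vec R i) (fun y => f y * g y)
    (f z * dx i g z + g z * dx i f z).
  apply: is_deriveM; apply: DeriveDef => //.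
    by apply: smooth_derivable; exact: sf.1.
  by apply: smooth_derivable; exact: sg.1.
have E : dx i (fun y => f y * g y) = fun z => f z * dx i g z + g z * dx i f z.
  by apply/funext => z; case: (hd z).
rewrite -[RHS](@Rint_dx R T d i (fun y => f y * g y) T0).
- by apply: eq_Rintegral => z _; rewrite E; ring.
- by move=> z; apply: cvgM; [exact: cf|exact: cg].
- by move=> t k x; rewrite sf.2 sg.2.
- by move=> z; case: (hd z).
- rewrite E => z; apply: cvgD.
    by apply: cvgM; [exact: cf|exact: cdg].
  by apply: cvgM; [exact: cg|exact: cdf].
Qed.

Definition div_chi chi (z : R * 'rV[R]_d) : 'rV[R]_d :=
  \row_i \sum_l dx l (fun y => chi y l i) z.

Lemma div_chi_L2 chi : elementary_field chi -> L2 (div_chi chi).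
Proof.
move=> ec; apply: continuous_L2 => // i j; under eq_fun do rewrite mxE.
apply: continuous_bigsum => l.
exact/smooth_periodic_continuous/smooth_periodic_dx/elementary_field_smooth.
Qed.

Lemma intg_smoothM (f g : R * 'rV[R]_d -> R) : smooth_periodic f -> smooth_periodic g ->
  intg mu (fun z => f z * g z).
Proof.
move=> sf sg; apply: continuous_intg => // z.
by apply: cvgM; [exact: (smooth_periodic_continuous sf)|exact: (smooth_periodic_continuous sg)].
Qed.

(** Summand by summand, an integration by parts in the variable x_l that moves the derivative from
    chi to the first derivatives of psi. *)
Lemma div_chi_div chi psi : elementary_field chi -> is_test_field psi ->
  ip mu (div_chi chi) (div_field psi) + ip mu chi (grad_div_field psi) = 0.
Proof.
move=> ec tpsi; have [sp _ _] := tpsi.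
have sc l i : smooth_periodic (fun z => chi z l i) by exact: elementary_field_smooth.
rewrite /ip -RintD; last 2 first.
- exact: (L2_intg (div_chi_L2 ec) (div_field_L2 T0 tpsi)).
- exact: (L2_intg (elementary_field_L2 T0 ec) (grad_div_field_L2 T0 tpsi)).
transitivity (\int[mu]_z (\sum_i \sum_j \sum_l
    (dx l (fun y => chi y l i) z * dx j (fun y => psi y i j) z +
     chi z l i * dx l (dx j (fun y => psi y i j)) z))).
  apply: eq_Rintegral => z _; rewrite frob_dot_rV /frob_dot [X in _ + X]exchange_big.
  rewrite -big_split; apply: eq_bigr => i _; rewrite !mxE.
  have E2 : \sum_l chi z l i * grad_div_field psi z l i =
      \sum_j \sum_l chi z l i * dx l (dx j (fun y => psi y i j)) z.
    by rewrite exchange_big; apply: eq_bigr => l _; rewrite mxE mulr_sumr.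
  rewrite -[LHS]/((\sum_l dx l (fun y => chi y l i) z) * (\sum_j dx j (fun y => psi y i j) z) +
    \sum_l chi z l i * grad_div_field psi z l i) E2 mulr_sumr -big_split.
  by apply: eq_bigr => j _; rewrite /= mulr_suml -big_split.
have iall i j l : intg mu (fun z => dx l (fun y => chi y l i) z * dx j (fun y => psi y i j) z +
     chi z l i * dx l (dx j (fun y => psi y i j)) z).
  apply: intgD; apply: intg_smoothM => //; do ?apply: smooth_periodic_dx => //; exact: sp.
rewrite Rint_sum => [|i]; last by do 2 apply: intg_sum => ?.
rewrite big1// => i _; rewrite Rint_sum => [|j]; last by apply: intg_sum => ?.
rewrite big1// => j _; rewrite Rint_sum => [|//].
rewrite big1// => l _; apply: Rint_by_parts => //.
by apply: smooth_periodic_dx; exact: sp.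
Qed.

Lemma div_chi_grad chi q : elementary_field chi -> smooth_periodic q ->
  ip mu (div_chi chi) (grad_field q) + ip mu chi (hess_field q) = 0.
Proof.
move=> ec sq.
have sc l i : smooth_periodic (fun z => chi z l i) by exact: elementary_field_smooth.
rewrite /ip -RintD; last 2 first.
- exact: (L2_intg (div_chi_L2 ec) (grad_field_L2 T0 sq)).
- exact: (L2_intg (elementary_field_L2 T0 ec) (hess_field_L2 T0 sq)).
transitivity (\int[mu]_z (\sum_i \sum_l
    (dx l (fun y => chi y l i) z * dx i q z + chi z l i * dx l (dx i q) z))).
  apply: eq_Rintegral => z _; rewrite frob_dot_rV /frob_dot [X in _ + X]exchange_big.
  rewrite -big_split; apply: eq_bigr => i _; rewrite !mxE mulr_suml -big_split.
  by apply: eq_bigr => l _; rewrite mxE.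
have iall i l : intg mu (fun z => dx l (fun y => chi y l i) z * dx i q z +
     chi z l i * dx l (dx i q) z).
  by apply: intgD; apply: intg_smoothM => //; do ?apply: smooth_periodic_dx => //.
rewrite Rint_sum => [|i]; last by apply: intg_sum => ?.
rewrite big1// => i _; rewrite Rint_sum => [|//].
rewrite big1// => l _; apply: Rint_by_parts => //.
exact: smooth_periodic_dx.
Qed.

(* Adding 2 nu div chi to E cancels the terms of the constraint in nu. *)
Definition recovery (delta nu : R) (u : dual_triple R d) chi : dual_triple R d :=
  DualTriple (fun z => (1 - delta) *: dualE u z + (2 * nu) *: div_chi chi z)
    (fun z => (1 - delta) *: dualB u z) chi.

Lemma LooZ m n a (F : R * 'rV[R]_d -> 'M[R]_(m, n)) :
  in_Lp mu +oo%E F -> in_Lp mu +oo%E (fun z => a *: F z).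
Proof.
move=> LF; have mF := LF.1.
apply: (in_LyP (spacetime_gt0 d T0) (M := `|a| * Lp_norm mu +oo%E F)).
  apply/measurable_fun_matrixP => i j; under eq_fun do rewrite mxE.
  by apply: measurable_funM => //; exact: (proj1 (measurable_fun_matrixP _) mF i j).
have h := Loo_ae (spacetime_gt0 d T0) LF.
apply: (ae_imp h) => z hz.
by rewrite /frobenius frob_dotZl frob_dotZr mulrA -expr2 sqrtrM ?sqr_ge0// sqrtr_sqr ler_wpM2l.
Qed.

(** After the cancellation there remains 1 - delta times the constraint at viscosity 0, in which chi
    does not occur; this is why chi may be replaced freely. *)
Lemma recovery_EBPsi delta nu (u : dual_triple R d) chi :
  EBPsi T 0 u -> elementary_field chi -> (forall z, (chi z)^T = chi z) ->
  EBPsi T nu (recovery delta nu u chi).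
Proof.
move=> /(EBPsiP T0)[[LE LooB Lchi sB sch] hw] ec symc; apply/(EBPsiP T0); split.
  split=> /=.
  - by apply: L2D; apply: L2Z => //; exact: div_chi_L2.
  - exact: LooZ.
  - exact: elementary_field_L2.
  - by apply: (ae_imp sB) => z hz; rewrite linearZ /= hz.
  - exact/nearW.
move=> psi q tpsi tq; have sq : smooth_periodic q by case: tq.
have LB := Loo_L2 (spacetime_fin d T0) (spacetime_gt0 d T0) LooB.
have Ld := dt_field_L2 T0 tpsi; have Lv := div_field_L2 T0 tpsi.
have Lg := grad_div_field_L2 T0 tpsi; have Lq := grad_field_L2 T0 sq.
have Lh := hess_field_L2 T0 sq; have LD := div_chi_L2 ec.
have := hw _ _ tpsi tq; rewrite /weak_form /= mulr0 mul0r addr0.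
have h1 := div_chi_div ec tpsi; have h2 := div_chi_grad ec sq.
rewrite (ipZl _ LB Ld) (ipDl (L2Z _ LE) (L2Z _ LD) Lv) (ipDl (L2Z _ LE) (L2Z _ LD) Lq).
rewrite !ipZl//; move: h1 h2.
move: (ip mu _ _) (ip mu _ _) (ip mu _ _) (ip mu _ _) (ip mu _ _) (ip mu _ _) (ip mu _ _).
move=> a1 a2 a3 a4 a5 a6 a7 h1 h2 h3.
have -> : a2 = a3 + a1 by lra.
have -> : a7 = - a6 by lra.
have -> : a5 = - a4 by lra.
by ring.
Qed.

(** The terms in chi converge apart from their factor [nu k], which tends to 0; the limit therefore
    satisfies the constraint at viscosity 0. *)
Lemma weak_form_limit (nu : nat -> R) (E : nat -> R * 'rV[R]_d -> 'rV[R]_d)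
    (B chi : nat -> R * 'rV[R]_d -> 'M[R]_d) E0 B0 chi0 psi q :
  nu @ \oo --> 0 ->
  (forall F, L2 F -> (fun k => ip mu (E k) F) @ \oo --> ip mu E0 F) ->
  (forall F, L2 F -> (fun k => ip mu (B k) F) @ \oo --> ip mu B0 F) ->
  (forall F, L2 F -> (fun k => ip mu (chi k) F) @ \oo --> ip mu chi0 F) ->
  is_test_field psi -> smooth_periodic q ->
  (forall k, weak_form T (nu k) (E k) (B k) (chi k) psi q = 0) ->
  weak_form T 0 E0 B0 chi0 psi q = 0.
Proof.
move=> nu0 cE cB cchi tpsi sq h.
have : (fun k => weak_form T (nu k) (E k) (B k) (chi k) psi q) @ \oo -->
    weak_form T 0 E0 B0 chi0 psi q.
  apply: cvgD.
    apply: cvgD; last by apply: cE; exact: grad_field_L2.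
    by apply: cvgB; [apply: cB; exact: dt_field_L2|apply: cE; exact: div_field_L2].
  apply: cvgM; first by apply: cvgM => //; exact: cvg_cst.
  by apply: cvgB; apply: cchi; [exact: hess_field_L2|exact: grad_div_field_L2].
move=> cv; rewrite -(cvg_lim _ cv)//; under eq_fun do rewrite h.
exact: lim_cst.
Qed.

End recovery_and_closedness.

(** * The kinetic energy *)

Section positive_semidefinite.
Variables (R : realType) (d : nat).

(** Rational parameters suffice by continuity and density. Pointwise inequalities can thus be drawn,
    outside one null set, from countably many test vectors. *)
Lemma quadratic_discriminant (a b c : R) : 0 <= c ->
  (forall q : rat, 0 <= a + 2 * ratr q * b + ratr q ^+ 2 * c) -> b ^+ 2 <= a * c.
Proof.
move=> c0 hq; pose p (s : R) := a + 2 * s * b + s ^+ 2 * c.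
have cp : continuous p.
  move=> s; apply: cvgD; first apply: cvgD.
  - exact: cvg_cst.
  - by apply: cvgM; [apply: cvgM; [exact: cvg_cst|exact: cvg_id]|exact: cvg_cst].
  - by apply: cvgM; [apply: exprn_continuous|exact: cvg_cst].
have h s : 0 <= p s.
  rewrite leNgt; apply/negP => ps.
  have op : open (p @^-1` [set y | y < 0]).
    by apply: open_comp => [x _|]; [exact: cp|exact: open_lt].
  have [|x [px [q _ qx]]] := @dense_rat R (p @^-1` [set y | y < 0]) _ op.
    by exists s.
  by move: px; rewrite /preimage /= -qx /p ltNge hq.
exact: discriminant_le c0 h.
Qed.

Definition qform (N : 'M[R]_d) (xi : 'rV[R]_d) : R := frob_dot N (xi^T *m xi).

Lemma qformE (N : 'M[R]_d) xi : qform N xi = \sum_i \sum_j N i j * (xi 0 i * xi 0 j).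
Proof.
apply: eq_bigr => i _; apply: eq_bigr => j _; congr (_ * _).
by rewrite mxE big_ord1 mxE.
Qed.

(** A countable family of vectors that detects the sign of all 2x2 principal minors. *)
Definition probe (i j : 'I_d) (q : rat) : 'rV[R]_d :=
  basis_vec R i + ratr q *: basis_vec R j.

Lemma frob_dot_delta (N : 'M[R]_d) i j : frob_dot N (delta_mx i j) = N i j.
Proof.
rewrite /frob_dot (bigD1 i)//= (bigD1 j)//= mxE !eqxx mulr1.
rewrite !big1 ?addr0// => [i' i'i|j' j'j].
  by rewrite big1// => j' _; rewrite mxE (negbTE i'i) mulr0.
by rewrite mxE (negbTE j'j) andbF mulr0.
Qed.

Lemma qform_probe (N : 'M[R]_d) i j q : N^T = N ->
  qform N (probe i j q) = N i i + 2 * ratr q * N i j + ratr q ^+ 2 * N j j.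
Proof.
move=> sN; have sij : N j i = N i j by rewrite -[in LHS]sN mxE.
rewrite /qform.
have -> : (probe i j q)^T *m probe i j q =
    delta_mx i i + ratr q *: delta_mx i j + ratr q *: delta_mx j i +
    ratr q ^+ 2 *: delta_mx j j.
  have -> : (probe i j q)^T = delta_mx i 0 + ratr q *: delta_mx j 0.
    by apply/colP => k; rewrite !mxE eqxx !andbT.
  rewrite /probe /basis_vec mulmxDl !mulmxDr -!scalemxAl -!scalemxAr !mul_delta_mx.
  by rewrite scalerA expr2 !addrA.
rewrite !frob_dotDr !frob_dotZr !frob_dot_delta sij.
by rewrite mulr2n; ring.
Qed.

(** Non-negative 2x2 minors give N_ij^2 <= N_ii N_jj; summing over i and j produces the square of
    the trace. *)
Lemma frob_le_trace (N : 'M[R]_d) : N^T = N ->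
  (forall i j q, 0 <= qform N (probe i j q)) ->
  0 <= \tr N /\ frob_dot N N <= \tr N ^+ 2.
Proof.
move=> sN h.
have N0 i : 0 <= N i i.
  by have := h i i 0; rewrite qform_probe// rmorph0 expr0n /= !(mulr0, mul0r) !addr0.
split; first exact: sumr_ge0.
rewrite /mxtrace expr2 mulr_suml; apply: ler_sum => i _.
rewrite mulr_sumr; apply: ler_sum => j _; rewrite -expr2.
apply: quadratic_discriminant => // q.
by rewrite -qform_probe.
Qed.

Lemma frob_rank1 (xi : 'rV[R]_d) :
  frob_dot (xi^T *m xi) (xi^T *m xi) = frob_dot xi xi ^+ 2.
Proof.
rewrite -[LHS]/(qform _ xi) qformE !frob_dot_rV expr2 mulr_suml.
apply: eq_bigr => i _; rewrite mulr_sumr; apply: eq_bigr => j _.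
by rewrite mxE big_ord1 mxE; ring.
Qed.

(** Cauchy-Schwarz for the Frobenius product, xi (x) xi having Frobenius norm |xi|^2. *)
Lemma qform_le_trace (N : 'M[R]_d) xi (t : R) : 0 <= t -> frob_dot N N <= t ^+ 2 ->
  qform N xi <= t * frob_dot xi xi.
Proof.
move=> t0 Nt; have x0 := frob_dot_ge0 xi.
apply: le_trans (ler_norm _) _.
rewrite -(@ler_pXn2r _ 2)// ?nnegrE ?normr_ge0 ?mulr_ge0// real_normK ?num_real//.
apply: le_trans (frob_sqr_le _ _) _.
by rewrite frob_rank1 exprMn ler_wpM2r// sqr_ge0.
Qed.

Lemma qform_psd (A : 'M[R]_d) (xi : 'rV[R]_d) : qform A xi = (xi *m A *m xi^T) 0 0.
Proof.
rewrite qformE mxE exchange_big; apply: eq_bigr => j _ /=.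
rewrite !mxE mulr_suml; apply: eq_bigr => i _; ring.
Qed.

Lemma psd_rank1 (xi : 'rV[R]_d) (c : R) : 0 <= c -> psd (c *: (xi^T *m xi)).
Proof.
move=> c0 eta; rewrite -qform_psd /qform frob_dotZl mulr_ge0//.
rewrite -[X in 0 <= X]/(qform _ eta) qformE.
have -> : \sum_i \sum_j (xi^T *m xi) i j * (eta 0 i * eta 0 j) =
    (\sum_i xi 0 i * eta 0 i) ^+ 2.
  rewrite expr2 mulr_suml; apply: eq_bigr => i _; rewrite mulr_sumr.
  by apply: eq_bigr => j _; rewrite mxE big_ord1 mxE; ring.
exact: sqr_ge0.
Qed.

Lemma psd_trace_ge (M : 'M[R]_d) (xi : 'rV[R]_d) :
  psd (M - xi^T *m xi) -> frob_dot xi xi <= \tr M.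
Proof.
move=> h; rewrite frob_dot_rV; apply: ler_sum => i _.
have := h (basis_vec R i); rewrite -qform_psd /qform /basis_vec trmx_delta mul_delta_mx.
by rewrite frob_dot_delta !mxE big_ord1 mxE subr_ge0.
Qed.

End positive_semidefinite.

(** * Positivity of N and coercivity from a finite kinetic supremum *)

Section kinetic_energy.
Variables (R : realType) (T : R) (d : nat).
Hypothesis T0 : 0 < T.
Local Notation mu := (spacetime_measure T d).
Local Notation L2 := (in_Lp mu 2%:E).
Local Notation dst F G := (ip mu (fun z => F z - G z) (fun z => F z - G z)).
Implicit Types (E F G Z : R * 'rV[R]_d -> 'rV[R]_d) (B N M : R * 'rV[R]_d -> 'M[R]_d).

Definition idf (z : R * 'rV[R]_d) : 'M[R]_d := 1%:M.

Lemma idf_L2 : L2 idf.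
Proof. by apply: continuous_L2 => // i j z; exact: cvg_cst. Qed.

Lemma cvg_dst_lipschitz m n p q (F : nat -> R * 'rV[R]_d -> 'M[R]_(m, n))
    (G : R * 'rV[R]_d -> 'M[R]_(m, n)) (F' : nat -> R * 'rV[R]_d -> 'M[R]_(p, q))
    (G' : R * 'rV[R]_d -> 'M[R]_(p, q)) (C : R) :
  (forall k, L2 (F k)) -> L2 G -> (forall k, L2 (F' k)) -> L2 G' ->
  (forall k, {ae mu, forall z, frob_dot (F' k z - G' z) (F' k z - G' z) <=
     C * frob_dot (F k z - G z) (F k z - G z)}) ->
  (fun k => dst (F k) G) @ \oo --> 0 -> (fun k => dst (F' k) G') @ \oo --> 0.
Proof.
move=> LF LG LF' LG' h c0.
apply: (@squeeze_cvgr _ _ _ _ (fun=> 0) (fun k => C * dst (F k) G)).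
- apply: nearW => k; rewrite ip_ge0 /= /ip -RintZ; last first.
    by apply: L2_intg; apply: L2B.
  apply: ae_le_Rint => //; first by apply: L2_intg; apply: L2B.
  by apply: intgZ; apply: L2_intg; apply: L2B.
- exact: cvg_cst.
- by rewrite -(mulr0 C); apply: cvgM => //; exact: cvg_cst.
Qed.

Lemma admissible_L2 Z M : admissible T Z M -> L2 Z /\ L2 M.
Proof.
by move=> [[cZ _] [cM _] _ _]; split; apply: continuous_L2 => // i j;
  exact: continuous_mx_entry.
Qed.

Lemma admissible_le Z M : admissible T Z M -> ip mu Z Z <= ip mu idf M.
Proof.
move=> adm; have [LZ LM] := admissible_L2 adm; have [_ _ _ pM] := adm.
apply: ae_le_Rint; [exact: L2_intg|exact: (L2_intg idf_L2)|].
apply: (ae_imp (@spacetime_ae_cell R T d)) => -[t x] [tT _].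
rewrite /idf frob_dot_trace mul1r; apply: psd_trace_ge; exact: pM.
Qed.

Definition kin F N Z M : R := ip mu F Z - 2^-1 * ip mu N M.

Lemma kinE F N Z M : L2 F -> L2 N -> L2 Z -> L2 M ->
  2^-1 * \int[mu]_z (2 * frob_dot (F z) (Z z) - frob_dot (N z) (M z)) = kin F N Z M.
Proof.
move=> LF LN LZ LM; rewrite RintB; last 2 first.
- by apply: intgZ; exact: L2_intg.
- exact: L2_intg.
by rewrite RintZ ?mulrBr ?mulKf//; exact: L2_intg.
Qed.

Lemma calM_leP F N (c : R) : L2 F -> L2 N ->
  (calM T F N <= c%:E)%E <-> forall Z M, admissible T Z M -> kin F N Z M <= c.
Proof.
move=> LF LN; split=> [h Z M adm|h].
  have [LZ LM] := admissible_L2 adm; rewrite -lee_fin (le_trans _ h)//.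
  by apply: ereal_sup_ubound; exists Z, M; rewrite kinE.
apply: ge_ereal_sup => _ [Z [M [adm ->]]]; have [LZ LM] := admissible_L2 adm.
by rewrite kinE// lee_fin; exact: h.
Qed.

Lemma Nmx_L2 a B : L2 B -> L2 (Nmx a B).
Proof.
move=> LB; apply: L2D; last exact: L2Z.
by apply: continuous_L2 => // i j z; exact: cvg_cst.
Qed.

Lemma ip_Nmx a B M : L2 B -> L2 M -> ip mu (Nmx a B) M = a * ip mu idf M + 2 * ip mu B M.
Proof.
move=> LB LM; rewrite -ipZl//; last exact: idf_L2.
rewrite -(ipZl 2 LB LM) -ipDl//; [|exact/L2Z/idf_L2|exact: L2Z].
by apply: eq_Rintegral => z _; rewrite /Nmx /idf scalemx1.
Qed.

(** The case N = c Id: admissibility gives tr M >= |Z|^2, and the square of G - c Z is non-negative.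
    It evaluates the zero triple and absorbs the perturbation of E in the recovery triples. *)
Lemma kin_scalar G Z M (c : R) : 0 < c -> L2 G -> admissible T Z M ->
  ip mu G Z - c / 2 * ip mu idf M <= ip mu G G / (2 * c).
Proof.
move=> c0 LG adm; have [LZ LM] := admissible_L2 adm; have h := admissible_le adm.
have := ip_ge0 mu (fun z => G z - c *: Z z); have LcZ := L2Z c LZ.
rewrite (ipBB LG LcZ) (ipZr c LG LZ) (ipZl c LZ LcZ) (ipZr c LZ LZ) => h2.
rewrite ler_pdivlMr; last by rewrite mulr_gt0.
have h3 : c * (c * ip mu Z Z) <= c * (c * ip mu idf M) by rewrite !ler_wpM2l// ltW.
move: h2 h3; move: (ip mu _ _) (ip mu _ _) (ip mu _ _) (ip mu _ _) => a b e f.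
have -> : (e - c / 2 * a) * (2 * c) = 2 * (c * e) - c * (c * a) by field.
by lra.
Qed.

Section bounded_energy.
Variables (F : R * 'rV[R]_d -> 'rV[R]_d) (N : R * 'rV[R]_d -> 'M[R]_d) (K : R).
Hypotheses (LF : L2 F) (LN : L2 N).
Hypothesis FNK : forall Z M, admissible T Z M -> kin F N Z M <= K.

(** With Z = 0, the pairs M = l p xi (x) xi are admissible for every l >= 0, so a negative integral
    would make the kinetic part unbounded in l. *)
Lemma qform_integral_ge0 (p : R * 'rV[R]_d -> R) (xi : 'rV[R]_d) : continuous p ->
  (forall t, Zn_periodic (fun x => p (t, x))) -> (forall z, 0 <= p z) ->
  0 <= ip mu N (fun z => p z *: (xi^T *m xi)).
Proof.
move=> cp pp p0; rewrite leNgt; apply/negP => lt0.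
pose M l z : 'M[R]_d := (l * p z) *: (xi^T *m xi).
have LM : L2 (fun z => p z *: (xi^T *m xi)).
  apply: continuous_L2 => // i j z; under eq_fun do rewrite mxE.
  by apply: cvgM; [exact: cp|exact: cvg_cst].
have h l : 0 <= l -> - (l / 2) * ip mu N (fun z => p z *: (xi^T *m xi)) <= K.
  move=> l0; have adm : admissible T (fun=> 0) (M l).
    split; [split|split| |].
    - by move=> z; exact: cvg_cst.
    - by [].
    - apply: continuous_mxP => i j z; under eq_fun do rewrite mxE.
      apply: cvgM; last exact: cvg_cst.
      by apply: cvgM; [exact: cvg_cst|exact: cp].
    - by move=> t i x; rewrite /M pp.
    - by move=> t x _; rewrite /M linearZ /= trmx_mul trmxK.
    - by move=> t x _; rewrite trmx0 mul0mx subr0; apply: psd_rank1; rewrite mulr_ge0.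
  apply: le_trans (FNK adm); rewrite /kin (ipC mu F).
  have -> : ip mu (fun _ : R * 'rV[R]_d => 0) F = 0.
    by rewrite /ip; under eq_Rintegral do rewrite frob_dot0l; rewrite Rintegral_cst// mul0r.
  have -> : ip mu N (M l) = l * ip mu N (fun z => p z *: (xi^T *m xi)).
    by rewrite -ipZr//; apply: eq_Rintegral => z _; rewrite /M scalerA.
  by rewrite le_eqVlt; apply/orP; left; apply/eqP; field.
move: (ip mu _ _) lt0 h => a a0 h.
have K0 : 0 <= K by have := h 0 (lexx 0); rewrite mul0r oppr0 mul0r.
(* The value of l at which the kinetic part equals K + 1. *)
have := h ((2 * K + 2) / - a).
have -> : - ((2 * K + 2) / - a / 2) * a = K + 1 by field; rewrite lt_eqF.
have l0 : 0 <= (2 * K + 2) / - a.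
  by rewrite divr_ge0 ?oppr_ge0 ?(ltW a0)// addr_ge0// mulr_ge0.
by move=> /(_ l0); lra.
Qed.

(* p = |s k| tends in L^2 to the negative part of the quadratic form; only its
   continuity is needed for M = p xi (x) xi to be admissible. *)
Lemma qform_ae_ge0 xi : {ae mu, forall z, 0 <= qform (N z) xi}.
Proof.
pose g z := qform (N z) xi; pose h z := Num.min (g z) 0.
have mN := proj1 (proj1 (in_L2P mu N) LN).
have mg : measurable_fun setT (g : measurableTypeR R * 'rV[R]_d -> R).
  by apply: measurable_frob_dot => //; exact: measurable_cst.
have mh : measurable_fun setT (h : measurableTypeR R * 'rV[R]_d -> R).
  by apply: measurable_minr => //; exact: measurable_cst.
(* Hence testing N against |h| xi (x) xi gives minus the squared norm of h. *)
have hh z : h z ^+ 2 = - (g z * `|h z|).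
  rewrite /h; case: (lerP (g z) 0) => g0; last by rewrite normr0 expr0n mulr0 oppr0.
  by rewrite ler0_norm//; ring.
have hb z : h z ^+ 2 <= frob_dot (xi^T *m xi) (xi^T *m xi) * frob_dot (N z) (N z).
  apply: (@le_trans _ _ (g z ^+ 2)); last by rewrite mulrC; exact: frob_sqr_le.
  by rewrite /h; case: (lerP (g z) 0) => //; rewrite expr0n sqr_ge0.
have ih : intg mu (fun z => h z ^+ 2).
  apply: (le_intg (measurable_funX 2 mh)
    (intgZ (frob_dot (xi^T *m xi) (xi^T *m xi)) (L2_intg LN LN))) => z.
  rewrite ger0_norm ?sqr_ge0// (le_trans (hb z))// ler_norm//.
(* The scalar h is seen as a 1x1 field so that the density of elementary fields applies to it. *)
pose H z : 'M[R]_1 := const_mx (h z).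
have LH : L2 H.
  by apply/in_L2_entry => i j; split; under eq_fun do rewrite mxE.
have [s [es sH]] := elementary_field_dense T0 LH.
pose p k z := `|s k z 0 0|.
have Ls k : L2 (s k) by exact: elementary_field_L2.
have cp k : continuous (p k).
  have c0 : continuous (fun z => s k z 0 0) by exact: elementary_field_continuous.
  by move=> z; apply: cvg_norm; exact: c0.
have LP k : L2 (fun z => p k z *: (xi^T *m xi)).
  apply: continuous_L2 => // i j z; under eq_fun do rewrite mxE.
  by apply: cvgM; [exact: cp|exact: cvg_cst].
have LQ : L2 (fun z => `|h z| *: (xi^T *m xi)).
  apply/in_L2_entry => i j; split; under eq_fun do rewrite mxE.
    by apply: measurable_funM; [exact: measurableT_comp|exact: measurable_cst].
  under eq_fun do rewrite exprMn real_normK ?num_real// mulrC.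
  exact: intgZ.
have c1 : (fun k => ip mu N (fun z => p k z *: (xi^T *m xi))) @ \oo -->
    ip mu N (fun z => `|h z| *: (xi^T *m xi)).
  under eq_fun do rewrite ipC; rewrite ipC; apply: cvg_ip => //.
  apply: (cvg_dst_lipschitz (C := frob_dot (xi^T *m xi) (xi^T *m xi)) Ls LH LP LQ _ sH).
  move=> k; apply: nearW => z; rewrite -scalerBl frob_dotZl frob_dotZr mulrA mulrC ler_wpM2l//.
    exact: frob_dot_ge0.
  rewrite -expr2; apply: le_trans (frob_dot_entry _ 0 0).
  rewrite !mxE -[leLHS]real_normK ?num_real// -[leRHS]real_normK ?num_real//.
  by rewrite lerXn2r ?nnegrE// ler_dist_dist.
have : 0 <= ip mu N (fun z => `|h z| *: (xi^T *m xi)).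
  rewrite -(cvg_lim _ c1)//; apply: limr_ge; first by apply/cvg_ex; eexists; exact: c1.
  apply: nearW => k; apply: qform_integral_ge0 => [//||z]; last by rewrite /p.
  by move=> t i x; rewrite /p (es k 0 0).2.
have -> : ip mu N (fun z => `|h z| *: (xi^T *m xi)) = - \int[mu]_z (h z ^+ 2).
  rewrite -RintN//; apply: eq_Rintegral => z _.
  by rewrite hh opprK frob_dotZr mulrC.
rewrite oppr_ge0 => i0.
have h0 : {ae mu, forall z, h z ^+ 2 = 0}.
  by apply: ge0_Rint_eq0 => //; apply: nearW => z; exact: sqr_ge0.
apply: (ae_imp h0) => z /eqP; rewrite sqrf_eq0 => /eqP.
by rewrite /h; case: (lerP (g z) 0) => [g0 e|/ltW//]; rewrite -/(g z) e.
Qed.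

Lemma probe_ae_ge0 : {ae mu, forall z, forall i j q, 0 <= qform (N z) (probe R i j q)}.
Proof.
have h : {ae mu, forall z, forall t : 'I_d * 'I_d * rat,
    0 <= qform (N z) (probe R t.1.1 t.1.2 t.2)}.
  by apply: ae_forall_count => t; exact: qform_ae_ge0.
by apply: (ae_imp h) => z hz i j q; exact: (hz (i, j, q)).
Qed.

(** For Z continuous and M = Z (x) Z, the bound N <= t Id makes the kinetic part at least |F|^2 / (2
    t) - (t / 2) |Z - F / t|^2; then Z tends to F / t in L^2. *)
Lemma kin_coercive (t : R) : 0 < t ->
  {ae mu, forall z, forall xi, qform (N z) xi <= t * frob_dot xi xi} ->
  ip mu F F / (2 * t) <= K.
Proof.
move=> t0 hN; have LtF := L2Z t^-1 LF.
have [s [es sF]] := elementary_field_dense T0 LtF.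
have Ls k : L2 (s k) by exact: elementary_field_L2.
have h k : ip mu F F / (2 * t) <= K + t / 2 * dst (s k) (fun z => t^-1 *: F z).
  pose M z : 'M[R]_d := (s k z)^T *m s k z.
  have adm : admissible T (s k) M.
    have cs i j : continuous (fun z => s k z i j) by exact: elementary_field_continuous.
    have ps u : Zn_periodic (fun x => s k (u, x)).
      by move=> l x; apply/matrixP => i j; rewrite (es k i j).2.
    split; [split|split| |] => //.
    - exact: continuous_mxP.
    - apply: continuous_mxP => i j; under eq_fun do rewrite mxE.
      apply: continuous_bigsum => l z; apply: cvgM; last exact: cs.
      by under eq_fun do rewrite mxE; rewrite mxE; exact: cs.
    - by move=> u l x; rewrite /M ps.
    - by move=> u x _; rewrite /M trmx_mul trmxK.
    - by move=> u x _ xi; rewrite /M subrr mulmx0 mul0mx mxE.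
  have [_ LM] := admissible_L2 adm.
  have h1 : ip mu N M <= t * ip mu (s k) (s k).
    rewrite /ip -RintZ; last exact: L2_intg.
    apply: ae_le_Rint; [exact: L2_intg|by apply: intgZ; exact: L2_intg|].
    by apply: (ae_imp hN) => z hz; exact: hz.
  have := FNK adm; rewrite /kin => h2.
  rewrite (ipBB (Ls k) LtF) (ipZr _ (Ls k) LF) (ipZl _ LF LtF) (ipZr _ LF LF) (ipC mu (s k) F).
  move: h1 h2; move: (ip mu _ _) (ip mu _ _) (ip mu _ _) (ip mu _ _) => a b c e h1 h2.
  have -> : K + t / 2 * (c - 2 * (t^-1 * b) + t^-1 * (t^-1 * a)) =
    K + (t * c) / 2 - b + a / (2 * t) by field; rewrite gt_eqF.
  by rewrite lerDr; lra.
have c1 : (fun k => K + t / 2 * dst (s k) (fun z => t^-1 *: F z)) @ \oo --> K.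
  rewrite -[X in _ --> X]addr0 -[X in _ + X](mulr0 (t / 2)).
  by apply: cvgD; [exact: cvg_cst|apply: cvgM => //; exact: cvg_cst].
rewrite -(cvg_lim _ c1)//; apply: limr_ge; first by apply/cvg_ex; eexists; exact: c1.
exact: nearW.
Qed.

End bounded_energy.

End kinetic_energy.

(** * Weak limits *)

Lemma increasing_comp (s t : nat -> nat) : (forall k, (s k < s k.+1)%N) ->
  (forall k, (t k < t k.+1)%N) -> forall k, (s (t k) < s (t k.+1))%N.
Proof.
move=> hs ht k; apply: (@leq_trans (s (t k).+1)); first exact: hs.
exact: increasing_seq_leq (ht k).
Qed.

Section weak_limits.
Variables (R : realType) (T : R) (d : nat).
Hypothesis T0 : 0 < T.
Local Notation mu := (spacetime_measure T d).
Local Notation L2 := (in_Lp mu 2%:E).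
Local Notation dst F G := (ip mu (fun z => F z - G z) (fun z => F z - G z)).

Definition cvg_weakly m n (F : nat -> R * 'rV[R]_d -> 'M[R]_(m, n))
    (G : R * 'rV[R]_d -> 'M[R]_(m, n)) : Prop :=
  forall H, L2 H -> (fun k => ip mu (F k) H) @ \oo --> ip mu G H.

Lemma cvg_weakly_subsequence m n F (G : R * 'rV[R]_d -> 'M[R]_(m, n)) (s : nat -> nat) :
  (forall k, (s k < s k.+1)%N) -> cvg_weakly F G -> cvg_weakly (fun k => F (s k)) G.
Proof. by move=> hs FG H LH; have := cvg_subsequence hs (FG H LH). Qed.

Lemma frob_dot_tr m n (A B : 'M[R]_(m, n)) : frob_dot A^T B^T = frob_dot A B.
Proof.
rewrite /frob_dot exchange_big; apply: eq_bigr => i _; apply: eq_bigr => j _.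
by rewrite !mxE.
Qed.

Lemma L2_tr m n (F : R * 'rV[R]_d -> 'M[R]_(m, n)) : L2 F -> L2 (fun z => (F z)^T).
Proof.
move=> /in_L2_entry h; apply/in_L2_entry => i j; have [h1 h2] := h j i.
by split; under eq_fun do rewrite mxE.
Qed.

Lemma cvg_ip_self m n (F : nat -> R * 'rV[R]_d -> 'M[R]_(m, n)) G :
  (forall k, L2 (F k)) -> L2 G -> (fun k => dst (F k) G) @ \oo --> 0 ->
  (fun k => ip mu (F k) (F k)) @ \oo --> ip mu G G.
Proof.
move=> LF LG c0; have c1 := cvg_ip LF LG LG c0.
have -> : (fun k => ip mu (F k) (F k)) =
    (fun k => dst (F k) G + 2 * ip mu (F k) G - ip mu G G).
  by apply/funext => k; rewrite ipBB//; ring.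
rewrite [X in _ --> X](_ : _ = 0 + 2 * ip mu G G - ip mu G G); last by ring.
by apply: cvgB; [apply: cvgD => //; apply: cvgM => //|]; exact: cvg_cst.
Qed.

Lemma ae_eq0_of_ip m n (F : R * 'rV[R]_d -> 'M[R]_(m, n)) : L2 F -> ip mu F F <= 0 ->
  {ae mu, forall z, F z = 0}.
Proof.
move=> LF F0.
have h : {ae mu, forall z, frob_dot (F z) (F z) = 0}.
  by apply: ge0_Rint_eq0 => //; [exact: L2_intg|apply: nearW => z; exact: frob_dot_ge0].
apply: (ae_imp h) => z hz; apply/matrixP => i j; rewrite mxE.
apply/eqP; rewrite -sqrf_eq0 eq_le sqr_ge0 andbT -hz.
exact: frob_dot_entry.
Qed.

(** The test field H = G - G^T is antisymmetric, hence orthogonal to every [F k] and, in the limit,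
    to G; but |H|^2 = 2 <G, H>. *)
Lemma weak_limit_sym (F : nat -> R * 'rV[R]_d -> 'M[R]_d) G :
  (forall k, L2 (F k)) -> L2 G -> cvg_weakly F G ->
  (forall k, {ae mu, forall z, (F k z)^T = F k z}) -> {ae mu, forall z, (G z)^T = G z}.
Proof.
move=> LF LG FG sF; pose H z := G z - (G z)^T.
have LGt := L2_tr LG; have LH : L2 H by exact: L2B.
have F0 k : ip mu (F k) H = 0.
  have -> : ip mu (F k) H = \int[mu]_z 0.
    apply: ae_eq_Rint => //.
      by apply: measurable_frob_dot; [exact: (LF k).1|exact: LH.1].
    apply: (ae_imp (sF k)) => z hz; rewrite /H frob_dotBr -{2}hz frob_dot_tr.
    by rewrite subrr.
  by rewrite Rintegral_cst// mul0r.
have G0 : ip mu G H = 0.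
  rewrite -(cvg_lim _ (FG H LH))//; under eq_fun do rewrite F0.
  exact: lim_cst.
have : {ae mu, forall z, H z = 0}.
  apply: ae_eq0_of_ip => //.
  have -> : ip mu H H = 2 * ip mu G H.
    rewrite /ip -RintZ; last exact: L2_intg.
    apply: eq_Rintegral => z _; rewrite {1}/H frob_dotBl.
    have -> : frob_dot (G z)^T (H z) = - frob_dot (G z) (H z).
      by rewrite -frob_dot_tr trmxK /H linearB /= trmxK -opprB frob_dotNr.
    by rewrite opprK mulr2n mulrDl mul1r.
  by rewrite G0 mulr0.
by move=> h; apply: (ae_imp h) => z; rewrite /H => /eqP; rewrite subr_eq0 => /eqP <-.
Qed.

(** Test with G restricted to the set A where |G| > b. In the limit the integral of |G|^2 over A is
    at most that of (b^2 + |G|^2) / 2, which is pointwise smaller on A, so A is null. *)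
Lemma weak_limit_bounded m n (F : nat -> R * 'rV[R]_d -> 'M[R]_(m, n)) G (b : R) :
  0 <= b -> (forall k, L2 (F k)) -> L2 G -> cvg_weakly F G ->
  (forall k, {ae mu, forall z, frobenius (F k z) <= b}) ->
  {ae mu, forall z, frobenius (G z) <= b}.
Proof.
move=> b0 LF LG FG hF.
have mG := measurable_frob_dot LG.1 LG.1.
pose A := [set z : measurableTypeR R * 'rV[R]_d | b ^+ 2 < frob_dot (G z) (G z)].
have mA : measurable A.
  have -> : A = [set: measurableTypeR R * 'rV[R]_d] `&`
      (fun z => frob_dot (G z) (G z)) @^-1` `]b ^+ 2, +oo[.
    by rewrite setTI; apply/seteqP; split=> z; rewrite /A /= in_itv /= andbT.
  exact: mG.
pose ind z : R := \1_A z.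
have ind01 z : 0 <= ind z <= 1 by rewrite /ind indicE; case: (z \in A); rewrite /= ?lexx ?ler01.
have mind : measurable_fun setT (ind : measurableTypeR R * 'rV[R]_d -> R).
  exact: measurable_indic.
have indM (f : measurableTypeR R * 'rV[R]_d -> R) : intg mu f -> intg mu (fun z => ind z * f z).
  move=> hf; apply: (le_intg _ hf); first by apply: measurable_funM => //; exact: intg_mfun hf.
  move=> z; have /andP[i0 i1] := ind01 z.
  by rewrite normrM (ger0_norm i0) ler_piMl.
pose H z := ind z *: G z.
have LH : L2 H.
  apply/in_L2_entry => i j; have [h1 h2] := proj1 (in_L2_entry mu G) LG i j.
  split; under eq_fun do rewrite mxE; first exact: measurable_funM.
  have -> : (fun z => (ind z * G z i j) ^+ 2) = fun z => ind z * (G z i j) ^+ 2.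
    apply/funext => z; rewrite exprMn /ind indicE.
    by case: (z \in A); rewrite ?expr1n// expr0n /= !mul0r.
  exact: indM.
have iJ : intg mu (fun z => ind z * ((b ^+ 2 + frob_dot (G z) (G z)) / 2)).
  apply: indM; under eq_fun do rewrite mulrC; apply/intgZ/intgD; last exact: L2_intg.
  exact: intg_cst (spacetime_fin d T0) _.
have iG : intg mu (fun z => ind z * frob_dot (G z) (G z)) by apply: indM; exact: L2_intg.
have le k : ip mu (F k) H <= \int[mu]_z (ind z * ((b ^+ 2 + frob_dot (G z) (G z)) / 2)).
  apply: ae_le_Rint => //; first exact: L2_intg.
  apply: (ae_imp (hF k)) => z hz; rewrite /H frob_dotZr ler_wpM2l ?(andP (ind01 z)).1//.
  have h1 : frob_dot (F k z) (F k z) <= b ^+ 2.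
    by rewrite -sqr_frobenius lerXn2r ?nnegrE ?frobenius_ge0.
  have := frob_dot_ge0 (F k z - G z); rewrite frob_dotBl !frob_dotBr (frob_dotC (G z)).
  by lra.
have : ip mu G H <= \int[mu]_z (ind z * ((b ^+ 2 + frob_dot (G z) (G z)) / 2)).
  by apply: (ler_cvg_to (FG H LH) (cvg_cst _)); exact: nearW.
have -> : ip mu G H = \int[mu]_z (ind z * frob_dot (G z) (G z)).
  by apply: eq_Rintegral => z _; rewrite frob_dotZr.
rewrite -subr_le0 -RintB// => i0.
have hz : {ae mu, forall z, ind z * frob_dot (G z) (G z) -
    ind z * ((b ^+ 2 + frob_dot (G z) (G z)) / 2) = 0}.
  apply: ge0_Rint_eq0 => //; first exact: intgB.
  apply: nearW => z; rewrite -mulrBr /ind indicE; case: (boolP (z \in A)); rewrite ?mul0r//.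
  by rewrite inE /A /= => hA; rewrite mul1r; lra.
apply: (ae_imp hz) => z; rewrite /ind indicE; case: (boolP (z \in A)) => zA.
  by move: zA; rewrite inE /A /= !mul1r => hA h; exfalso; lra.
move: zA; rewrite notin_setE /A /= => /negP; rewrite -leNgt => hA _.
by rewrite /frobenius -(ger0_norm b0) -sqrtr_sqr ler_wsqrtr.
Qed.

Lemma normr_frob_dot_le m n (A B : 'M[R]_(m, n)) :
  `|frob_dot A B| <= frobenius A * frobenius B.
Proof.
rewrite -(@ler_pXn2r _ 2)// ?nnegrE ?mulr_ge0 ?frobenius_ge0//.
by rewrite real_normK ?num_real// exprMn !sqr_frobenius frob_sqr_le.
Qed.

Lemma in_L1_intg m n (phi : R * 'rV[R]_d -> 'M[R]_(m, n)) : in_Lp mu 1%:E phi ->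
  measurable_fun setT (phi : measurableTypeR R * 'rV[R]_d -> _) /\
  intg mu (fun z => frobenius (phi z)).
Proof.
move=> [mphi fphi]; split=> //; apply/Lfun1_integrable.
by apply/andP; split; rewrite inE //; exact: measurable_frobenius.
Qed.

(* Truncation: phi 1_{|phi| <= N} lies in L^2 and tends to phi in L^1. *)
Lemma weak_star m n (F : nat -> R * 'rV[R]_d -> 'M[R]_(m, n)) G (b : R) :
  0 <= b -> (forall k, L2 (F k)) -> L2 G -> cvg_weakly F G ->
  (forall k, {ae mu, forall z, frobenius (F k z) <= b}) ->
  {ae mu, forall z, frobenius (G z) <= b} -> cvg_against mu 1%:E F G.
Proof.
move=> b0 LF LG FG hF hG phi /in_L1_intg[mphi iphi].
have mfphi := intg_mfun iphi.
pose ind N z : R := \1_[set z : measurableTypeR R * 'rV[R]_d | frobenius (phi z) <= N%:R] z.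
have mind N : measurable_fun setT (ind N : measurableTypeR R * 'rV[R]_d -> R).
  apply: measurable_indic.
  have -> : [set z : measurableTypeR R * 'rV[R]_d | frobenius (phi z) <= N%:R] =
      [set: measurableTypeR R * 'rV[R]_d] `&`
      (fun z => frobenius (phi z)) @^-1` `]-oo, N%:R].
    by rewrite setTI; apply/seteqP; split=> z; rewrite /= in_itv.
  exact: mfphi.
pose psi N z := ind N z *: phi z.
have Lpsi N : L2 (psi N).
  apply: (L2_bounded (spacetime_fin d T0) (M := N%:R)).
    apply/measurable_fun_matrixP => i j; under eq_fun do rewrite mxE.
    by apply: measurable_funM => //; exact: (proj1 (measurable_fun_matrixP _) mphi i j).
  move=> z; rewrite /psi /ind indicE; case: (boolP (z \in _)) => [|_]; last first.
    by rewrite scale0r /frobenius frob_dot0l sqrtr0.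
  by rewrite inE /= scale1r.
pose r N := \int[mu]_z ((1 - ind N z) * frobenius (phi z)).
have ind01 N z : 0 <= 1 - ind N z <= 1.
  by rewrite /ind indicE; case: (z \in _); rewrite /= ?subrr ?subr0 ?lexx ?ler01.
have rb N z : `|(1 - ind N z) * frobenius (phi z)| <= frobenius (phi z).
  have /andP[h1 h2] := ind01 N z.
  by rewrite normrM (ger0_norm h1) ger0_norm ?frobenius_ge0// ler_piMl ?frobenius_ge0.
have mr N : measurable_fun setT
    ((fun z => (1 - ind N z) * frobenius (phi z)) : measurableTypeR R * 'rV[R]_d -> R).
  by apply: measurable_funM => //; apply: measurable_funB.
have ir N : intg mu (fun z => (1 - ind N z) * frobenius (phi z)).
  apply: (le_intg (mr N) iphi) => z; rewrite (le_trans (rb N z))// ler_norm//.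
have r0 : r @ \oo --> 0.
  have -> : 0 = \int[mu]_z 0 :> R by rewrite Rintegral_cst// mul0r.
  apply: (cvg_Rint_dominated (h := fun z => frobenius (phi z))) => //.
    by move=> N; apply: nearW; exact: rb.
  apply: nearW => z; apply/cvg_seqP => e e0.
  exists (Num.truncn (frobenius (phi z))).+1 => N hN.
  have zN : frobenius (phi z) <= N%:R.
    by apply: ltW; apply: (lt_le_trans (truncnS_gt _)); rewrite ler_nat.
  by rewrite subr0 /ind indicE mem_set ?subrr ?mul0r ?normr0.
have mdot (K : R * 'rV[R]_d -> 'M[R]_(m, n)) : L2 K ->
    {ae mu, forall z, frobenius (K z) <= b} ->
    intg mu (fun z => frob_dot (K z) (phi z)) /\
    forall N, `|\int[mu]_z frob_dot (K z) (phi z) - ip mu K (psi N)| <= b * r N.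
  move=> LK hK.
  have iK : intg mu (fun z => frob_dot (K z) (phi z)).
    apply: (ae_le_intg _ (intgZ b iphi)); first exact: measurable_frob_dot LK.1 mphi.
    apply: (ae_imp hK) => z hz; apply: le_trans (normr_frob_dot_le _ _) _.
    by rewrite ler_wpM2r ?frobenius_ge0.
  split=> // N; have iN := L2_intg LK (Lpsi N).
  rewrite /ip -RintB// /r -RintZ//.
  have bnd : {ae mu, forall z, `|frob_dot (K z) (phi z) - frob_dot (K z) (psi N z)| <=
      b * ((1 - ind N z) * frobenius (phi z))}.
    apply: (ae_imp hK) => z hz; have /andP[h1 h2] := ind01 N z.
    rewrite /psi frob_dotZr -{1}[frob_dot _ _]mul1r -mulrBl normrM (ger0_norm h1).
    rewrite mulrCA ler_wpM2l//; apply: le_trans (normr_frob_dot_le _ _) _.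
    by rewrite ler_wpM2r ?frobenius_ge0.
  rewrite ler_norml; apply/andP; split.
    rewrite -RintN; last exact: intgZ.
    apply: ae_le_Rint; [exact/intgN/intgZ|exact: intgB|].
    by apply: (ae_imp bnd) => z; rewrite ler_norml => /andP[].
  apply: ae_le_Rint; [exact: intgB|exact: intgZ|].
  by apply: (ae_imp bnd) => z; rewrite ler_norml => /andP[].
apply/cvg_seqP => e e0.
have [|N hN] := proj1 (cvg_seqP r 0) r0 (e / (3 * (b + 1))).
  by rewrite divr_gt0// mulr_gt0// ltr_wpDl.
have hrN : b * r N <= e / 3.
  have := ltW (hN N (leqnn N)); rewrite subr0 => /(le_trans (ler_norm _)) h.
  apply: le_trans (ler_wpM2l b0 h) _.
  have -> : b * (e / (3 * (b + 1))) = e / 3 * (b / (b + 1)).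
    by field; rewrite gt_eqF// ltr_wpDl.
  by rewrite ler_piMr ?divr_ge0 ?(ltW e0)// ler_pdivrMr ?ltr_wpDl// mul1r lerDl.
have [|K hK] := proj1 (cvg_seqP _ _) (FG _ (Lpsi N)) (e / 3).
  by rewrite divr_gt0.
exists K => k /hK h1.
have [_ /(_ N) h2] := mdot _ (LF k) (hF k); have [_ /(_ N) h3] := mdot _ LG hG.
move: h1 h2 h3; rewrite !(ler_norml, ltr_norml).
move: (ip mu (F k) (psi N)) (ip mu G (psi N)) (\int[mu]_z _) (\int[mu]_z _) => p q i j.
move=> /andP[h1 h1'] /andP[h2 h2'] /andP[h3 h3']; apply/andP; split; lra.
Qed.

(** Three successive extractions. B is treated in L^2, which contains L^oo for a finite measure; its
    pointwise bound and the symmetries are then recovered on the limit. *)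
Lemma triple_weak_compact (w : nat -> dual_triple R d) (C b : R) : 0 <= b ->
  (forall k, in_L2_Loo_L2 T (w k)) ->
  (forall k, ip mu (dualE (w k)) (dualE (w k)) <= C) ->
  (forall k, ip mu (dualchi (w k)) (dualchi (w k)) <= C) ->
  (forall k, Lp_norm mu +oo%E (dualB (w k)) <= b) ->
  exists (s : nat -> nat) (l : dual_triple R d),
    [/\ forall k, (s k < s k.+1)%N, in_L2_Loo_L2 T l,
      cvg_weakly (fun k => dualE (w (s k))) (dualE l),
      cvg_weakly (fun k => dualB (w (s k))) (dualB l) &
      cvg_weakly (fun k => dualchi (w (s k))) (dualchi l)] /\
    {ae mu, forall z, frobenius (dualB l z) <= b}.
Proof.
move=> b0 hw hE hchi hB.
have LE k : L2 (dualE (w k)) by case: (hw k).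
have LB k : L2 (dualB (w k)).
  by apply: (Loo_L2 (spacetime_fin d T0) (spacetime_gt0 d T0)); case: (hw k).
have Lc k : L2 (dualchi (w k)) by case: (hw k).
have aB k : {ae mu, forall z, frobenius (dualB (w k) z) <= b}.
  have [_ LooB _ _ _] := hw k.
  by apply: (ae_imp (Loo_ae (spacetime_gt0 d T0) LooB)) => z /le_trans; exact.
have bB k : ip mu (dualB (w k)) (dualB (w k)) <= b ^+ 2 * T.
  have -> : b ^+ 2 * T = \int[mu]_z (b ^+ 2).
    by rewrite Rintegral_cst//= (spacetime_measureT d T0).
  apply: ae_le_Rint; [exact: L2_intg|exact: intg_cst (spacetime_fin d T0) _|].
  apply: (ae_imp (aB k)) => z hz.
  by rewrite -sqr_frobenius lerXn2r ?nnegrE ?frobenius_ge0.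
have [s1 [E [i1 LE0 cE]]] := L2_weak_compact (spacetime_fin d T0) LE hE.
have [s2 [B [i2 LB0 cB]]] := L2_weak_compact (spacetime_fin d T0)
  (fun k => LB (s1 k)) (fun k => bB (s1 k)).
have [s3 [chi [i3 Lc0 cc]]] := L2_weak_compact (spacetime_fin d T0)
  (fun k => Lc (s1 (s2 k))) (fun k => hchi (s1 (s2 k))).
pose s k := s1 (s2 (s3 k)).
have i23 := increasing_comp i2 i3.
have is_ := increasing_comp i1 i23.
have wE : cvg_weakly (fun k => dualE (w (s k))) E.
  exact: (cvg_weakly_subsequence (F := fun k => dualE (w (s1 k))) i23).
have wB : cvg_weakly (fun k => dualB (w (s k))) B.
  exact: (cvg_weakly_subsequence (F := fun k => dualB (w (s1 (s2 k)))) i3).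
have aB0 := weak_limit_bounded b0 (fun k => LB (s k)) LB0 wB (fun k => aB (s k)).
exists s, (DualTriple E B chi); split=> //; split=> //.
split=> //=.
- exact: (in_LyP (spacetime_gt0 d T0) LB0.1 aB0).
- by apply: (weak_limit_sym (fun k => LB (s k)) LB0 wB) => k; case: (hw (s k)).
- by apply: (weak_limit_sym (fun k => Lc (s k)) Lc0 cc) => k; case: (hw (s k)).
Qed.

(** Symmetrisation stays within elementary fields, fixes F and does not increase the Frobenius
    distance. *)
Lemma sym_elementary_dense (F : R * 'rV[R]_d -> 'M[R]_d) : L2 F ->
  {ae mu, forall z, (F z)^T = F z} ->
  exists s : nat -> R * 'rV[R]_d -> 'M[R]_d,
    [/\ forall k, elementary_field (s k), forall k z, (s k z)^T = s k z &
      (fun k => dst (s k) F) @ \oo --> 0].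
Proof.
move=> LF sF; have [s [es sF0]] := elementary_field_dense T0 LF.
have est k : elementary_field (fun z => 2^-1 *: (s k z + (s k z)^T)).
  have [_ _ hD hZ] := @elementary_field_subspace R T d T0 d d.
  by apply: hZ; apply: hD => // i j; have [h1 h2] := es k j i; split;
    [under eq_fun do rewrite mxE|move=> t l x; rewrite !mxE h2].
exists (fun k z => 2^-1 *: (s k z + (s k z)^T)); split=> //.
  by move=> k z; rewrite linearZ /= linearD /= trmxK addrC.
have Ls k := elementary_field_L2 T0 (es k); have Lt k := elementary_field_L2 T0 (est k).
apply: (cvg_dst_lipschitz (C := 1) Ls LF Lt LF _ sF0) => k.
apply: (ae_imp sF) => z hz; rewrite mul1r.
have -> : 2^-1 *: (s k z + (s k z)^T) - F z =
    2^-1 *: ((s k z - F z) + (s k z - F z)^T).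
  rewrite linearB /= hz; apply/matrixP => i j; rewrite !mxE.
  by field.
move: (s k z - F z) => A; have := frob_dot_ge0 (A - A^T).
rewrite frob_dotZl frob_dotZr !(frob_dotDl, frob_dotDr, frob_dotNl, frob_dotNr).
by rewrite frob_dot_tr (frob_dotC A^T); lra.
Qed.

End weak_limits.

(** * The action and its minimisers *)

(** The letters e, x, b, f, r, v, w, p, g stand for the squared norms of E, chi, B, E - a Vbar, chi
    - B - aW Wbar, Vbar, Wbar, V0 and grad V0, and P, Q for the pairings of V0 with E and of grad V0
    with chi. Multiplying the last five hypotheses in turn by 16 D a, 1, 2 D a / aW, 8 and 8 D a /
    aW and adding cancels P, Q, f and r. Dividing the outcome by 5 or by 4 D a / aW gives the
    coefficients of [bound_E] and [bound_chi]. *)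
Lemma energy_inequality (R : realFieldType) (D a aW nu e f v w p g x b r P Q : R) :
  0 < D -> 0 < a -> 0 < aW ->
  f / (2 * (D * a)) + P + 2 * nu * Q + (2 * aW)^-1 * r - (a / 2 * v + aW / 2 * w) <= 0 ->
  0 <= e + 16 * D * a * P + 64 * D ^+ 2 * a ^+ 2 * p ->
  0 <= x + 16 * aW * nu * Q + 64 * aW ^+ 2 * nu ^+ 2 * g ->
  3 / 4 * e - 3 * a ^+ 2 * v <= f ->
  3 / 4 * x - 6 * b - 6 * aW ^+ 2 * w <= r ->
  5 * e + 4 * (D * a / aW) * x <= 8 * a ^+ 2 * (3 + D) * v + 64 * D ^+ 2 * a ^+ 2 * p +
    128 * D * a * aW * nu ^+ 2 * g + 56 * D * a * aW * w + 48 * (D * a / aW) * b.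
Proof.
move=> D0 a0 aW0 h1 h2 h3 h4 h5.
have k0 : 0 < D * a / aW by rewrite divr_gt0 ?mulr_gt0.
have {}h1 : 8 * f + 16 * D * a * P + 32 * D * a * nu * Q + 8 * (D * a / aW) * r
    - 8 * D * a ^+ 2 * v - 8 * D * a * aW * w <= 0.
  have := ler_wpM2l (ltW (mulr_gt0 (@ltr0Sn R 15) (mulr_gt0 D0 a0))) h1.
  rewrite mulr0; congr (_ <= _); field; rewrite !gt_eqF//.
have {}h3 : 0 <= 2 * (D * a / aW) * x + 32 * D * a * nu * Q + 128 * D * a * aW * nu ^+ 2 * g.
  have := mulr_ge0 (ltW (mulr_gt0 (@ltr0Sn R 1) k0)) h3.
  by congr (_ <= _); field; rewrite gt_eqF.
have {}h5 : 6 * (D * a / aW) * x - 48 * (D * a / aW) * b - 48 * D * a * aW * w <=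
    8 * (D * a / aW) * r.
  have := ler_wpM2l (ltW (mulr_gt0 (@ltr0Sn R 7) k0)) h5.
  by congr (_ <= _); field; rewrite gt_eqF.
have -> : 8 * a ^+ 2 * (3 + D) * v = 24 * a ^+ 2 * v + 8 * D * a ^+ 2 * v by ring.
by move: (D * a / aW) k0 h1 h3 h5 => k k0 h1 h3 h5; lra.
Qed.

Section sublevel_sets.
Variables (R : realType) (d : nat) (T aV aW alpha : R).
Variables (Vbar : R * 'rV[R]_d -> 'rV[R]_d) (Wbar : R * 'rV[R]_d -> 'M[R]_d).
Variables (V0 : 'rV[R]_d -> 'rV[R]_d) (G0 : 'rV[R]_d -> 'M[R]_d).
Hypotheses (T0 : 0 < T) (aV0 : 0 < aV) (aW0 : 0 < aW) (alpha0 : 0 < alpha).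
Local Notation mu := (spacetime_measure T d).
Local Notation L2 := (in_Lp mu 2%:E).
Hypotheses (LVbar : L2 Vbar) (LWbar : L2 Wbar).
Hypotheses (LV0 : in_Lp (torus_measure R d) 2%:E V0)
  (LG0 : in_Lp (torus_measure R d) 2%:E G0).
Local Notation V0f := (fun z : R * 'rV[R]_d => V0 z.2).
Local Notation G0f := (fun z : R * 'rV[R]_d => G0 z.2).
Local Notation a := (a_ aV alpha).
Local Notation action := (action T aV aW alpha Vbar Wbar V0 G0).
Local Notation ext_action := (ext_action T aV aW alpha Vbar Wbar V0 G0).
Implicit Types (u v : dual_triple R d).

Let LV0f : L2 V0f. Proof. exact: L2_space_field. Qed.
Let LG0f : L2 G0f. Proof. exact: L2_space_field. Qed.

Lemma a_gt0 nu : 0 < a nu.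
Proof. by rewrite /a_ ltr_wpDr// powR_ge0. Qed.

Lemma a_0 : a 0 = aV.
Proof. by rewrite /a_ powR0 ?addr0// gt_eqF. Qed.

Lemma a_le nu nu' : 0 <= nu <= nu' -> a nu <= a nu'.
Proof.
move=> /andP[n0 nn]; rewrite lerD2l ge0_ler_powR// ?nnegrE// ?(ltW alpha0)//.
exact: le_trans nn.
Qed.

Lemma in_L2_Loo_L2_L2 u : in_L2_Loo_L2 T u ->
  [/\ L2 (dualE u), L2 (dualB u) & L2 (dualchi u)].
Proof.
move=> [LE LooB Lchi _ _]; split=> //.
exact: (Loo_L2 (spacetime_fin d T0) (spacetime_gt0 d T0)).
Qed.

Definition resid u z : 'M[R]_d := dualchi u z - dualB u z - aW *: Wbar z.

(** The action without its kinetic supremum: always a real number, so the value +oo can only come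
    from [calM]. *)
Definition rest nu u : R := ip mu V0f (dualE u) + 2 * nu * ip mu G0f (dualchi u)
  + (2 * aW)^-1 * ip mu (resid u) (resid u)
  - (a nu / 2 * ip mu Vbar Vbar + aW / 2 * ip mu Wbar Wbar).

Definition shifted nu u z : 'rV[R]_d := dualE u z - a nu *: Vbar z.

Definition sublevel nu u (c : R) : Prop := forall Z M, admissible T Z M ->
  kin T (shifted nu u) (Nmx (a nu) (dualB u)) Z M + rest nu u <= c.

Lemma resid_L2 u : in_L2_Loo_L2 T u -> L2 (resid u).
Proof.
by move=> /in_L2_Loo_L2_L2[_ LB Lc]; apply: L2B; [exact: L2B|exact: L2Z].
Qed.

Lemma shifted_L2 nu u : in_L2_Loo_L2 T u -> L2 (shifted nu u).
Proof. by move=> /in_L2_Loo_L2_L2[LE _ _]; apply: L2B => //; exact: L2Z. Qed.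

Lemma actionE nu u : in_L2_Loo_L2 T u -> action nu u =
  (calM T (shifted nu u) (Nmx (a nu) (dualB u)) + (rest nu u)%:E)%E.
Proof.
move=> hu; have [LE LB Lc] := in_L2_Loo_L2_L2 hu; have Lr := resid_L2 hu.
case: u hu LE LB Lc Lr => E B chi hu LE LB Lc Lr.
rewrite /Defs.action /rest -!addeA -!EFinD; congr (_ + _%:E)%E.
rewrite RintD; [|exact: L2_intg|by apply: intgZ; exact: L2_intg].
rewrite RintZ; last exact: L2_intg.
rewrite -!addrA; congr (_ + (_ + (_ - _))).
  rewrite -RintZ; last exact: L2_intg.
  by apply: eq_Rintegral => z _; rewrite sqr_frobenius.
rewrite -!RintZ; [|exact: L2_intg..].
rewrite -RintD; [|by apply: intgZ; exact: L2_intg..].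
by apply: eq_Rintegral => z _; rewrite !sqr_frobenius.
Qed.

Lemma action_leP nu u (c : R) : in_L2_Loo_L2 T u ->
  (action nu u <= c%:E)%E <-> sublevel nu u c.
Proof.
move=> hu; have [LE LB Lc] := in_L2_Loo_L2_L2 hu.
rewrite actionE// -leeBrDr// -EFinB.
split=> [/calM_leP h Z M adm|h].
  by rewrite -lerBrDr; apply: h => //; [exact: shifted_L2|exact: Nmx_L2].
apply/calM_leP => //; [exact: shifted_L2|exact: Nmx_L2|].
by move=> Z M adm; rewrite lerBrDr; exact: h.
Qed.

Lemma kin_affine nu u Z M : in_L2_Loo_L2 T u -> admissible T Z M ->
  kin T (shifted nu u) (Nmx (a nu) (dualB u)) Z M =
  ip mu (dualE u) Z - a nu * ip mu Vbar Z - a nu / 2 * ip mu (@idf R d) M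
  - ip mu (dualB u) M.
Proof.
move=> /in_L2_Loo_L2_L2[LE LB _] adm; have [LZ LM] := admissible_L2 T0 adm.
rewrite /kin ip_Nmx// (ipBl LE (L2Z _ LVbar) LZ) ipZl//.
by field.
Qed.

Definition zero_triple : dual_triple R d := DualTriple (fun=> 0) (fun=> 0) (fun=> 0).

Lemma ip0l m n (G : R * 'rV[R]_d -> 'M[R]_(m, n)) : ip mu (fun=> 0) G = 0.
Proof.
by rewrite /ip; under eq_Rintegral do rewrite frob_dot0l; rewrite Rintegral_cst// mul0r.
Qed.

Lemma zero_triple_EBPsi nu : EBPsi T nu zero_triple.
Proof.
apply/(EBPsiP T0); split.
  have L0 m n : in_Lp mu +oo%E (fun=> 0 : 'M[R]_(m, n)).
    by apply: continuous_Loo => // i j z; exact: cvg_cst.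
  by split; [exact: L2_0|exact: L0|exact: L2_0|..]; apply: nearW => z; rewrite trmx0.
by move=> psi q _ _; rewrite /weak_form /= !ip0l; ring.
Qed.

(** The kinetic part is at most (a / 2) |Vbar|^2 by [kin_scalar], and the residual term equals (aW /
    2) |Wbar|^2; these are exactly the two constants subtracted in the action. *)
Lemma zero_triple_sublevel nu : sublevel nu zero_triple 0.
Proof.
move=> Z M adm; have [hu _] := zero_triple_EBPsi nu.
rewrite kin_affine//= ip0l ip0l /rest /= !(ipC mu _ (fun=> 0)) !ip0l.
have -> : ip mu (resid zero_triple) (resid zero_triple) = aW ^+ 2 * ip mu Wbar Wbar.
  rewrite expr2 -mulrA -ipZr// -ipZl//; last exact: L2Z.
  by apply: eq_Rintegral => z _; rewrite /resid /= subrr sub0r frob_dotNl frob_dotNr opprK.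
have := kin_scalar T0 (a_gt0 nu) (L2Z (- a nu) LVbar) adm.
have [LZ LM] := admissible_L2 T0 adm.
have an0 : a nu != 0 by rewrite gt_eqF ?a_gt0.
rewrite (ipZl _ LVbar (L2Z _ LVbar)) ipZl// ipZr//.
have -> : - a nu * (- a nu * ip mu Vbar Vbar) / (2 * a nu) = a nu / 2 * ip mu Vbar Vbar.
  by field.
have -> : (2 * aW)^-1 * (aW ^+ 2 * ip mu Wbar Wbar) = aW / 2 * ip mu Wbar Wbar.
  by field; rewrite gt_eqF.
by move: (a nu / 2 * ip mu Vbar Vbar) (aW / 2 * _) (a nu / 2 * _) => *; lra.
Qed.

(** A finite level for one competitor makes the minimum finite, which places the minimiser in the
    class of parameter nu itself and not merely in the union. *)
Lemma minimiser_sublevel nu u v (c : R) : 0 <= nu ->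
  is_minimiser (EBPsi_union T) (ext_action nu) u ->
  EBPsi T nu v -> sublevel nu v c -> EBPsi T nu u /\ sublevel nu u c.
Proof.
move=> nu0 [_ hu] vE vc.
have := hu v (ex_intro2 _ _ nu nu0 vE); rewrite /Defs.ext_action (asboolT vE).
have vc' : (action nu v <= c%:E)%E by apply/action_leP => //; exact: vE.1.
case: asboolP => [uE h|_ /le_trans /(_ vc')]; last by rewrite leNgt ltry.
by split=> //; apply/action_leP; [exact: uE.1|exact: le_trans h vc'].
Qed.

(** * A priori bounds for triples of non-positive action *)

Section bounds.
Variables (nu : R) (u : dual_triple R d).
Hypotheses (d2 : (2 <= d)%N) (uE : EBPsi T nu u) (us : sublevel nu u 0).
Local Notation D := (d%:R : R).

Let hu : in_L2_Loo_L2 T u. Proof. by case: uE. Qed.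
Let LE : L2 (dualE u). Proof. by have [] := in_L2_Loo_L2_L2 hu. Qed.
Let LB : L2 (dualB u). Proof. by have [] := in_L2_Loo_L2_L2 hu. Qed.
Let Lc : L2 (dualchi u). Proof. by have [] := in_L2_Loo_L2_L2 hu. Qed.
Let D0 : 0 < D. Proof. by rewrite ltr0n; case: d d2. Qed.
Let D2 : 2 <= D. Proof. by rewrite ler_nat. Qed.

(** As tr B = 0, |N|^2 = D a^2 + 4 |B|^2, and |N|^2 <= (tr N)^2 = D^2 a^2 leaves 4 |B|^2 <= D (D -
    1) a^2. The second half bounds N by its Frobenius norm. *)
Lemma sublevel_pointwise : {ae mu, forall z,
  4 * frob_dot (dualB u z) (dualB u z) <= D * (D - 1) * a nu ^+ 2 /\
  forall xi, qform (Nmx (a nu) (dualB u) z) xi <= D * a nu * frob_dot xi xi}.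
Proof.
have h Z M : admissible T Z M ->
    kin T (shifted nu u) (Nmx (a nu) (dualB u)) Z M <= - rest nu u.
  by move=> /us; lra.
have hp := probe_ae_ge0 T0 (Nmx_L2 T0 (a nu) LB) h.
have [_ _ _ sB _] := hu.
apply: (ae_imp (ae_and hp (ae_and sB (trace_free T0 uE)))) => z [{}hp [{}sB trB]].
have sN : (Nmx (a nu) (dualB u) z)^T = Nmx (a nu) (dualB u) z.
  by rewrite /Nmx linearD linearZ /= tr_scalar_mx sB.
have trN : \tr (Nmx (a nu) (dualB u) z) = D * a nu.
  by rewrite /Nmx linearD linearZ /= mxtrace_scalar trB mulr0 addr0 mulr_natl.
have [_] := frob_le_trace sN hp; rewrite trN => hN; split; last first.
  by move=> xi; apply: qform_le_trace => //; rewrite mulr_ge0// ltW// a_gt0.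
move: hN; rewrite /Nmx frob_dotDl !frob_dotDr !frob_dotZl !frob_dotZr (frob_dotC _ _%:M).
rewrite !frob_dot_trace mxtrace_scalar trB -mulr_natl.
by move: (frob_dot _ _) (a nu) => x y; nra.
Qed.

Lemma sublevel_bound_B : Lp_norm mu +oo%E (dualB u) <= bound_B d aV alpha nu.
Proof.
have [_ LooB _ _ _] := hu.
apply: Loo_norm_le => //; first exact: (spacetime_gt0 d T0).
apply: (ae_imp sublevel_pointwise) => z [h _]; rewrite /bound_B.
have b0 : 0 <= Num.sqrt D * ((D - 1) / 2) * a nu.
  have D1 : 0 <= (D - 1) / 2 by have := D2; lra.
  by rewrite mulr_ge0 ?(ltW (a_gt0 _))// mulr_ge0 ?sqrtr_ge0.
rewrite -(@ler_pXn2r _ 2)// ?nnegrE ?frobenius_ge0// sqr_frobenius.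
rewrite !exprMn sqr_sqrtr ?ler0n//.
have A0 := sqr_ge0 (a nu); move: (a nu ^+ 2) A0 h => A A0 h.
(* Since D - 1 >= 1, the pointwise estimate is weakened to the factor (D - 1)^2 that appears in
   [bound_B]. *)
have h2 : D * (D - 1) * A <= D * (D - 1) * (D - 1) * A.
  have D1 : 0 <= D - 1 by have := D2; lra.
  have t0 := mulr_ge0 (mulr_ge0 (ltW D0) D1) A0.
  by move: D D0 D2 t0 => D' *; nra.
have -> : D * ((D - 1) ^+ 2 * 2^-1 ^+ 2) * A = D * (D - 1) * (D - 1) * A / 4 by field.
by lra.
Qed.

(** The level bound is combined with squares: those of E + 8 D a V0 and chi + 8 aW nu grad V0 absorb
    the linear terms, and that of E / 2 - 2 a Vbar gives |E - a Vbar|^2 >= (3/4) |E|^2 - 3 a^2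
    |Vbar|^2. *)
Lemma sublevel_energy :
  5 * ip mu (dualE u) (dualE u) + 4 * (D * a nu / aW) * ip mu (dualchi u) (dualchi u) <=
  8 * a nu ^+ 2 * (3 + D) * ip mu Vbar Vbar + 64 * D ^+ 2 * a nu ^+ 2 * ip mu V0f V0f +
  128 * D * a nu * aW * nu ^+ 2 * ip mu G0f G0f + 56 * D * a nu * aW * ip mu Wbar Wbar +
  48 * (D * a nu / aW) * ip mu (dualB u) (dualB u).
Proof.
have h Z M : admissible T Z M ->
    kin T (shifted nu u) (Nmx (a nu) (dualB u)) Z M <= - rest nu u.
  by move=> /us; lra.
have Da0 : 0 < D * a nu by rewrite mulr_gt0// a_gt0.
have hc := kin_coercive T0 (shifted_L2 nu hu) (Nmx_L2 T0 (a nu) LB) h Da0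
  (ae_imp sublevel_pointwise (fun z => @proj2 _ _)).
apply: (@energy_inequality _ D (a nu) aW nu _ (ip mu (shifted nu u) (shifted nu u)) _ _ _ _ _
  _ (ip mu (resid u) (resid u)) (ip mu V0f (dualE u)) (ip mu G0f (dualchi u))) => //.
- exact: a_gt0.
- by move: hc; rewrite /rest; lra.
- have := ip_ge0 mu (fun z => dualE u z + (8 * D * a nu) *: V0f z).
  rewrite (ipDD LE (L2Z _ LV0f)) (ipZr _ LE LV0f) (ipZl _ LV0f (L2Z _ LV0f)) ipZr//.
  by rewrite (ipC mu (dualE u)); congr (_ <= _); ring.
- have := ip_ge0 mu (fun z => dualchi u z + (8 * aW * nu) *: G0f z).
  rewrite (ipDD Lc (L2Z _ LG0f)) (ipZr _ Lc LG0f) (ipZl _ LG0f (L2Z _ LG0f)) ipZr//.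
  by rewrite (ipC mu (dualchi u)); congr (_ <= _); ring.
- have := ip_ge0 mu (fun z => 2^-1 *: dualE u z - (2 * a nu) *: Vbar z).
  rewrite (ipBB (L2Z _ LE) (L2Z _ LVbar)) (ipZr _ (L2Z _ LE) LVbar) (ipZl _ LE LVbar).
  rewrite (ipZl _ LE (L2Z _ LE)) (ipZr _ LE LE) (ipZl _ LVbar (L2Z _ LVbar)) (ipZr _ LVbar LVbar).
  rewrite /shifted (ipBB LE (L2Z _ LVbar)) (ipZr _ LE LVbar) (ipZl _ LVbar (L2Z _ LVbar)).
  rewrite (ipZr _ LVbar LVbar).
  by move: (ip mu _ _) (ip mu _ _) (ip mu _ _) => *; lra.
(* Two squares: that of chi / 2 - 2 Y gives |chi - Y|^2 >= (3/4) |chi|^2 - 3 |Y|^2, and that of B -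
   aW Wbar gives |Y|^2 <= 2 |B|^2 + 2 aW^2 |Wbar|^2. *)
- pose Y z := dualB u z + aW *: Wbar z; have LaW := L2Z aW LWbar.
  have LY : L2 Y by exact: L2D.
  have -> : resid u = fun z => dualchi u z - Y z.
    by apply/funext => z; rewrite /resid /Y opprD addrA.
  have h1 := ip_ge0 mu (fun z => 2^-1 *: dualchi u z - 2 *: Y z); move: h1.
  rewrite (ipBB (L2Z _ Lc) (L2Z _ LY)) (ipZr _ (L2Z _ Lc) LY) (ipZl _ Lc LY).
  rewrite (ipZl _ Lc (L2Z _ Lc)) (ipZr _ Lc Lc) (ipZl _ LY (L2Z _ LY)) (ipZr _ LY LY).
  rewrite (ipBB Lc LY).
  have h2 := ip_ge0 mu (fun z => dualB u z - aW *: Wbar z); move: h2.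
  have -> : ip mu Y Y = ip mu (dualB u) (dualB u) + 2 * (aW * ip mu (dualB u) Wbar) +
      aW * (aW * ip mu Wbar Wbar).
    by rewrite (ipDD LB LaW) (ipZl _ LWbar LaW) !ipZr.
  rewrite (ipBB LB LaW) (ipZl _ LWbar LaW) !ipZr//.
  by move: (ip mu _ _) (ip mu _ _) (ip mu _ _) (ip mu _ _) => *; lra.
Qed.

Lemma sublevel_ip_B : ip mu (dualB u) (dualB u) <= D * (D - 1) * a nu ^+ 2 / 4 * T.
Proof.
have -> : D * (D - 1) * a nu ^+ 2 / 4 * T = \int[mu]_z (D * (D - 1) * a nu ^+ 2 / 4).
  by rewrite Rintegral_cst//= (spacetime_measureT d T0).
apply: ae_le_Rint; [exact: L2_intg|exact: intg_cst (spacetime_fin d T0) _|].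
by apply: (ae_imp sublevel_pointwise) => z [h _]; lra.
Qed.

Let torus_volume : fine (torus_measure R d setT) = 1.
Proof. by rewrite torus_measureT. Qed.

Let ip_B_le : ip mu (dualB u) (dualB u) <= (D - 1) ^+ 2 * D * a nu ^+ 2 / 4 * T.
Proof.
apply: le_trans sublevel_ip_B _; rewrite ler_wpM2r ?(ltW T0)// ler_wpM2r//.
rewrite ler_wpM2r ?sqr_ge0// mulrC ler_wpM2r ?(ltW D0)//.
by have := D2; move: D => x; nra.
Qed.

(** The term in chi is dropped from [sublevel_energy] and the rest divided by 5. *)
Lemma sublevel_bound_E : Lp_norm mu 2%:E (dualE u) ^+ 2 <=
  bound_E T aV aW alpha Vbar Wbar V0 G0 nu.
Proof.
rewrite /bound_E torus_volume !Lp_norm_sqr//.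
have k0 : 0 < D * a nu / aW by rewrite !divr_gt0 ?mulr_gt0 ?a_gt0.
have hB := ler_wpM2l (ltW k0) ip_B_le.
have hx := mulr_ge0 (ltW k0) (ip_ge0 mu (dualchi u)).
have := sublevel_energy.
have e1 : 12 * a nu ^+ 3 / (5 * aW) * (D - 1) ^+ 2 * D ^+ 2 * 1 * T =
  (48 / 5) * (D * a nu / aW * ((D - 1) ^+ 2 * D * a nu ^+ 2 / 4 * T)).
  by field; rewrite gt_eqF.
rewrite e1; move: hB hx.
move: (D * a nu / aW * (_ / 4 * T)) => s.
rewrite -!mulrA; move: (ip mu _ _) (ip mu _ _) (ip mu _ _) (ip mu _ _) (ip mu _ _) (ip mu _ _) (ip mu _ _).
by move=> *; lra.
Qed.

(** The term in E is dropped from [sublevel_energy] and the rest divided by 4 D a / aW. *)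
Lemma sublevel_bound_chi : Lp_norm mu 2%:E (dualchi u) ^+ 2 <=
  bound_chi T aV aW alpha Vbar Wbar V0 G0 nu.
Proof.
rewrite /bound_chi torus_volume !Lp_norm_sqr//.
have k0 : 0 < 4 * (D * a nu / aW) by rewrite mulr_gt0// !divr_gt0 ?mulr_gt0 ?a_gt0.
rewrite -(ler_pM2l k0); have an0 := a_gt0 nu.
have hB := ler_wpM2l (ltW k0) ip_B_le.
have he := ip_ge0 mu (dualE u).
have := sublevel_energy; move: hB he.
move: (ip mu _ _) (ip mu _ _) (ip mu _ _) (ip mu _ _) (ip mu _ _) (ip mu _ _) (ip mu _ _).
move=> w g p v x e b hB he h.
have -> : 4 * (D * a nu / aW) *
  (2 * (3 + D) / D * a nu * aW * v + 14 * aW ^+ 2 * w + 16 * D * a nu * aW * p +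
   32 * aW ^+ 2 * nu ^+ 2 * g + 3 * a nu ^+ 2 * (D - 1) ^+ 2 * D * 1 * T) =
  8 * a nu ^+ 2 * (3 + D) * v + 64 * D ^+ 2 * a nu ^+ 2 * p + 128 * D * a nu * aW * nu ^+ 2 * g
  + 56 * D * a nu * aW * w + 12 * (4 * (D * a nu / aW) * ((D - 1) ^+ 2 * D * a nu ^+ 2 / 4 * T)).
  by field; rewrite !gt_eqF.
by move: (D * a nu / aW) k0 hB h => *; lra.
Qed.

End bounds.

(** Monotonicity places every minimiser with nu <= nu0 in the single bounded set attached to nu0. *)
Lemma bounds_le nu nu' : (2 <= d)%N -> 0 <= nu <= nu' ->
  [/\ bound_E T aV aW alpha Vbar Wbar V0 G0 nu <= bound_E T aV aW alpha Vbar Wbar V0 G0 nu',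
      bound_chi T aV aW alpha Vbar Wbar V0 G0 nu <= bound_chi T aV aW alpha Vbar Wbar V0 G0 nu' &
      bound_B d aV alpha nu <= bound_B d aV alpha nu'].
Proof.
move=> d2 hn; have an := a_le hn; have a0 := a_gt0 nu; have a0' := a_gt0 nu'.
have /andP[n0 nn] := hn.
have D2 : 2 <= d%:R :> R by rewrite ler_nat.
have D0 : 0 <= d%:R :> R by rewrite ler0n.
have D1 : 0 <= d%:R - 1 :> R by lra.
have a2 : a nu ^+ 2 <= a nu' ^+ 2 by rewrite lerXn2r// nnegrE ltW.
have a3 : a nu ^+ 3 <= a nu' ^+ 3 by rewrite lerXn2r// nnegrE ltW.
have n2 : nu ^+ 2 <= nu' ^+ 2 by rewrite lerXn2r ?nnegrE// (le_trans n0).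
have anu2 : a nu * nu ^+ 2 <= a nu' * nu' ^+ 2 by rewrite ler_pM ?sqr_ge0// ltW.
rewrite /bound_E /bound_chi /bound_B torus_measureT /=.
set v := Lp_norm mu 2%:E Vbar; set w := Lp_norm mu 2%:E Wbar.
set p := Lp_norm mu 2%:E V0f; set g := Lp_norm mu 2%:E G0f.
have v0 := sqr_ge0 v; have w0 := sqr_ge0 w; have p0 := sqr_ge0 p; have g0 := sqr_ge0 g.
move: (v ^+ 2) (w ^+ 2) (p ^+ 2) (g ^+ 2) v0 w0 p0 g0 => {}v {}w {}p {}g v0 w0 p0 g0.
have i0 : 0 <= aW^-1 by rewrite invr_ge0 ltW.
have aW0' := ltW aW0; have T0' := ltW T0.
have s0 : 0 <= (d%:R - 1) ^+ 2 * d%:R ^+ 2 * T :> R by rewrite !mulr_ge0 ?sqr_ge0.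
split.
- rewrite lerD// ?lerD//.
  + by rewrite !ler_wpM2r// ?ler_wpM2l//; lra.
  + by rewrite ler_wpM2r// ler_wpM2l// !mulr_ge0//.
  + by rewrite ler_wpM2r// ler_wpM2l// !mulr_ge0// sqr_ge0.
  + rewrite ler_wpM2r//.
    have e x y : 128 / 5 * d%:R * x * aW * y = 128 / 5 * d%:R * aW * (x * y) by ring.
    by rewrite !e ler_wpM2l// !mulr_ge0.
  + have e x : 12 * x / (5 * aW) * (d%:R - 1) ^+ 2 * d%:R ^+ 2 * 1 * T =
      (12 / 5 * aW^-1 * ((d%:R - 1) ^+ 2 * d%:R ^+ 2 * T)) * x by field; rewrite gt_eqF.
    by rewrite !e ler_wpM2l// !mulr_ge0.
- rewrite lerD// ?lerD//.
  + by rewrite ler_wpM2r// ler_wpM2r// ler_wpM2l// !mulr_ge0// ?invr_ge0// addr_ge0.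
  + by rewrite ler_wpM2r// ler_wpM2r// ler_wpM2l// !mulr_ge0.
  + by rewrite ler_wpM2r// ler_wpM2l// !mulr_ge0// sqr_ge0.
  + by rewrite !ler_wpM2r// ?sqr_ge0// ler_wpM2l.
- by rewrite ler_wpM2l// !mulr_ge0// ?sqrtr_ge0.
Qed.

Lemma minimiser_bounded nu0 nu u : (2 <= d)%N -> 0 <= nu <= nu0 ->
  is_minimiser (EBPsi_union T) (ext_action nu) u ->
  EBPsi_w T aV aW alpha Vbar Wbar V0 G0 nu0 u.
Proof.
move=> d2 hn; have /andP[n0 _] := hn => hu.
have [uE us] := minimiser_sublevel n0 hu (zero_triple_EBPsi nu) (@zero_triple_sublevel nu).
have [bE bc bB] := bounds_le d2 hn.
split; first by exists nu.
split; first exact: uE.1.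
- exact: le_trans (sublevel_bound_E d2 uE us) bE.
- exact: le_trans (sublevel_bound_chi d2 uE us) bc.
- exact: le_trans (sublevel_bound_B d2 uE us) bB.
Qed.

Lemma cvg_a (nus : nat -> R) : (forall k, 0 < nus k) -> nus @ \oo --> 0 ->
  (fun k => a (nus k)) @ \oo --> aV.
Proof.
move=> nus0 cnus; rewrite -[X in _ --> X]addr0; apply: cvgD; first exact: cvg_cst.
apply/cvg_seqP => e e0.
have [|N hN] := proj1 (cvg_seqP nus 0) cnus (e `^ alpha^-1); first exact: powR_gt0.
exists N => n /hN; rewrite !subr0 (ger0_norm (ltW (nus0 n))) ger0_norm ?powR_ge0// => h.
have -> : e = (e `^ alpha^-1) `^ alpha by rewrite -powRrM mulVf ?gt_eqF// powRr1 ?ltW.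
by apply: gt0_ltr_powR => //; rewrite nnegrE ?powR_ge0// ltW.
Qed.

(** With gap = a_nu - (1 - delta) aV, which is nu^alpha + delta aV > 0, the matrix N of the recovery
    triple is (1 - delta) (aV Id + 2 B) + gap Id, and its shifted field is (1 - delta) (E - aV Vbar)
    + (2 nu div chi - gap Vbar). The kinetic part splits accordingly: the first summand is bounded
    by the level of v, the second by [kin_scalar] with constant gap. *)
Lemma recovery_sublevel delta nu v chi c : 0 < delta <= 1 ->
  EBPsi T 0 v -> sublevel 0 v c -> elementary_field chi -> (forall z, (chi z)^T = chi z) ->
  sublevel nu (recovery delta nu v chi) ((1 - delta) * (c - rest 0 v)
    + ip mu (fun z => (2 * nu) *: div_chi chi z - (a nu - (1 - delta) * aV) *: Vbar z)
        (fun z => (2 * nu) *: div_chi chi z - (a nu - (1 - delta) * aV) *: Vbar z)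
        / (2 * (a nu - (1 - delta) * aV))
    + rest nu (recovery delta nu v chi)).
Proof.
move=> /andP[d0 d1] vE vc ec sc Z M adm.
have [hr _] := recovery_EBPsi T0 delta nu vE ec sc; have hv := vE.1.
have [LE LB _] := in_L2_Loo_L2_L2 hv; have LD := div_chi_L2 T0 ec.
have [LZ LM] := admissible_L2 T0 adm.
have g0 : 0 < a nu - (1 - delta) * aV.
  have p0 : 0 <= nu `^ alpha by exact: powR_ge0.
  by have := mulr_gt0 d0 aV0; rewrite /a_; lra.
set gap := a nu - (1 - delta) * aV in g0 *.
have LG : L2 (fun z => (2 * nu) *: div_chi chi z - gap *: Vbar z) by apply: L2B; exact: L2Z.
have := kin_scalar T0 g0 LG adm.
rewrite (ipBl (L2Z _ LD) (L2Z _ LVbar) LZ) (ipZl _ LD LZ) (ipZl _ LVbar LZ) => h1.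
have := vc Z M adm; rewrite (kin_affine 0 hv adm) a_0 => h2.
rewrite (kin_affine nu hr adm) lerD2r /=.
rewrite (ipDl (L2Z _ LE) (L2Z _ LD) LZ) (ipZl _ LE LZ) (ipZl _ LD LZ) (ipZl _ LB LM).
have d1' : 0 <= 1 - delta by lra.
have := ler_wpM2l d1' h2; move: h1; rewrite -/gap.
have -> : a nu = gap + (1 - delta) * aV by rewrite /gap subrK.
move: (ip mu (fun z => _ - _) _ / _) (rest 0 v) => q r0.
move: (ip mu _ _) (ip mu _ _) (ip mu _ _) (ip mu _ _) (ip mu _ _) => *; lra.
Qed.

(** Isolates the dependence on nu; the residual involves only B and chi, which in the recovery
    triple do not depend on nu. *)
Lemma rest_recovery delta nu v chi : in_L2_Loo_L2 T v -> elementary_field chi ->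
  rest nu (recovery delta nu v chi) = rest 0 (recovery delta 0 v chi)
    + 2 * nu * (ip mu V0f (div_chi chi) + ip mu G0f chi) - (a nu - aV) / 2 * ip mu Vbar Vbar.
Proof.
move=> hv ec; have [LE _ _] := in_L2_Loo_L2_L2 hv; have LD := div_chi_L2 T0 ec.
rewrite /rest a_0.
have -> : resid (recovery delta nu v chi) = resid (recovery delta 0 v chi) by [].
rewrite /= !(ipDr LV0f (L2Z _ LE) (L2Z _ LD)) !(ipZr _ LV0f LE) !(ipZr _ LV0f LD).
by field; rewrite gt_eqF.
Qed.

(** * Lower semicontinuity and minimality of the weak limit *)

Section limit.
Variables (nus : nat -> R) (w : nat -> dual_triple R d) (l : dual_triple R d).
Hypotheses (nus0 : forall k, 0 < nus k) (cnus : nus @ \oo --> 0).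
Hypotheses (hw : forall k, in_L2_Loo_L2 T (w k)) (hl : in_L2_Loo_L2 T l).
Hypotheses (wE : cvg_weakly T (fun k => dualE (w k)) (dualE l))
  (wB : cvg_weakly T (fun k => dualB (w k)) (dualB l))
  (wchi : cvg_weakly T (fun k => dualchi (w k)) (dualchi l)).

Let LlE : L2 (dualE l). Proof. by have [] := in_L2_Loo_L2_L2 hl. Qed.
Let LlB : L2 (dualB l). Proof. by have [] := in_L2_Loo_L2_L2 hl. Qed.
Let Llc : L2 (dualchi l). Proof. by have [] := in_L2_Loo_L2_L2 hl. Qed.

Lemma cvg_resid : cvg_weakly T (fun k => resid (w k)) (resid l).
Proof.
have E u H : in_L2_Loo_L2 T u -> L2 H ->
    ip mu (resid u) H = ip mu (dualchi u) H - ip mu (dualB u) H - aW * ip mu Wbar H.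
  move=> /in_L2_Loo_L2_L2[_ LB Lc] LH.
  by rewrite (ipBl (L2B Lc LB) (L2Z _ LWbar) LH) (ipBl Lc LB LH) ipZl.
move=> H LH; rewrite E//; under eq_fun do rewrite E//.
by apply: cvgB; [apply: cvgB; [exact: wchi|exact: wB]|exact: cvg_cst].
Qed.

(* Weak lower semicontinuity: the quadratic term is minorised by its tangent at l. *)
Lemma sublevel_limit (c : nat -> R) (c0 : R) : c @ \oo --> c0 ->
  (forall k, sublevel (nus k) (w k) (c k)) -> sublevel 0 l c0.
Proof.
move=> cc hc Z M adm; have [LZ LM] := admissible_L2 T0 adm.
pose f k := ip mu (dualE (w k)) Z - a (nus k) * ip mu Vbar Z
  - a (nus k) / 2 * ip mu (@idf R d) M - ip mu (dualB (w k)) M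
  + (ip mu (dualE (w k)) V0f + 2 * nus k * ip mu (dualchi (w k)) G0f
     + (2 * aW)^-1 * (2 * ip mu (resid (w k)) (resid l) - ip mu (resid l) (resid l))
     - (a (nus k) / 2 * ip mu Vbar Vbar + aW / 2 * ip mu Wbar Wbar)).
have fc k : f k <= c k.
  apply: le_trans (hc k Z M adm); rewrite (kin_affine _ (hw k) adm) lerD2l /rest.
  rewrite !(ipC mu V0f) !(ipC mu G0f) lerD2r lerD2l ler_wpM2l//.
    by rewrite invr_ge0 mulr_ge0// ltW.
  have Lr := resid_L2 (hw k); have Lrl := resid_L2 hl.
  by have := ip_ge0 mu (fun z => resid (w k) z - resid l z); rewrite ipBB//; lra.
have ca := cvg_a nus0 cnus.
have cf : f @ \oo --> kin T (shifted 0 l) (Nmx (a 0) (dualB l)) Z M + rest 0 l.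
  rewrite (kin_affine 0 hl adm) /rest a_0 !(ipC mu V0f) !(ipC mu G0f).
  have -> : ip mu (resid l) (resid l) =
    2 * ip mu (resid l) (resid l) - ip mu (resid l) (resid l) by ring.
  have cst (x : R) : (fun _ : nat => x) @ \oo --> x by exact: cvg_cst.
  have ca2 : (fun k => a (nus k) / 2) @ \oo --> aV / 2 by exact: cvgM.
  apply: cvgD.
    apply: cvgB; last exact: wB.
    apply: cvgB; last exact: cvgM.
    by apply: cvgB; [exact: wE|exact: cvgM].
  apply: cvgB; last by apply: cvgD => //; exact: cvgM.
  apply: cvgD; first (apply: cvgD; first exact: wE).
    by apply: cvgM; [exact: cvgM|exact: wchi].
  apply: cvgM => //; apply: cvgB => //; apply: cvgM => //.
  exact: (cvg_resid (resid_L2 hl)).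
by apply: (ler_cvg_to cf cc); exact: nearW.
Qed.

Hypothesis hmin : forall k v c, EBPsi T (nus k) v -> sublevel (nus k) v c ->
  sublevel (nus k) (w k) c.

(** For fixed delta and chi the gap tends to delta aV > 0 and 2 nu div chi to 0, so the perturbation
    energy tends to (delta aV)^2 |Vbar|^2 / (2 delta aV), the middle term of the level. *)
Lemma sublevel_recovery_limit delta v chi c : 0 < delta <= 1 ->
  EBPsi T 0 v -> sublevel 0 v c -> elementary_field chi -> (forall z, (chi z)^T = chi z) ->
  sublevel 0 l ((1 - delta) * (c - rest 0 v) + delta * aV / 2 * ip mu Vbar Vbar
    + rest 0 (recovery delta 0 v chi)).
Proof.
move=> hd vE vc ec sc; have LD := div_chi_L2 T0 ec; have /andP[d0 d1] := hd.
apply: sublevel_limit (fun k => hmin (recovery_EBPsi T0 delta (nus k) vE ec sc)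
  (recovery_sublevel (nus k) hd vE vc ec sc)).
have ca := cvg_a nus0 cnus.
have cst (x : R) : (fun _ : nat => x) @ \oo --> x by exact: cvg_cst.
have cg : (fun k => a (nus k) - (1 - delta) * aV) @ \oo --> delta * aV.
  rewrite [X in _ --> X](_ : _ = aV - (1 - delta) * aV); last by ring.
  exact: cvgB.
have dn0 : delta * aV != 0 by rewrite gt_eqF// mulr_gt0.
apply: cvgD; last first.
  rewrite [X in _ --> X](_ : _ = rest 0 (recovery delta 0 v chi) +
    2 * 0 * (ip mu V0f (div_chi chi) + ip mu G0f chi) - (aV - aV) / 2 * ip mu Vbar Vbar);
    last by ring.
  under eq_fun do rewrite (rest_recovery _ _ vE.1 ec).
  apply: cvgB; first by apply: cvgD => //; apply: cvgM => //; exact: cvgM.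
  by apply: cvgM => //; apply: cvgM => //; exact: cvgB.
apply: cvgD => //.
rewrite [X in _ --> X](_ : _ = (2 * 0 * (2 * 0 * ip mu (div_chi chi) (div_chi chi))
   - 2 * (2 * 0 * (delta * aV * ip mu (div_chi chi) Vbar))
   + delta * aV * (delta * aV * ip mu Vbar Vbar)) / (2 * (delta * aV)));
    last by field; rewrite !gt_eqF.
have -> : (fun k => ip mu
      (fun z => (2 * nus k) *: div_chi chi z - (a (nus k) - (1 - delta) * aV) *: Vbar z)
      (fun z => (2 * nus k) *: div_chi chi z - (a (nus k) - (1 - delta) * aV) *: Vbar z) /
      (2 * (a (nus k) - (1 - delta) * aV))) =
    (fun k => (2 * nus k * (2 * nus k * ip mu (div_chi chi) (div_chi chi))
   - 2 * (2 * nus k * ((a (nus k) - (1 - delta) * aV) * ip mu (div_chi chi) Vbar))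
   + (a (nus k) - (1 - delta) * aV) * ((a (nus k) - (1 - delta) * aV) * ip mu Vbar Vbar)) /
      (2 * (a (nus k) - (1 - delta) * aV))).
  apply/funext => k; congr (_ / _).
  rewrite (ipBB (L2Z _ LD) (L2Z _ LVbar)) (ipZl _ LD (L2Z _ LD)) (ipZr _ LD LD).
  rewrite (ipZl _ LD (L2Z _ LVbar)) (ipZr _ LD LVbar) (ipZl _ LVbar (L2Z _ LVbar)).
  by rewrite (ipZr _ LVbar LVbar).
have c2 : (fun k => 2 * nus k) @ \oo --> (2 * 0 : R) by exact: cvgM.
apply: cvgM; last by apply: cvgV; [rewrite mulf_neq0|exact: cvgM].
apply: cvgD; last by apply: cvgM => //; exact: cvgM.
apply: cvgB; first by apply: cvgM => //; exact: cvgM.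
by apply: cvgM => //; apply: cvgM => //; exact: cvgM.
Qed.

(** The levels of [sublevel_recovery_limit] no longer involve div chi, so smooth fields can approach
    chi in L^2 while delta = 1/(n+1) tends to 0; the level then tends to c. *)
Lemma limit_sublevel v c : EBPsi T 0 v -> sublevel 0 v c -> sublevel 0 l c.
Proof.
move=> vE vc Z M adm; have [LE LB Lc] := in_L2_Loo_L2_L2 vE.1.
have [s [es ss cs]] : exists s : nat -> R * 'rV[R]_d -> 'M[R]_d,
    [/\ forall k, elementary_field (s k), forall k z, (s k z)^T = s k z &
      (fun k => ip mu (fun z => s k z - dualchi v z) (fun z => s k z - dualchi v z))
        @ \oo --> 0].
  by apply: sym_elementary_dense => //; case: vE.1.
have Ls k := elementary_field_L2 T0 (es k).
pose del (n : nat) : R := n.+1%:R^-1.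
have del01 n : 0 < del n <= 1 by rewrite invr_gt0 ltr0Sn invf_le1 ?ler1n.
have cdel : del @ \oo --> 0 by exact: cvg_harmonic.
have h n := sublevel_recovery_limit (del01 n) vE vc (es n) (ss n) adm.
have cst (x : R) : (fun _ : nat => x) @ \oo --> x by exact: cvg_cst.
have c1 : (fun n => 1 - del n) @ \oo --> (1 : R).
  by rewrite -[X in _ --> X]subr0; exact: cvgB.
have cr : (fun n => ip mu (resid (recovery (del n) 0 v (s n)))
    (resid (recovery (del n) 0 v (s n)))) @ \oo --> ip mu (resid v) (resid v).
  have Lr n : L2 (resid (recovery (del n) 0 v (s n))).
    by apply: resid_L2; case: (recovery_EBPsi T0 (del n) 0 vE (es n) (ss n)).
  apply: cvg_ip_self => //; first exact: resid_L2 vE.1.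
  (* The residuals differ by (s n - chi) + del n B, whose squared norm is expanded. *)
  have -> : (fun n => ip mu
      (fun z => resid (recovery (del n) 0 v (s n)) z - resid v z)
      (fun z => resid (recovery (del n) 0 v (s n)) z - resid v z)) =
    (fun n => ip mu (fun z => s n z - dualchi v z) (fun z => s n z - dualchi v z)
      + 2 * (del n * (ip mu (s n) (dualB v) - ip mu (dualchi v) (dualB v)))
      + del n * (del n * ip mu (dualB v) (dualB v))).
    apply/funext => n; rewrite -(ipBl (Ls n) Lc LB) -(ipZr _ (L2B (Ls n) Lc) LB).
    rewrite -(ipZr _ LB LB) -(ipZl _ LB (L2Z _ LB)) -(ipDD (L2B (Ls n) Lc) (L2Z _ LB)).
    congr ip; apply/funext => z; rewrite /resid /=; apply/matrixP => i j; rewrite !mxE; ring.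
  rewrite [X in _ --> X](_ : _ = 0 + 2 * (0 * (ip mu (dualchi v) (dualB v)
    - ip mu (dualchi v) (dualB v))) + 0 * (0 * ip mu (dualB v) (dualB v))); last by ring.
  apply: cvgD; last by apply: cvgM => //; exact: cvgM.
  apply: cvgD => //; apply: cvgM => //; apply: cvgM => //; apply: cvgB => //.
  exact: cvg_ip.
have crest : (fun n => rest 0 (recovery (del n) 0 v (s n))) @ \oo --> rest 0 v.
  rewrite /rest; under eq_fun do rewrite mulr0 !mul0r addr0; rewrite mulr0 mul0r addr0.
  apply: cvgB => //; apply: cvgD; last exact: cvgM.
  rewrite [X in _ --> X](_ : _ = 1 * ip mu V0f (dualE v)); last by rewrite mul1r.
  have -> : (fun n => ip mu V0f (dualE (recovery (del n) 0 v (s n)))) =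
      (fun n => (1 - del n) * ip mu V0f (dualE v)).
    apply/funext => n; rewrite -(ipZr _ LV0f LE); congr ip; apply/funext => z /=.
    by rewrite mulr0 scale0r addr0.
  exact: cvgM.
have cR : (fun n => (1 - del n) * (c - rest 0 v) + del n * aV / 2 * ip mu Vbar Vbar
    + rest 0 (recovery (del n) 0 v (s n))) @ \oo --> c.
  rewrite [X in _ --> X](_ : _ = 1 * (c - rest 0 v) + 0 * aV / 2 * ip mu Vbar Vbar
    + rest 0 v); last by ring.
  by apply: cvgD => //; apply: cvgD; apply: cvgM => //; apply: cvgM => //; exact: cvgM.
by apply: (ler_cvg_to (cst _) cR); exact: nearW.
Qed.

End limit.

(** Reduces the comparison of two actions to their real sublevels. For y = -oo every real c
    qualifies, which forces x = -oo. *)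
Lemma lee_of_real_bounds (x y : \bar R) :
  (forall c : R, (y <= c%:E)%E -> (x <= c%:E)%E) -> (x <= y)%E.
Proof.
case: y => [r|_|h]; [exact|exact: leey|].
have {}h c : (x <= c%:E)%E by apply: h; exact: leNye.
case: x h => [r h|/(_ 0)//|//]; exfalso.
by have := h (r - 1); rewrite lee_fin; lra.
Qed.

Lemma limit_minimiser (nus : nat -> R) (w : nat -> dual_triple R d) l : (forall k, 0 < nus k) -> nus @ \oo --> 0 ->
  (forall k, is_minimiser (EBPsi_union T) (ext_action (nus k)) (w k)) ->
  in_L2_Loo_L2 T l ->
  cvg_weakly T (fun k => dualE (w k)) (dualE l) ->
  cvg_weakly T (fun k => dualB (w k)) (dualB l) ->
  cvg_weakly T (fun k => dualchi (w k)) (dualchi l) ->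
  EBPsi T 0 l /\ is_minimiser (EBPsi_union T) (ext_action 0) l.
Proof.
move=> nus0 cnus hw hl wE wB wc.
have hmin k v c : EBPsi T (nus k) v -> sublevel (nus k) v c ->
    EBPsi T (nus k) (w k) /\ sublevel (nus k) (w k) c.
  by apply: minimiser_sublevel => //; exact: ltW.
have wEB k : EBPsi T (nus k) (w k).
  by have [] := hmin k _ _ (zero_triple_EBPsi _) (@zero_triple_sublevel _).
have lE : EBPsi T 0 l.
  apply/(EBPsiP T0); split=> // psi q tpsi tq; have sq : smooth_periodic q by case: tq.
  apply: (weak_form_limit T0 cnus wE wB wc tpsi sq) => k.
  by have [_] := proj1 (EBPsiP T0 _ _) (wEB k); exact.
split=> //; split; first by exists 0 => //=.
move=> v _; rewrite /Defs.ext_action (asboolT lE); case: asboolP => [vE|_]; last exact: leey.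
apply: lee_of_real_bounds => c; rewrite (action_leP _ _ vE.1) (action_leP _ _ hl) => vc.
apply: (limit_sublevel nus0 cnus (fun k => (wEB k).1) hl wE wB wc) vE vc => k v' c' vE' vc'.
by have [] := hmin k v' c' vE' vc'.
Qed.

Lemma minimisers_converge (nu0 : R) (u : R -> dual_triple R d) : (2 <= d)%N -> 0 < nu0 ->
  (forall nu, 0 < nu <= nu0 -> is_minimiser (EBPsi_union T) (ext_action nu) (u nu)) ->
  exists (nuk : nat -> R) (u0 : dual_triple R d),
    [/\ forall k, 0 < nuk k <= nu0,
        nuk k @[k --> \oo] --> 0,
        is_minimiser (EBPsi_union T) (ext_action 0) u0 &
        cvg_EBPsi_w T aV aW alpha Vbar Wbar V0 G0 nu0 (fun k => u (nuk k)) u0].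
Proof.
move=> d2 nu00 hu.
pose nus k : R := nu0 / k.+1%:R.
have nus01 k : 0 < nus k <= nu0.
  by rewrite divr_gt0//= ler_pdivrMr// ler_peMr ?(ltW nu00)// ler1n.
have cnus : nus @ \oo --> 0.
  by rewrite -(mulr0 nu0); apply: cvgM; [exact: cvg_cst|exact: cvg_harmonic].
have hb k : EBPsi_w T aV aW alpha Vbar Wbar V0 G0 nu0 (u (nus k)).
  have /andP[n0 n1] := nus01 k.
  by apply: minimiser_bounded (hu _ (nus01 k)); rewrite // (ltW n0).
set bE := bound_E T aV aW alpha Vbar Wbar V0 G0 nu0.
set bc := bound_chi T aV aW alpha Vbar Wbar V0 G0 nu0.
have hL k : in_L2_Loo_L2 T (u (nus k)) by case: (hb k) => _ [].
have hE k : ip mu (dualE (u (nus k))) (dualE (u (nus k))) <= bE.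
  by case: (hb k) => _ [[LE _ _ _ _] h _ _]; rewrite -Lp_norm_sqr.
have hc k : ip mu (dualchi (u (nus k))) (dualchi (u (nus k))) <= bc.
  by case: (hb k) => _ [[_ _ Lc _ _] _ h _]; rewrite -Lp_norm_sqr.
have hB k : Lp_norm mu +oo%E (dualB (u (nus k))) <= bound_B d aV alpha nu0.
  by case: (hb k) => _ [].
have B0 : 0 <= bound_B d aV alpha nu0.
  have D2 : 2 <= d%:R :> R by rewrite ler_nat.
  have D1 : 0 <= (d%:R - 1) / 2 :> R by lra.
  by rewrite /bound_B mulr_ge0 ?(ltW (a_gt0 _))// mulr_ge0 ?sqrtr_ge0.
have max_ub_l (x y : R) : x <= Num.max x y by rewrite le_max lexx.
have max_ub_r (x y : R) : y <= Num.max x y by rewrite le_max lexx orbT.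
(* One common constant serves for the extraction; the separate bounds on the limit are recovered
   from [weak_limit_norm_le]. *)
have [s [l [[hs hl wE wB wc] aB]]] := triple_weak_compact T0 (C := Num.max bE bc) B0 hL
  (fun k => le_trans (hE k) (max_ub_l _ _)) (fun k => le_trans (hc k) (max_ub_r _ _)) hB.
pose nuk k := nus (s k).
have cnuk : nuk @ \oo --> 0 := cvg_subsequence hs cnus.
have nuk0 k : 0 < nuk k by case/andP: (nus01 (s k)).
have [lE lmin] := limit_minimiser nuk0 cnuk (fun k => hu _ (nus01 (s k))) hl wE wB wc.
have [LlE LlB Llc] := in_L2_Loo_L2_L2 hl.
exists nuk, l; split=> //; first by move=> k; exact: nus01.
split.
- by move=> k; exact: hb.
- split; first by exists 0 => //=.
  split=> //.
  + rewrite Lp_norm_sqr//; apply: (weak_limit_norm_le (fun k => _) (fun k => hE (s k)) LlE).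
      by move=> k; have [] := in_L2_Loo_L2_L2 (hL (s k)).
    exact: wE.
  + rewrite Lp_norm_sqr//; apply: (weak_limit_norm_le (fun k => _) (fun k => hc (s k)) Llc).
      by move=> k; have [] := in_L2_Loo_L2_L2 (hL (s k)).
    exact: wc.
  + by apply: Loo_norm_le => //; [exact: (spacetime_gt0 d T0)|case: hl].
- exact: wE.
- apply: weak_star wB _ aB => // k; first by have [] := in_L2_Loo_L2_L2 (hL (s k)).
  have [_ LooB _ _ _] := hL (s k).
  by apply: (ae_imp (Loo_ae (spacetime_gt0 d T0) LooB)) => z /le_trans; apply; exact: hB.
- exact: wc.
Qed.

End sublevel_sets.

Theorem theorem5p3 (R : realType) (d : nat) (hd : d = 2%N \/ d = 3%N)
  (T aV aW alpha : R) (hT : 0 < T) (haV : 0 < aV) (haW : 0 < aW)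
  (halpha : 0 < alpha < ((d./2 + 4)%N%:R)^-1)
  (Vbar : R * 'rV[R]_d -> 'rV[R]_d) (Wbar : R * 'rV[R]_d -> 'M[R]_d)
  (hVbar : in_Lp (spacetime_measure T d) 2%:E Vbar)
  (hWbar : in_Lp (spacetime_measure T d) 2%:E Wbar)
  (V0 : 'rV[R]_d -> 'rV[R]_d) (gradV0 : 'rV[R]_d -> 'M[R]_d)
  (hV0 : in_Lp (torus_measure R d) 2%:E V0)
  (hdivV0 : divergence_free V0) (hmeanV0 : zero_mean V0)
  (hgradV0 : is_weak_gradient V0 gradV0)
  (hgradV0L2 : in_Lp (torus_measure R d) 2%:E gradV0)
  (nu0 : R) (hnu0 : 0 < nu0) (u : R -> dual_triple R d)
  (hu : forall nu, 0 < nu <= nu0 ->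
    is_minimiser (EBPsi_union T)
      (ext_action T aV aW alpha Vbar Wbar V0 gradV0 nu) (u nu)) :
  exists (nuk : nat -> R) (u0 : dual_triple R d),
    [/\ forall k, 0 < nuk k <= nu0,
        nuk k @[k --> \oo] --> 0,
        is_minimiser (EBPsi_union T)
          (ext_action T aV aW alpha Vbar Wbar V0 gradV0 0) u0 &
        cvg_EBPsi_w T aV aW alpha Vbar Wbar V0 gradV0 nu0
          (fun k => u (nuk k)) u0].
Proof.
have /andP[alpha0 _] := halpha.
have d2 : (2 <= d)%N by case: hd => ->.
exact: minimisers_converge.
Qed.
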